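(* Let $n\ge2$ and let $A_1,\ldots,A_k$ be $n\times n$ matrices over $\mathbb{R}$ satisfying $\operatorname{Tr}(A_iA_j^T)=n\delta_{ij}$ for all $1\le i,j\le k$. Let $M$ be a random $n\times n$ orthogonal matrix, distributed according to Haar measure on the orthogonal group $\mathcal{O}_n$, and let $$X=(\operatorname{Tr}(A_1M),\operatorname{Tr}(A_2M),\ldots,\operatorname{Tr}(A_kM))\in\mathbb{R}^k .$$ Let $Z=(Z_1,\ldots,Z_k)$ be a random vector whose components are independent standard normal random variables. Then for every Lipschitz function $f:\mathbb{R}^k\to\mathbb{R}$, $$\left|\mathbb{E}f(X)-\mathbb{E}f(Z)\right|\le\frac{\sqrt2\,M_1(f)\,k}{n-1},$$ where $M_1(f)=\sup_{x\ne y}\frac{|f(x)-f(y)|}{|x-y|}$ is the Lipschitz constant of $f$.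
   Context: $\delta_{ij}$ is the Kronecker delta and $|\cdot|$ is the Euclidean norm on $\mathbb{R}^k$. *)

(* Defs.v *)
From HB Require Import structures.
From mathcomp Require Export all_boot all_order all_algebra.
From mathcomp Require Export all_classical all_reals all_analysis.

Set Implicit Arguments.
Unset Strict Implicit.
Unset Printing Implicit Defensive.

Import Order.TTheory GRing.Theory Num.Theory.
Import numFieldNormedType.Exports.

Local Open Scope classical_set_scope.
Local Open Scope ring_scope.

(* The library's norm on ['rV[R]_k] is the sup norm. *)
Definition euclidean_norm (R : realType) (k : nat) (x : 'rV[R]_k) : R :=
  Num.sqrt (\sum_(i < k) x 0 i ^+ 2).

Definition euclidean_lipschitz (R : realType) (k : nat) (f : 'rV[R]_k -> R) :
    Prop :=
  exists L : R, forall x y : 'rV[R]_k,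
    `|f x - f y| <= L * euclidean_norm (x - y).

(* [sup] is a total real-valued function, with value [0] on the empty set and
   on sets with no upper bound: this is the Lipschitz constant only under
   [euclidean_lipschitz f]. *)
Definition lipschitz_constant (R : realType) (k : nat) (f : 'rV[R]_k -> R) : R :=
  sup [set r : R | exists x y : 'rV[R]_k,
         x != y /\ r = `|f x - f y| / euclidean_norm (x - y)].

Notation borel_mx R n := (g_sigma_algebraType (@open 'M[R]_n)).

Definition orthogonal_group (R : realType) (n : nat) : set 'M[R]_n :=
  [set U | U *m U^T = 1%:M].

(* The Haar probability measure of the orthogonal group, seen as a Borel
   measure on the ambient space of matrices: it is carried by the group and
   invariant under left translations by its elements. *)
Definition haar_orthogonal (R : realType) (n : nat)
    (mu : set (borel_mx R n) -> \bar R) : Prop :=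
  mu (@orthogonal_group R n) = 1%E /\
  forall (U : 'M[R]_n) (B : set (borel_mx R n)),
    @orthogonal_group R n U -> measurable B ->
    mu [set U *m V | V in B] = mu B.

Definition mutually_independent (R : realType) (d : measure_display)
    (T : measurableType d) (P : probability T R) (k : nat)
    (Z : 'I_k -> {RV P >-> R}) : Prop :=
  forall (J : {set 'I_k}) (B : 'I_k -> set R),
    (forall i, measurable (B i)) ->
    P [set w | forall i, i \in J -> B i (Z i w)] =
    (\prod_(i in J) P (Z i @^-1` B i))%E.

Definition standard_normal (R : realType) (d : measure_display)
    (T : measurableType d) (P : probability T R) (Y : {RV P >-> R}) : Prop :=
  forall B : set R, measurable B -> distribution P Y B = normal_prob 0 1 B.

(* Main.v *)
Require Import Defs.
From mathcomp Require Import fingroup perm measurable_realfun ring lra.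

Set Implicit Arguments.
Unset Strict Implicit.
Unset Printing Implicit Defensive.

Import Order.TTheory GRing.Theory Num.Theory.
Import numFieldNormedType.Exports.

Local Open Scope classical_set_scope.
Local Open Scope ring_scope.

(** Write [X V] for the vector of the [Tr (A_i V)].  Interpolate by
    [Phi t = E g (cos t X + sin t Z)].  The Gaussian vector is integrated by
    parts coordinatewise.  The Haar measure is invariant under the rotations in
    the coordinate planes, so each generator [S = e_i e_j^T - e_j e_i^T] gives
    [E d/dt F (exp (t S) M) = 0]; summing over all planes, where the [S ^+ 2] add
    up to a multiple of the identity, yields
    [(n - 1) E <X, psi X> = E \sum_(l, m) d_m psi_l X (n delta_lm - Tr (M A_l M A_m))].
    Hence [(n - 1) Phi' t = - cos t sin t E <Hess, delta_lm - Tr (M A_l M A_m)>],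
    where one derivative of the Hessian is undone by a second Gaussian
    integration by parts, leaving only the Lipschitz constant of [g].  The fourth
    moments of the entries of [M] show
    [E (delta_lm - Tr (M A_l M A_m)) ^+ 2 <= 2], so that
    [`|Phi' t| <= sqrt 2 L k / (n - 1) * cos t], which integrates to the bound on
    [0, pi / 2].  A Lipschitz function is approximated uniformly by smooth ones by
    averaging over small segments in the coordinate directions. *)

(** * Integration and Lipschitz functions *)

(** Derivatives are carried as explicit quadratic remainders ([has_partial], [smooth1], [expands]).
    A bound [C * t ^+ 2] that is uniform in the point can be integrated as it stands, so each
    derivative under an integral sign costs one linear inequality. Two kinds of constants coexist.
    [C] only records finiteness and may be huge, since averaging over segments of length [delta]
    costs a factor [1 / delta]; it is measured in [l1norm], which adds up along coordinate steps.
    [L] is the Euclidean Lipschitz constant: averaging preserves it exactly, and it alone survives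
    in the bound. The factor [sqrt 2 * k] is the square root of the sum of [k ^ 2] second moments,
    each at most [2]. The factor [sin t] of the speed is used up by the second Gaussian integration
    by parts, which leaves [cos t] only. Haar integrals run over [orth] rather than over all
    matrices, because traces are bounded only on the group. *)

Section real_integrals.
Context d (T : measurableType d) (R : realType).
Variables (mu : {finite_measure set T -> \bar R}) (D : set T).
Hypothesis mD : measurable D.
Implicit Types F G : T -> R.

Definition rintegrable F := mu.-integrable D (EFin \o F).

Lemma rintegrable_measurable F : rintegrable F -> measurable_fun D F.
Proof. by move=> /measurable_int /measurable_EFinP. Qed.

Lemma rintegrable_cst c : rintegrable (fun=> c).
Proof. exact: finite_measure_integrable_cst. Qed.

Lemma rintegrableD F G : rintegrable F -> rintegrable G ->
  rintegrable (fun x => F x + G x).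
Proof. by move=> iF iG; exact: (integrableD mD iF iG). Qed.

Lemma rintegrableZ c F : rintegrable F -> rintegrable (fun x => c * F x).
Proof. by move=> iF; exact: (integrableZl mD c iF). Qed.

Lemma rintegrableB F G : rintegrable F -> rintegrable G ->
  rintegrable (fun x => F x - G x).
Proof. by move=> iF iG; exact: (integrableB mD iF iG). Qed.

Lemma rintegrable_sum (I : Type) (s : seq I) (F : I -> T -> R) :
  (forall i, rintegrable (F i)) -> rintegrable (fun x => \sum_(i <- s) F i x).
Proof.
move=> iF; elim: s => [|i s ih].
  by under eq_fun do rewrite big_nil; exact: rintegrable_cst.
under eq_fun do rewrite big_cons.
exact: rintegrableD.
Qed.

Lemma rintegrable_le F G : measurable_fun D F -> rintegrable G ->
  (forall x, D x -> `|F x| <= G x) -> rintegrable F.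
Proof.
move=> mF iG FG; apply: le_integrable iG => //; first exact/measurable_EFinP.
move=> x Dx; rewrite /= lee_fin (le_trans (FG x Dx))//; exact: ler_norm.
Qed.

Lemma Rintegral_sum (I : Type) (s : seq I) (F : I -> T -> R) :
  (forall i, rintegrable (F i)) ->
  \int[mu]_(x in D) (\sum_(i <- s) F i x) =
  \sum_(i <- s) \int[mu]_(x in D) F i x.
Proof.
move=> iF; elim: s => [|i s ih].
  rewrite big_nil; under eq_Rintegral do rewrite big_nil.
  by rewrite Rintegral_cst// mul0r.
under eq_Rintegral do rewrite big_cons.
rewrite RintegralD ?ih ?big_cons//; first exact: iF.
exact: (rintegrable_sum s iF).
Qed.

Lemma le_norm_Rintegral F K : rintegrable F -> rintegrable K ->
  (forall x, D x -> `|F x| <= K x) ->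
  `|\int[mu]_(x in D) F x| <= \int[mu]_(x in D) K x.
Proof.
move=> iF iK FK; apply: le_trans (le_normr_Rintegral mD iF) _.
apply: le_Rintegral => //.
apply: rintegrable_le iK _ => //; last by move=> x Dx; rewrite normr_id FK.
by apply: measurableT_comp => //; exact: rintegrable_measurable.
Qed.

(** Differentiation under the integral sign in quantitative form: the remainder bound is integrated
    and linearity does the rest. Derivatives pass through Haar and Gaussian integrals by this
    lemma. *)
Lemma Rintegral_first_order F0 F1 F' K t : rintegrable F0 -> rintegrable F1 ->
  rintegrable F' -> rintegrable K ->
  (forall x, D x -> `|F1 x - F0 x - t * F' x| <= K x) ->
  `|\int[mu]_(x in D) F1 x - \int[mu]_(x in D) F0 x
    - t * \int[mu]_(x in D) F' x| <= \int[mu]_(x in D) K x.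
Proof.
move=> i0 i1 i' iK h.
rewrite -RintegralZl// -RintegralB// -RintegralB//; last 2 first.
- exact: rintegrableB.
- exact: rintegrableZ.
apply: le_norm_Rintegral => //.
by apply: rintegrableB; [exact: rintegrableB|exact: rintegrableZ].
Qed.

End real_integrals.

(** * Lipschitz bounds and quantitative partial derivatives *)

Section lipschitz.
Variables (R : realType) (k : nat).
Implicit Types (x y h : 'rV[R]_k) (g : 'rV[R]_k -> R).

(** Steps along the axes add up exactly in this norm, so Taylor bounds can be proved one coordinate
    at a time. *)
Definition l1norm x : R := \sum_(i < k) `|x 0 i|.

Lemma l1norm_ge0 x : 0 <= l1norm x. Proof. exact: sumr_ge0. Qed.

Lemma l1normD x y : l1norm (x + y) <= l1norm x + l1norm y.
Proof.
rewrite /l1norm -big_split/=; apply: ler_sum => i _.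
by rewrite mxE ler_normD.
Qed.

Lemma l1normZ a x : l1norm (a *: x) = `|a| * l1norm x.
Proof.
by rewrite /l1norm mulr_sumr; apply: eq_bigr => i _; rewrite mxE normrM.
Qed.

Lemma l1normN x : l1norm (- x) = l1norm x.
Proof. by rewrite -scaleN1r l1normZ normrN1 mul1r. Qed.

Lemma l1norm_delta i : l1norm (delta_mx 0 i) = 1.
Proof.
rewrite /l1norm (bigD1 i)//= big1 ?addr0 => [|j ji].
  by rewrite mxE !eqxx normr1.
by rewrite mxE (negbTE ji) andbF normr0.
Qed.

Lemma ler_l1norm x i : `|x 0 i| <= l1norm x.
Proof. by rewrite /l1norm (bigD1 i)//= lerDl sumr_ge0. Qed.

Lemma ler_sum_l1norm (G : 'I_k -> R) C x : (forall i, `|G i| <= C) ->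
  `|\sum_(i < k) G i * x 0 i| <= C * l1norm x.
Proof.
move=> GC; rewrite (le_trans (ler_norm_sum _ _ _))// /l1norm mulr_sumr.
by apply: ler_sum => i _; rewrite normrM ler_wpM2r.
Qed.

Definition lip C g := forall x y, `|g x - g y| <= C * l1norm (x - y).

Lemma lipW C C' g : C <= C' -> lip C g -> lip C' g.
Proof.
move=> CC' gC x y; rewrite (le_trans (gC x y))// ler_wpM2r//.
exact: l1norm_ge0.
Qed.

Lemma lip_growth C g x : lip C g -> `|g x| <= `|g 0| + C * l1norm x.
Proof.
move=> /(_ x 0); rewrite subr0 => h.
by rewrite -(subrK (g 0) (g x)) (le_trans (ler_normD _ _))// addrC lerD2l.
Qed.

(** A partial derivative in a form that is uniform in the point, global in the step and stable under
    averaging over translations. *)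
Definition has_partial (l : 'I_k) (F F' : 'rV[R]_k -> R) (C : R) :=
  forall x t, `|F (x + t *: delta_mx 0 l) - F x - t * F' x| <= C * t ^+ 2.

Lemma has_partialW l F F' C C' : C <= C' -> has_partial l F F' C ->
  has_partial l F F' C'.
Proof.
by move=> CC' h x t; rewrite (le_trans (h x t))// ler_wpM2r// sqr_ge0.
Qed.

(** The difference quotient with step [t] is at most [C] and differs from [F' x] by at most [C * t];
    the step [e / (C + 1)] makes this error at most [e]. *)
Lemma has_partial_bound l F F' C x : lip C F -> has_partial l F F' C ->
  `|F' x| <= C.
Proof.
move=> lF h; apply/ler_addgt0Pr => e e0.
have C0 : 0 <= C.
  have := lF (x + delta_mx 0 l) x; rewrite addrAC subrr add0r l1norm_delta mulr1.
  exact: le_trans.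
pose t := e / (C + 1).
have t0 : 0 < t by rewrite divr_gt0// ltr_wpDl.
have te : C * t <= e.
  rewrite /t mulrCA ler_piMr ?(ltW e0)// ler_pdivrMr ?ltr_wpDl// mul1r lerDl//.
have := h x t; have := lF (x + t *: delta_mx 0 l) x.
rewrite addrAC subrr add0r l1normZ l1norm_delta mulr1 (gtr0_norm t0).
set a := F _ - F x => h1 h2.
have : `|t * F' x| <= C * t + C * t ^+ 2.
  have -> : t * F' x = a - (a - t * F' x) by rewrite opprB addrC subrK.
  by rewrite (le_trans (ler_normB _ _))// lerD.
rewrite normrM (gtr0_norm t0) (_ : _ + _ = t * (C + C * t)); last by ring.
by rewrite ler_pM2l// => /le_trans; apply; rewrite lerD2l.
Qed.

Definition smooth1 C g (G : 'I_k -> 'rV[R]_k -> R) :=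
  [/\ lip C g, forall l, lip C (G l) & forall l, has_partial l g (G l) C].

(** The increment is made one coordinate at a time. Each move costs its own remainder, plus the
    change of the remaining partial derivatives, which the Lipschitz bound on [G] controls by a
    cross term. *)
Lemma smooth1_taylor C g G x h : smooth1 C g G ->
  `|g (x + h) - g x - \sum_(l < k) G l x * h 0 l| <= 2 * C * l1norm h ^+ 2.
Proof.
move=> [lg lG dg].
rewrite {1}(row_sum_delta h) /l1norm.
(* The base point is generalised: coordinate [a] is moved first, and the induction hypothesis is
   used at the displaced point [x']. *)
elim: (index_enum _) x => [|a s ih] x.
  by rewrite !big_nil addr0 subrr subr0 normr0 expr0n mulr0.
rewrite !big_cons addrA.
set x' := x + _; set y := \sum_(j <- s) _.
set S := \sum_(j <- s) `|_|; set G0 := \sum_(j <- s) _.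
have S0 : 0 <= S by rewrite sumr_ge0.
pose G1 := \sum_(j <- s) G j x' * h 0 j.
have h1 : `|g (x' + y) - g x' - G1| <= 2 * C * S ^+ 2 by exact: ih.
have h2 : `|g x' - g x - h 0 a * G a x| <= C * h 0 a ^+ 2 by exact: dg.
have h3 : `|G1 - G0| <= C * `|h 0 a| * S.
  rewrite /G1 /G0 -sumrB (le_trans (ler_norm_sum _ _ _))// mulr_sumr.
  apply: ler_sum => j _; rewrite -mulrBl normrM ler_wpM2r//.
  rewrite (le_trans (lG j x' x))// /x' addrAC subrr add0r l1normZ l1norm_delta.
  by rewrite mulr1.
have C0 : 0 <= C.
  have := lg (x + delta_mx 0 a) x; rewrite addrAC subrr add0r l1norm_delta mulr1.
  exact: le_trans.
rewrite (_ : _ - _ = (g (x' + y) - g x' - G1) + (g x' - g x - h 0 a * G a x)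
  + (G1 - G0)); last by ring.
rewrite (le_trans (ler_normD _ _))// (le_trans (lerD (ler_normD _ _) (lexx _)))//.
rewrite (le_trans (lerD (lerD h1 h2) h3))//.
rewrite -(real_normK (num_real (h 0 a))).
have : 0 <= C * `|h 0 a| * S by rewrite !mulr_ge0.
have : 0 <= C * `|h 0 a| ^+ 2 by rewrite mulr_ge0// sqr_ge0.
set b := `|h 0 a|; lra.
Qed.

End lipschitz.

(** * Measurability of Lipschitz functions *)

Section lipschitz_measurable.
Context d (T : measurableType d) (R : realType) (k : nat).

(* Infima over rational points: a Lipschitz [g] satisfies [g x < a] iff
   [g q + C * l1norm (x - q) < a] for some rational point [q]. *)
Lemma measurable_lip C (g : 'rV[R]_k -> R) (Y : T -> 'rV[R]_k) (D : set T) :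
  lip C g -> (forall i, measurable_fun D (fun w => Y w 0 i)) ->
  measurable_fun D (g \o Y).
Proof.
move=> gC mY.
wlog C0 : C gC / 0 <= C.
  move=> /(_ `|C|); apply => //; apply: lipW gC; exact: ler_norm.
pose q (v : 'rV[rat]_k) : 'rV[R]_k := map_mx ratr v.
move=> mD; apply: (measurability _ (RGenInftyO.measurableE R)) => //.
move=> _ [_ [a ->] <-].
rewrite (_ : D `&` _ = \bigcup_(v : 'rV[rat]_k)
    (D `&` [set w | g (q v) + C * l1norm (Y w - q v) < a])); last first.
  apply/seteqP; split=> w /=.
    move=> [Dw]; rewrite in_itv/= => ga.
    (* The precision makes [2 * C * k] times the coordinate error smaller than [a - g (Y w)]: one
       [C * k] pays for [g] at the rational point, the other for the penalty term. *)
    have : forall i, exists r : rat,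
        `|Y w 0 i - ratr r| < (a - g (Y w)) / (2 * (C + 1) * (k%:R + 1)).
      move=> i.
      set e := _ / _.
      have e0 : 0 < e.
        rewrite divr_gt0 ?subr_gt0// mulr_gt0 ?ltr_wpDl//.
        by rewrite mulr_gt0// ltr_wpDl.
      have /rat_in_itvoo[r] : Y w 0 i - e < Y w 0 i + e.
        by rewrite ltrD2l gtrN.
      rewrite in_itv/= => /andP[r1 r2]; exists r.
      by rewrite ltr_norml; apply/andP; split; lra.
    move=> /choice[r hr].
    exists (\row_i r i) => //; split=> //.
    set v := q _; set e := _ / _ in hr.
    have vY : l1norm (Y w - v) <= k%:R * e.
      have -> : k%:R * e = \sum_(i < k) e by rewrite sumr_const card_ord mulr_natl.
      apply: ler_sum => i _; rewrite !mxE; exact: ltW.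
    have := gC v (Y w); rewrite -(opprB (Y w) v) l1normN => gv.
    have e0 : 0 < e.
      rewrite divr_gt0 ?subr_gt0// mulr_gt0 ?ltr_wpDl//.
      by rewrite mulr_gt0// ltr_wpDl.
    have he : 2 * (C + 1) * (k%:R + 1) * e = a - g (Y w).
      rewrite mulrC /e divfK// gt_eqF// mulr_gt0 ?ltr_wpDl//.
      by rewrite mulr_gt0// ltr_wpDl.
    have {}gv : g v <= g (Y w) + C * l1norm (Y w - v).
      by rewrite -lerBlDl (le_trans (ler_norm _)).
    have k0 : (0 : R) <= k%:R by [].
    have : C * l1norm (Y w - v) <= C * (k%:R * e) by rewrite ler_wpM2l.
    have Ce : 0 <= C * e by rewrite mulr_ge0// ltW.
    have ke : 0 <= k%:R * e by rewrite mulr_ge0// ltW.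
    move: hr he e0 vY Ce ke; clearbody e => hr he e0 vY Ce ke CY.
    by rewrite /=; lra.
  move=> [v _ [Dw gv]]; split => //; rewrite in_itv/=.
  have := gC (Y w) (q v) => h.
  apply: le_lt_trans gv; rewrite -lerBlDl (le_trans (ler_norm _))//.
apply: countable_bigcupT_measurable => // v.
have mL : measurable_fun D (fun w => g (q v) + C * l1norm (Y w - q v)).
  apply: measurable_funD => //; apply: measurable_funM => //.
  apply: measurable_sum => i; apply: measurableT_comp => //.
  under eq_fun do rewrite !mxE.
  by apply: measurable_funB.
rewrite (_ : _ `&` _ = D `&` (fun w => g (q v) + C * l1norm (Y w - q v)) @^-1` `]-oo, a[).
  exact: mL.
by apply/seteqP; split=> w /= [Dw]; rewrite in_itv/=.
Qed.

End lipschitz_measurable.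

(** * One-variable calculus *)

Section calculus1.
Variable R : realType.
Implicit Types (f F : R -> R) (a b t C : R).
Notation leb := (@lebesgue_measure R).

Lemma lipschitz_continuous1 f C :
  (forall x y, `|f x - f y| <= C * `|x - y|) -> continuous f.
Proof.
move=> fC x; apply/cvgrPdist_le => e e0.
near=> y; rewrite (le_trans (fC x y))//.
rewrite (@le_trans _ _ ((`|C| + 1) * `|x - y|))//.
  by rewrite ler_wpM2r// ler_wpDr// ler_norm.
rewrite mulrC -ler_pdivlMr ?ltr_wpDl//.
near: y; apply: (cvgr_dist_le id x (@cvg_id _ _)).
by rewrite divr_gt0// ltr_wpDl.
Unshelve. all: by end_near. Qed.

(** The bridge from quadratic remainders back to derivatives: dividing by [t] leaves an error of at
    most [C * |t|]. *)
Lemma is_derive_of_taylor F a (f' : R) C :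
  (forall t, `|t| <= 1 -> `|F (a + t) - F a - t * f'| <= C * t ^+ 2) ->
  is_derive a (1 : R) F f'.
Proof.
move=> h.
have cv : h^-1 *: ((F \o shift a) (h *: (1 : R)) - F a) @[h --> 0^'] --> f'.
  apply/cvgrPdist_le => e e0; near=> t.
  have t0 : t != 0 by near: t; exact: nbhs_dnbhs_neq.
  rewrite /= /GRing.scale/= mulr1 (addrC t a).
  rewrite -[X in X - _](mulKf t0) -mulrBr normrM distrC normfV.
  rewrite mulrC ler_pdivrMr ?normr_gt0//.
  rewrite (le_trans (h t _))//.
    near: t; apply: dnbhs0_le; exact: ltr01.
  rewrite -[X in C * X]real_normK ?num_real// expr2 mulrA ler_wpM2r//.
  rewrite (@le_trans _ _ ((`|C| + 1) * `|t|))//.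
    by rewrite ler_wpM2r// ler_wpDr// ler_norm.
  rewrite mulrC -ler_pdivlMr ?ltr_wpDl//.
  by near: t; apply: dnbhs0_le; rewrite divr_gt0// ltr_wpDl.
split; first by apply/cvg_ex; exists f'.
exact/cvg_lim.
Unshelve. all: by end_near. Qed.

Lemma is_derive_continuous f F : (forall x, is_derive x (1 : R) F (f x)) ->
  continuous F.
Proof.
move=> h x; apply/differentiable_continuous/derivable1_diffP.
by have [] := h x.
Qed.

(** The endpoints come in either order, so that increments of both signs are covered. The interval
    [D] accommodates primitives that exist only locally. *)
Lemma mvt_diff f F a b (D : interval R) : a \in D -> b \in D ->
  (forall x, x \in D -> is_derive x (1 : R) F (f x)) ->
  exists c, [/\ c \in D, `|c - a| <= `|b - a| & F b - F a = f c * (b - a)].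
Proof.
move=> aD bD h.
have sub x y z : x \in D -> y \in D -> z \in `[x, y] -> z \in D.
  by move=> xD yD; rewrite in_itv/= => zxy; exact: (@interval_is_interval _ D x y).
have cF x y : x \in D -> y \in D -> {within `[x, y], continuous F}.
  move=> xD yD; apply: derivable_within_continuous => z zxy.
  by have [] := h z (sub _ _ _ xD yD zxy).
have [ab|ba] := leP a b.
  have [|c] := @MVT_segment _ F f a b ab _ (cF _ _ aD bD).
    by move=> x xab; apply: h; apply: (sub _ _ _ aD bD (subset_itv_oo_cc xab)).
  move=> cab; have := cab; rewrite in_itv/= => /andP[ac cb] ->; exists c; split => //.
    exact: (sub _ _ _ aD bD cab).
  by rewrite !ger0_norm ?subr_ge0// lerD2r.
have [|c] := @MVT_segment _ F f b a (ltW ba) _ (cF _ _ bD aD).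
  by move=> x xab; apply: h; apply: (sub _ _ _ bD aD (subset_itv_oo_cc xab)).
move=> cab; have := cab; rewrite in_itv/= => /andP[bc ca] e; exists c; split => //.
- exact: (sub _ _ _ bD aD cab).
- by rewrite !ler0_norm ?subr_le0 ?(ltW ba)// lerN2 lerD2r.
- by rewrite -opprB e -mulrN opprB.
Qed.

Lemma taylor_of_is_derive f F C a t (D : interval R) : a \in D -> a + t \in D ->
  (forall x, x \in D -> is_derive x (1 : R) F (f x)) ->
  (forall x y, `|f x - f y| <= C * `|x - y|) ->
  `|F (a + t) - F a - t * f a| <= C * t ^+ 2.
Proof.
move=> aD atD h fC.
have [c [_]] := mvt_diff aD atD h.
rewrite (addrC a t) addrK => ct ->.
rewrite [f c * t]mulrC -mulrBr normrM mulrC.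
have -> : C * t ^+ 2 = C * `|t| * `|t| by rewrite -mulrA -normrM -expr2 ger0_norm ?sqr_ge0.
rewrite ler_wpM2r// (le_trans (fC _ _))// ler_wpM2l//.
by have := fC 1 0; rewrite subr0 normr1 mulr1; apply: le_trans.
Qed.

Lemma FTC2 f F a b : a < b ->
  (forall x, x \in `[a, b] -> is_derive x (1 : R) F (f x)) ->
  continuous f -> \int[leb]_(x in `[a, b]) f x = F b - F a.
Proof.
move=> ab h cf.
have cF x : x \in `[a, b] -> {for x, continuous F}.
  move=> xab; apply/differentiable_continuous/derivable1_diffP.
  by have [] := h x xab.
rewrite /Rintegral (@continuous_FTC2 _ f F)//.
- exact: continuous_subspaceT.
- split.
  + by move=> x /subset_itv_oo_cc xab; have [] := h x xab.
  + by apply/cvg_at_right_filter/cF; rewrite in_itv/= lexx ltW.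
  + by apply/cvg_at_left_filter/cF; rewrite in_itv/= lexx ltW.
- by move=> x /subset_itv_oo_cc xab; rewrite derive1E; have [] := h x xab.
Qed.

Lemma continuous_integrable_itv f a b : continuous f ->
  leb.-integrable `[a, b] (EFin \o f).
Proof.
move=> cf; apply: continuous_compact_integrable; first exact: segment_compact.
exact: continuous_subspaceT.
Qed.

(** The integral started at [- N] is differentiable strictly to the right of its starting point,
    whence the open interval. *)
Lemma local_primitive f (N : R) : continuous f ->
  exists F, forall x : R, x \in `]- N, N[ -> is_derive x (1 : R) F (f x).
Proof.
move=> cf.
exists (fun x => \int[leb]_(t in `[- N, x]) f t) => x.
rewrite in_itv/= => /andP[Nx xN].
have [] := @continuous_FTC1 _ f (BLeft (- N)) x N xN
  (continuous_integrable_itv _ _ cf) _ (cf x).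
- by rewrite lte_fin.
- by move=> dF Ff; split => //; rewrite -Ff derive1E.
Qed.

End calculus1.

(** * Gaussian integration by parts *)

Section gaussian1.
Variable R : realType.
Notation leb := (@lebesgue_measure R).
Notation gauss := (@normal_prob R 0 1).
Notation pdf := (@normal_pdf R 0 1).
Implicit Types (f G : R -> R).

(** The Radon-Nikodym derivative of [gauss] agrees with [pdf] almost everywhere, because both have
    the same integral over every measurable set. *)
Lemma ge0_integral_normal_prob (f : R -> \bar R) :
  (forall x, 0 <= f x)%E -> measurable_fun setT f ->
  (\int[gauss]_x f x = \int[leb]_x (f x * (pdf x)%:E))%E.
Proof.
move=> f0 mf.
have dom := @normal_prob_dominates R 0 1.
rewrite -(Radon_Nikodym_SigmaFinite.change_of_variables dom)//.
have iRN := Radon_Nikodym_SigmaFinite.f_integrable dom.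
apply: ae_eq_integral => //.
- by apply: emeasurable_funM => //; exact: measurable_int iRN.
- apply: emeasurable_funM => //; apply/measurable_EFinP.
  exact: measurable_normal_pdf.
- apply: ae_eqe_mul2l; apply: integral_ae_eq => //.
    by apply/measurable_EFinP; exact: measurable_normal_pdf.
  by move=> E _ mE; rewrite -Radon_Nikodym_SigmaFinite.f_integral.
Qed.

Lemma rintegrable_normal_prob f : measurable_fun setT f ->
  leb.-integrable setT (EFin \o (fun x => f x * pdf x)) ->
  rintegrable gauss setT f.
Proof.
move=> mf /integrableP[_ ifp]; apply/integrableP; split.
  exact/measurable_EFinP.
rewrite ge0_integral_normal_prob//; last first.
  by apply: measurableT_comp => //; exact/measurable_EFinP.
apply: le_lt_trans ifp; rewrite le_eqVlt; apply/orP; left; apply/eqP.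
apply: eq_integral => x _ /=.
by rewrite normrM (ger0_norm (normal_pdf_ge0 _ _ _)).
Qed.

Lemma Rintegral_normal_prob f : measurable_fun setT f ->
  leb.-integrable setT (EFin \o (fun x => f x * pdf x)) ->
  \int[gauss]_x f x = \int[leb]_x (f x * pdf x).
Proof.
move=> mf ifp; have ifg := rintegrable_normal_prob mf ifp.
rewrite /Rintegral; congr fine.
have dom := @normal_prob_dominates R 0 1.
rewrite -(Radon_Nikodym_change_of_variables dom)//.
have iRN := Radon_Nikodym_SigmaFinite.f_integrable dom.
apply: ae_eq_integral => //.
- apply: emeasurable_funM => //; exact/measurable_EFinP.
- exact: (measurable_int leb ifp).
- under [X in ae_eq _ _ _ X]eq_fun do rewrite EFinM.
  apply: ae_eqe_mul2l; apply: integral_ae_eq => //.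
  + apply: Radon_Nikodym_integrable; exact: dom.
  + by apply/measurable_EFinP; exact: measurable_normal_pdf.
  + by move=> E _ mE; rewrite -Radon_Nikodym_integral.
Qed.

Lemma pdfE x : pdf x = normal_peak 1 * expR (- x ^+ 2 / 2).
Proof. by rewrite normal_pdfE ?oner_neq0// /normal_fun subr0 expr1n. Qed.

Lemma is_derive_pdf (x : R) : is_derive x (1 : R) pdf (- x * pdf x).
Proof.
have -> : pdf = (fun x => normal_peak 1 * expR (- x ^+ 2 / 2)).
  by apply/funext => y; rewrite pdfE.
apply: is_derive_eq.
rewrite /GRing.scale/=; lra.
Qed.

(** Half of the exponent absorbs the square: [x ^+ 2 / 4 <= expR (x ^+ 2 / 4)]. The other half is
    the density of variance [2], and the ratio of peaks adjusts the normalisation. Integrability of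
    quadratic growth and the decay at infinity both follow from it. *)
Lemma sqr_pdf_le x : x ^+ 2 * pdf x <=
  4 * normal_peak 1 / normal_peak (Num.sqrt 2) * normal_pdf 0 (Num.sqrt 2) x.
Proof.
have s2 : Num.sqrt 2 != 0 :> R by rewrite gt_eqF// sqrtr_gt0.
rewrite pdfE (normal_pdfE _ s2) /normal_fun /= subr0 sqr_sqrtr//.
have p2 : normal_peak (Num.sqrt 2) != 0 :> R by rewrite gt_eqF// normal_peak_gt0.
rewrite [leLHS]mulrCA; set e2 := expR (_ / (2 *+ 2)).
have -> : 4 * normal_peak 1 / normal_peak (Num.sqrt 2) *
  (normal_peak (Num.sqrt 2) * e2) = normal_peak 1 * (4 * e2) by field.
rewrite {}/e2 ler_wpM2l ?normal_peak_ge0//.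
have -> : - x ^+ 2 / 2 = - x ^+ 2 / 4 + - x ^+ 2 / (2 *+ 2) by lra.
rewrite expRD mulrA ler_wpM2r ?expR_ge0//.
have h := expR_ge1Dx (x ^+ 2 / 4).
rewrite mulNr expRN -ler_pdivlMr ?invr_gt0 ?expR_gt0// invrK.
by have := sqr_ge0 x; lra.
Qed.

Lemma integrable_pdf_quadratic c : leb.-integrable setT
  (EFin \o (fun x => (c * (1 + x ^+ 2)) * pdf x)).
Proof.
pose m x := `|c| * pdf x + (`|c| * (4 * normal_peak 1 / normal_peak (Num.sqrt 2)))
  * normal_pdf 0 (Num.sqrt 2) x.
have le_m (x : R) : `|c * (1 + x ^+ 2) * pdf x| <= `|m x|.
  rewrite !normrM (ger0_norm (normal_pdf_ge0 _ _ _)) (@ger0_norm _ (1 + _)); last first.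
    by rewrite addr_ge0// sqr_ge0.
  rewrite (@ger0_norm _ (m x)); last first.
    rewrite addr_ge0 ?mulr_ge0 ?normal_pdf_ge0// ?normal_peak_ge0//.
    by rewrite invr_ge0 normal_peak_ge0.
  rewrite -mulrA mulrDl mul1r mulrDr lerD2l -mulrA ler_wpM2l//.
  exact: sqr_pdf_le.
apply: (@le_integrable _ _ _ leb _ measurableT _ (EFin \o m)).
- apply/measurable_EFinP; apply: measurable_funM.
    by apply: measurable_funM => //; apply: measurable_funD => //;
      exact: measurable_funX.
  exact: measurable_normal_pdf.
- by move=> x _ /=; rewrite lee_fin; exact: le_m.
- apply: (@integrableD _ _ _ leb _ measurableT
    (fun x => (`|c|%:E * (pdf x)%:E)%E)
    (fun x => ((`|c| * (4 * normal_peak 1 / normal_peak (Num.sqrt 2)))%:E *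
       (normal_pdf 0 (Num.sqrt 2) x)%:E)%E));
  by apply: integrableZl => //; exact: integrable_normal_pdf.
Qed.

Lemma quadratic_growth_normal f c : measurable_fun setT f ->
  (forall x, `|f x| <= c * (1 + x ^+ 2)) ->
  leb.-integrable setT (EFin \o (fun x => f x * pdf x)).
Proof.
move=> mf fc; apply: le_integrable (integrable_pdf_quadratic c) => //.
- apply/measurable_EFinP; apply: measurable_funM => //.
  exact: measurable_normal_pdf.
- move=> x _ /=; rewrite lee_fin !normrM ler_wpM2r// (le_trans (fc x))//.
  by rewrite -normrM ler_norm.
Qed.

Lemma rintegrable_normal_quadratic f c : measurable_fun setT f ->
  (forall x, `|f x| <= c * (1 + x ^+ 2)) -> rintegrable gauss setT f.
Proof.
move=> mf fc; apply: rintegrable_normal_prob => //.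
exact: quadratic_growth_normal fc.
Qed.

(** Since [x ^+ 2 * pdf x] is bounded, linear growth against [pdf] still leaves a factor [1 / |x|].
    This controls the boundary terms in [stein1]. *)
Lemma pdf_decay c : exists K, forall f, (forall x, `|f x| <= c * (1 + `|x|)) ->
  forall x, 1 <= `|x| -> `|f x * pdf x| <= K / `|x|.
Proof.
pose K0 := 4 * normal_peak (1 : R) / normal_peak (Num.sqrt 2) * normal_peak (Num.sqrt 2).
exists (2 * `|c| * K0) => f fc x x1.
have s2 : Num.sqrt 2 != 0 :> R by rewrite gt_eqF// sqrtr_gt0.
have x0 : 0 < `|x| by apply: lt_le_trans x1.
rewrite ler_pdivlMr// normrM (ger0_norm (normal_pdf_ge0 _ _ _)).
have xK : x ^+ 2 * pdf x <= K0.
  rewrite (le_trans (sqr_pdf_le x))// ler_wpM2l//; last exact: normal_pdf_ub.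
  by rewrite !mulr_ge0 ?invr_ge0 ?normal_peak_ge0.
rewrite (@le_trans _ _ (2 * `|c| * `|x| * pdf x * `|x|))//.
  rewrite !ler_wpM2r// ?normal_pdf_ge0//.
  rewrite (le_trans (fc x))// (@le_trans _ _ (`|c| * (1 + `|x|)))//.
    by rewrite ler_wpM2r ?ler_norm// addr_ge0.
  have : 0 <= `|c| by [].
  nra.
have -> : 2 * `|c| * `|x| * pdf x * `|x| = 2 * `|c| * (x ^+ 2 * pdf x).
  by rewrite -(real_normK (num_real x)); ring.
by rewrite ler_wpM2l// mulr_ge0.
Qed.

(** On growing symmetric intervals the integral is a difference of boundary values, which is O(1 /
    n), while dominated convergence gives the integral over the line. *)
Lemma Rintegral_derive_eq0 h F : (forall x, is_derive x (1 : R) F (h x)) ->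
  continuous h -> leb.-integrable setT (EFin \o h) ->
  (exists K, forall x, 1 <= `|x| -> `|F x| <= K / `|x|) ->
  \int[leb]_x h x = 0.
Proof.
move=> dF ch ih [K FK].
(* The shift to [n.+1] keeps the endpoints in the region [1 <= |x|] where the decay of [F] is
   known. *)
pose f_ n := EFin \o (h \_ `[- (n.+1%:R : R), n.+1%:R]).
have mh : measurable_fun setT h by exact: continuous_measurable_fun.
have [| | | | | _ _] := @dominated_convergence _ _ _ leb setT measurableT f_ (EFin \o h)
  (fun x => `|(h x)%:E|)%E.
- move=> n; apply/measurable_EFinP.
  by apply/(measurable_restrictT _ _).1 => //; exact: measurable_funTS.
- exact/measurable_EFinP.
- apply: aeW => x _; apply: cvg_near_cst; near=> n.
  rewrite /f_ /= patchE ifT//; apply/mem_set; rewrite /= in_itv/= -ler_norml.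
  rewrite (@le_trans _ _ n%:R)//; last by rewrite ler_nat.
  near: n; exact: nbhs_infty_ger.
- exact: integrable_abse ih.
- apply: aeW => x n _; rewrite /f_ /= lee_fin patchE; case: ifPn => //.
  by rewrite normr0.
move=> cv1.
have {cv1} cv2 : (fun n => \int[leb]_(x in `[- (n.+1%:R : R), n.+1%:R]) h x) @ \oo --> \int[leb]_x h x.
  rewrite /Rintegral; apply: fine_cvg; rewrite fineK; last exact: integrable_fin_num.
  apply: cvg_trans cv1; apply: near_eq_cvg; near=> n.
  rewrite [RHS]integral_mkcond; apply: eq_integral => x _.
  by rewrite /f_ /= !patchE; case: ifP.
apply: (cvg_unique _ cv2) => //.
have -> : (fun n => \int[leb]_(x in `[- (n.+1%:R : R), n.+1%:R]) h x) =
    (fun n => F n.+1%:R - F (- n.+1%:R)).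
  by apply/funext => n; rewrite (FTC2 _ (fun x _ => dF x) ch)// gtrN.
apply/cvgrPdist_le => e e0; near=> n.
rewrite sub0r normrN (le_trans (ler_normB _ _))//.
rewrite (@le_trans _ _ (2 * K / n.+1%:R))//.
  have := FK n.+1%:R; have := FK (- n.+1%:R).
  rewrite normrN ger0_norm// ler1n => /(_ isT) h1 /(_ isT) h2.
  by rewrite mulr_natl mulrnAl mulr2n lerD.
rewrite ler_pdivrMr// -ler_pdivrMl//.
rewrite (@le_trans _ _ n%:R)//; last by rewrite ler_nat.
near: n; exact: nbhs_infty_ger.
Unshelve. all: by end_near. Qed.

(** Stein's identity: the difference of the two integrands times [pdf] is the derivative of
    [G * pdf], which vanishes at infinity because a bounded [G'] lets [G] grow at most linearly. *)
Lemma stein1 G G' C : (forall x, is_derive x (1 : R) G (G' x)) ->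
  (forall x, `|G' x| <= C) -> (forall x y, `|G' x - G' y| <= C * `|x - y|) ->
  \int[gauss]_x (x * G x) = \int[gauss]_x G' x.
Proof.
move=> dG G'C lG'.
have cG' := lipschitz_continuous1 lG'.
have cG := is_derive_continuous dG.
have mG' := continuous_measurable_fun cG'.
have mG := continuous_measurable_fun cG.
have C0 : 0 <= C by rewrite (le_trans _ (G'C 0)).
have Gx x : `|G x| <= (`|G 0| + C) * (1 + `|x|).
  have inT (y : R) : y \in `]-oo, +oo[ by rewrite in_itv.
  have [c [_ _]] := mvt_diff (inT 0) (inT x) (fun y _ => dG y).
  rewrite subr0 => e.
  have : `|G x - G 0| <= C * `|x| by rewrite e normrM ler_wpM2r.
  have := ler_normD (G x - G 0) (G 0); rewrite subrK.
  have := normr_ge0 (G 0); have := normr_ge0 x; nra.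
have iG' : leb.-integrable setT (EFin \o (fun x => G' x * pdf x)).
  apply: (quadratic_growth_normal mG' (c := C)) => x; rewrite (le_trans (G'C x))//.
  by rewrite ler_peMr// lerDl sqr_ge0.
have mxG : measurable_fun setT (fun x : R => x * G x) by exact: measurable_funM.
have iG : leb.-integrable setT (EFin \o (fun x : R => (x * G x) * pdf x)).
  apply: (quadratic_growth_normal mxG (c := 2 * (`|G 0| + C))) => x; rewrite normrM.
  apply: (@le_trans _ _ (`|x| * ((`|G 0| + C) * (1 + `|x|)))).
    by rewrite ler_wpM2l.
  rewrite -(real_normK (num_real x)); have := normr_ge0 x.
  have : 0 <= `|G 0| + C by rewrite addr_ge0.
  set a := `|G 0| + C; set y := `|x| => a0 y0.
  have h : y * (1 + y) <= 2 * (1 + y ^+ 2) by have := sqr_ge0 (y - 1); nra.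
  by have := ler_wpM2l a0 h; lra.
rewrite (Rintegral_normal_prob mxG iG) (Rintegral_normal_prob mG' iG').
apply/eqP; rewrite eq_sym -subr_eq0 -RintegralB//; apply/eqP.
have dF x : is_derive x (1 : R) (fun x => G x * pdf x) (G' x * pdf x - x * G x * pdf x).
  have dGx := dG x; have dp := is_derive_pdf x.
  apply: is_derive_eq.
  by rewrite /GRing.scale/=; ring.
apply: (Rintegral_derive_eq0 dF).
- have cp : continuous pdf by exact: is_derive_continuous is_derive_pdf.
  move=> x; apply: cvgB; apply: cvgM; try exact: cp; first exact: cG'.
  by apply: cvgM; [exact: cvg_id|exact: cG].
- exact: (integrableB measurableT iG' iG).
- have [K hK] := pdf_decay (`|G 0| + C).
  by exists K; exact: hK.
Qed.

End gaussian1.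

(** * Transfer of integrals between maps with the same law *)

Section same_law.
Context d1 d2 d (T1 : measurableType d1) (T2 : measurableType d2)
  (S : measurableType d) (R : realType).
Variables (m1 : {measure set T1 -> \bar R}) (m2 : {measure set T2 -> \bar R}).
Variables (Y1 : T1 -> S) (Y2 : T2 -> S).
Hypotheses (mY1 : measurable_fun setT Y1) (mY2 : measurable_fun setT Y2).
Hypothesis law : forall A, measurable A -> m1 (Y1 @^-1` A) = m2 (Y2 @^-1` A).

(** Both integrals are integrals over [D] against the common image measure. Integrability is
    transferred as well, so it has to be checked on one side only. *)
Lemma same_law_integral (D : set S) (F : S -> R) : measurable D ->
  measurable_fun setT F ->
  m1.-integrable (Y1 @^-1` D) (EFin \o (F \o Y1)) ->
  m2.-integrable (Y2 @^-1` D) (EFin \o (F \o Y2)) /\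
  (\int[m1]_(x in Y1 @^-1` D) (F (Y1 x)) = \int[m2]_(x in Y2 @^-1` D) (F (Y2 x))).
Proof.
move=> mD mF i1.
have mEF : measurable_fun setT (EFin \o F) by exact/measurable_EFinP.
have i2 : m2.-integrable (Y2 @^-1` D) (EFin \o (F \o Y2)).
  apply/integrableP; split.
    apply/measurable_EFinP; apply: measurable_funTS.
    exact: measurableT_comp.
  have mA : measurable_fun D (fun y => `|(F y)%:E|%E).
    by apply: measurable_funTS; apply: measurableT_comp.
  have -> : (\int[m2]_(x in Y2 @^-1` D) `|(EFin \o (F \o Y2)) x| =
    \int[m1]_(x in Y1 @^-1` D) `|(EFin \o (F \o Y1)) x|)%E.
    transitivity (\int[pushforward m2 Y2]_(y in D) `|(F y)%:E|)%E.
      by rewrite (ge0_integral_pushforward mY2).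
    transitivity (\int[pushforward m1 Y1]_(y in D) `|(F y)%:E|)%E; last first.
      by rewrite (ge0_integral_pushforward mY1).
    by apply: eq_measure_integral => A mA' _; exact/esym/law.
  by case/integrableP : i1.
split => //; congr fine.
transitivity (\int[pushforward m1 Y1]_(y in D) (F y)%:E)%E.
  by rewrite (integral_pushforward mY1).
transitivity (\int[pushforward m2 Y2]_(y in D) (F y)%:E)%E; last first.
  by rewrite (integral_pushforward mY2).
by apply: eq_measure_integral => A mA' _; exact: law.
Qed.

End same_law.

(** * Laws of random vectors and integration by parts for independent normal coordinates *)

Section gaussian_vector.
Variable R : realType.
Notation gauss := (@normal_prob R 0 1).
Variable k : nat.

(* ['rV[R]_k] carries no measurable structure; the one generated by [boxes]
   is the product one, and [boxes] is a pi-system, so that laws of vectors can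
   be compared on it. *)
Definition boxes : set (set 'rV[R]_k) := [set B | exists2 C : 'I_k -> set R,
  (forall i, measurable (C i)) & B = [set x : 'rV[R]_k | forall i, C i (x 0 i)]].

Notation rVbox := (g_sigma_algebraType boxes).

Lemma setI_closed_boxes : setI_closed boxes.
Proof.
move=> _ _ [C mC ->] [C' mC' ->]; exists (fun i => C i `&` C' i).
  by move=> i; exact: measurableI.
apply/seteqP; split=> x /=; first by move=> [h h'] i; split.
by move=> h; split=> i; have [] := h i.
Qed.

Lemma boxes_setT : boxes setT.
Proof. by exists (fun=> setT) => //; apply/seteqP; split. Qed.

Lemma measurable_box_coord i : measurable_fun setT (fun x : rVbox => x 0 i : R).
Proof.
move=> _ B mB; rewrite setTI; apply: sub_sigma_algebra.
exists (fun j => if j == i then B else setT) => [j|]; first by case: ifP.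
apply/seteqP; split=> x /=; first by move=> Bx j; case: eqP => // ->.
by move=> /(_ i); rewrite eqxx.
Qed.

Lemma measurable_to_box d (S : measurableType d) (Y : S -> rVbox) :
  (forall i, measurable_fun setT (fun w => Y w 0 i : R)) -> measurable_fun setT Y.
Proof.
move=> mY; apply: (@measurability _ _ _ rVbox _ _ boxes) => //.
move=> _ [_ [C mC ->] <-]; rewrite setTI.
rewrite (_ : _ @^-1` _ = \bigcap_(i in [set: 'I_k]) ((fun w => Y w 0 i) @^-1` C i)).
  apply: fin_bigcap_measurable => // i _.
  by rewrite -[X in measurable X]setTI; exact: mY.
by apply/seteqP; split=> w /= h; [move=> i _; exact: h|move=> i; exact: h].
Qed.

Lemma box_law_unique d1 d2 (T1 : measurableType d1) (T2 : measurableType d2)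
    (m1 : {finite_measure set T1 -> \bar R}) (m2 : {measure set T2 -> \bar R})
    (Y1 : T1 -> rVbox) (Y2 : T2 -> rVbox) :
  measurable_fun setT Y1 -> measurable_fun setT Y2 ->
  (forall B, boxes B -> m1 (Y1 @^-1` B) = m2 (Y2 @^-1` B)) ->
  forall A, measurable A -> m1 (Y1 @^-1` A) = m2 (Y2 @^-1` A).
Proof.
move=> mY1 mY2 eqb A mA.
have u := @measure_unique _ R rVbox boxes (fun=> setT) erefl setI_closed_boxes
  (fun=> boxes_setT) (bigcup_const _ _)
  (pushforward m1 Y1) (pushforward m2 Y2).
apply: u => // _.
by rewrite -ge0_fin_numE//; apply: fin_num_measure; rewrite -[X in measurable X]setTI; exact: mY1.
Qed.

Context d' (T' : measurableType d') (Q : probability T' R).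
Variable Z : 'I_k -> {RV Q >-> R}.
Hypothesis Z_normal : forall i : 'I_k, standard_normal (Z i).
Hypothesis Z_indep : mutually_independent Z.

Definition rvec w : 'rV[R]_k := \row_i Z i w.

Lemma measurable_rvec i : measurable_fun setT (fun w => rvec w 0 i).
Proof. by under eq_fun do rewrite mxE; exact: measurable_funP. Qed.

(* Resampling the [l]-th coordinate independently leaves the law of the vector
   unchanged; this reduces [gaussian_ibp] to one dimension. *)
Definition replace_coord (l : 'I_k) (p : R * T') : 'rV[R]_k :=
  \row_i (if i == l then p.1 else Z i p.2).

Lemma measurable_replace_coord l i :
  measurable_fun setT (fun p => replace_coord l p 0 i).
Proof.
under eq_fun do rewrite mxE.
case: (i == l); first exact: measurable_fst.
by apply: measurableT_comp => //; exact: measurable_snd.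
Qed.

(** On a box both sides are the normal mass of [C l] times the probability of the constraints on the
    other coordinates. On the left this is independence, used once over all indices and once over
    the complement of [l]. *)
Lemma replace_coord_law l (A : set rVbox) : measurable A ->
  Q ((rvec : T' -> rVbox) @^-1` A) =
  (gauss \x Q)%E ((replace_coord l : R * T' -> rVbox) @^-1` A).
Proof.
apply: box_law_unique => [||_ [C mC ->]].
- by apply: measurable_to_box; exact: measurable_rvec.
- by apply: measurable_to_box; exact: measurable_replace_coord.
pose Dl := [set w | forall i, i \in [set~ l]%SET -> C i (Z i w)].
have mDl : measurable Dl.
  rewrite (_ : Dl = \bigcap_(i in [set i | i \in [set~ l]%SET]) (Z i @^-1` C i)).
    apply: fin_bigcap_measurable => // i _.
    by rewrite -[X in measurable X]setTI; exact: measurable_funP.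
  by apply/seteqP; split=> w /= h i; exact: h.
transitivity (Q [set w | forall i, i \in [set: 'I_k]%SET -> C i (Z i w)]).
  congr (Q _); apply/seteqP; split=> w /= h i.
    by move=> _; have := h i; rewrite mxE.
  by rewrite mxE; apply: h; rewrite finset.inE.
transitivity ((gauss \x Q)%E (C l `*` Dl)); last first.
  congr ((gauss \x Q)%E _); apply/seteqP; split=> -[t w] /=.
    move=> [/= h1 h2] i; rewrite mxE; case: eqP => [->//|/eqP il].
    by apply: h2; rewrite !finset.inE.
  move=> h; split=> /=; first by have := h l; rewrite mxE eqxx.
  by move=> i; rewrite !finset.inE => /negbTE il; have := h i; rewrite mxE il.
rewrite [RHS]product_measure1E//; last exact: mC.
rewrite (Z_indep [set: 'I_k]%SET mC) (bigD1 l)/= ?finset.inE//.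
congr (_ * _)%E; first exact: Z_normal.
transitivity (\prod_(i in [set~ l]%SET) Q (Z i @^-1` C i))%E; last exact/esym/(Z_indep _ mC).
by apply: eq_bigl => i; rewrite !finset.inE.
Qed.

Lemma rintegrable_Z_sqr l : rintegrable Q setT (fun w => Z l w ^+ 2).
Proof.
have mX : measurable_fun setT (fun x : R => x ^+ 2) by exact: measurable_funX.
have [] // := @same_law_integral _ _ _ _ _ R R gauss Q id (Z l) _ _ _ setT
  (fun x => x ^+ 2) measurableT mX.
- by move=> A mA; exact/esym/Z_normal.
rewrite preimage_setT; apply: (rintegrable_normal_quadratic (c := 1)) => //.
by move=> x; rewrite mul1r ger0_norm ?sqr_ge0// lerDr.
Qed.

(** Cauchy-Schwarz, by bounding each product by the half-sum of the two squares. *)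
Lemma sqr_l1norm (x : 'rV[R]_k) :
  l1norm x ^+ 2 <= k%:R * \sum_(i < k) x 0 i ^+ 2.
Proof.
rewrite expr2 /l1norm big_distrlr/=.
apply: (@le_trans _ _ (\sum_(i < k) \sum_(j < k) ((x 0 i ^+ 2 + x 0 j ^+ 2) / 2))).
  apply: ler_sum => i _; apply: ler_sum => j _.
  rewrite -(real_normK (num_real (x 0 i))) -(real_normK (num_real (x 0 j))).
  by have := sqr_ge0 (`|x 0 i| - `|x 0 j|); nra.
set S := \sum_(i < k) x 0 i ^+ 2.
rewrite (eq_bigr (fun i => (k%:R * x 0 i ^+ 2 + S) / 2)); last first.
  by move=> i _; rewrite -mulr_suml big_split/= sumr_const card_ord mulr_natl.
rewrite -mulr_suml big_split/= sumr_const card_ord -mulr_sumr -/S -mulr_natl.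
by lra.
Qed.

(** The second moments of the coordinates dominate. This is the integrability test for all Gaussian
    integrands below. *)
Lemma rintegrable_quadratic (F : T' -> R) c : measurable_fun setT F ->
  (forall w, `|F w| <= c * (1 + l1norm (rvec w) ^+ 2)) -> rintegrable Q setT F.
Proof.
move=> mF Fc; have c0 : 0 <= `|c| by [].
apply: (rintegrable_le measurableT
  (G := fun w => `|c| * (1 + k%:R * \sum_(i < k) Z i w ^+ 2))) => //.
  apply: (rintegrableZ measurableT); apply: (rintegrableD measurableT).
    exact: rintegrable_cst.
  apply: (rintegrableZ measurableT); apply: (rintegrable_sum measurableT) => i.
  exact: rintegrable_Z_sqr.
move=> w _; rewrite (le_trans (Fc w))//.
apply: (@le_trans _ _ (`|c| * (1 + l1norm (rvec w) ^+ 2))).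
  by rewrite ler_wpM2r ?ler_norm// addr_ge0// sqr_ge0.
rewrite ler_wpM2l// lerD2l (le_trans (sqr_l1norm _))//.
by under eq_bigr do rewrite mxE.
Qed.

(** With the [l]-th coordinate resampled, Fubini freezes the other ones and [stein1] applies along a
    line in direction [l]. *)
Lemma gaussian_ibp l C (F F' : 'rV[R]_k -> R) : lip C F -> lip C F' ->
  (forall x, `|F' x| <= C) -> has_partial l F F' C ->
  \int[Q]_w (Z l w * F (rvec w)) = \int[Q]_w F' (rvec w).
Proof.
move=> lF lF' F'C hF.
have C0 : 0 <= C by rewrite (le_trans _ (F'C 0)).
have mF : measurable_fun setT (fun x : rVbox => F x).
  by apply: (measurable_lip lF) => i; exact: measurable_box_coord.
have mF' : measurable_fun setT (fun x : rVbox => F' x).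
  by apply: (measurable_lip lF') => i; exact: measurable_box_coord.
have mY1 : measurable_fun setT (rvec : T' -> rVbox).
  by apply: measurable_to_box; exact: measurable_rvec.
have mY2 : measurable_fun setT (replace_coord l : R * T' -> rVbox).
  by apply: measurable_to_box; exact: measurable_replace_coord.
have mxF : measurable_fun setT (fun x : rVbox => x 0 l * F x).
  by apply: measurable_funM => //; exact: measurable_box_coord.
have i1 : Q.-integrable setT (EFin \o (fun w => rvec w 0 l * F (rvec w))).
  apply: (rintegrable_quadratic (c := `|F 0| + 2 * C)).
    apply: measurable_funM; first exact: measurable_rvec.
    exact: measurableT_comp mY1.
  move=> w; rewrite normrM.
  have h1 := ler_l1norm (rvec w) l; have h2 := lip_growth (rvec w) lF.
  have := l1norm_ge0 (rvec w); have := normr_ge0 (F 0).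
  move: h1 h2; set y := l1norm _; set a := `|F 0|; set b := `|F _|.
  set r := `|rvec w 0 l|.
  have b0 : 0 <= b by exact: normr_ge0.
  have r0 : 0 <= r by exact: normr_ge0.
  move=> ry ba a0 y0.
  have h : r * b <= y * (a + C * y) by rewrite ler_pM.
  have h2 : a * y <= a * (1 + y ^+ 2).
    by rewrite ler_wpM2l//; have := sqr_ge0 (y - 1); nra.
  have h3 : C * y ^+ 2 <= C * (1 + y ^+ 2) by rewrite ler_wpM2l// lerDr.
  have h4 : 0 <= C * (1 + y ^+ 2) by rewrite mulr_ge0// addr_ge0 ?sqr_ge0.
  lra.
have i1' : Q.-integrable setT (EFin \o (fun w => F' (rvec w))).
  apply: (rintegrable_quadratic (c := C)).
    exact: measurableT_comp mY1.
  move=> w; rewrite (le_trans (F'C _))// ler_peMr// lerDl sqr_ge0//.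
have law := @replace_coord_law l.
have [i2 e2] := same_law_integral (m2 := (gauss \x Q)%E) mY1 mY2 law measurableT mxF i1.
have [i2' e2'] := same_law_integral (m2 := (gauss \x Q)%E) mY1 mY2 law measurableT mF' i1'.
transitivity (\int[Q]_w (rvec w 0 l * F (rvec w))).
  by apply: eq_Rintegral => w _; rewrite mxE.
transitivity (\int[(gauss \x Q)%E]_p (replace_coord l p 0 l * F (replace_coord l p))).
  exact: e2.
apply: esym; transitivity (\int[(gauss \x Q)%E]_p (F' (replace_coord l p))).
  exact: e2'.
apply: esym.
rewrite /Rintegral; congr fine.
have e : (\int[gauss \x Q]_x (replace_coord l x 0 l * F (replace_coord l x))%:E =
  \int[Q]_w \int[gauss]_t (replace_coord l (t, w) 0 l * F (replace_coord l (t, w)))%:E)%E.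
  by rewrite -(integral21_prod_meas1 i2).
have e' : (\int[gauss \x Q]_x (F' (replace_coord l x))%:E =
  \int[Q]_w \int[gauss]_t (F' (replace_coord l (t, w)))%:E)%E.
  by rewrite -(integral21_prod_meas1 i2').
rewrite e e'; apply: eq_integral => w _.
(* The point of that line with vanishing [l]-th coordinate, so that the fresh normal variable is the
   parameter itself. *)
pose a := replace_coord l (0, w).
have rE t : replace_coord l (t, w) = a + t *: delta_mx 0 l.
  apply/rowP => i; rewrite !mxE eqxx/=; case: eqP => _; first by rewrite mulr1 add0r.
  by rewrite mulr0 addr0.
have aff (s t : R) : l1norm ((a + s *: delta_mx 0 l) - (a + t *: delta_mx 0 l)) = `|s - t|.
  by rewrite opprD addrACA subrr add0r -scalerBl l1normZ l1norm_delta mulr1.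
have lip' (s t : R) : `|F' (a + s *: delta_mx 0 l) - F' (a + t *: delta_mx 0 l)| <= C * `|s - t|.
  by rewrite (le_trans (lF' _ _))// aff.
have lipF (s t : R) : `|F (a + s *: delta_mx 0 l) - F (a + t *: delta_mx 0 l)| <= C * `|s - t|.
  by rewrite (le_trans (lF _ _))// aff.
have dF (t : R) : is_derive t (1 : R) (fun t => F (a + t *: delta_mx 0 l)) (F' (a + t *: delta_mx 0 l)).
  apply: (is_derive_of_taylor (C := C)) => s _.
  by rewrite scalerDl addrA; exact: hF.
have := stein1 dF (fun t => F'C _) lip'.
have m1 : measurable_fun setT (fun t : R => F (a + t *: delta_mx 0 l)).
  exact: continuous_measurable_fun (lipschitz_continuous1 lipF).
have m1' : measurable_fun setT (fun t : R => F' (a + t *: delta_mx 0 l)).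
  exact: continuous_measurable_fun (lipschitz_continuous1 lip').
have g1' : rintegrable gauss setT (fun t : R => F' (a + t *: delta_mx 0 l)).
  apply: (rintegrable_normal_quadratic (c := C)) => // t.
  by rewrite (le_trans (F'C _))// ler_peMr// lerDl sqr_ge0.
have g1 : rintegrable gauss setT (fun t : R => t * F (a + t *: delta_mx 0 l)).
  apply: (rintegrable_normal_quadratic (c := `|F a| + 2 * C)).
    by apply: measurable_funM.
  move=> t; rewrite normrM.
  have := lipF t 0; rewrite scale0r addr0 subr0.
  have := ler_normD (F (a + t *: delta_mx 0 l) - F a) (F a); rewrite subrK.
  rewrite -(real_normK (num_real t)).
  have := normr_ge0 t; have := normr_ge0 (F a).
  set b := `|F (_ + _)|; set y := `|t|; set c := `|F a| => c0 y0 h1 h2.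
  have h3 : y * b <= y * (C * y + c) by rewrite ler_wpM2l// (le_trans h1)// lerD2r.
  have h4 : c * y <= c * (1 + y ^+ 2).
    by rewrite ler_wpM2l//; have := sqr_ge0 (y - 1); nra.
  have h5 : C * y ^+ 2 <= C * (1 + y ^+ 2) by rewrite ler_wpM2l// lerDr.
  have h6 : 0 <= C * (1 + y ^+ 2) by rewrite mulr_ge0// addr_ge0 ?sqr_ge0.
  lra.
move=> h.
transitivity ((\int[gauss]_x (x * F (a + x *: delta_mx 0 l)))%:E).
  rewrite /Rintegral fineK; last exact: integrable_fin_num.
  by apply: eq_integral => t _; rewrite rE; congr (_ * _)%:E; rewrite -rE mxE eqxx.
rewrite h /Rintegral fineK; last exact: integrable_fin_num.
by apply: eq_integral => t _; rewrite rE.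
Qed.

End gaussian_vector.

(** * Smoothing *)

Section coordinate_average.
Variables (R : realType) (k : nat).
Notation leb := (@lebesgue_measure R).
Implicit Types (f g G : 'rV[R]_k -> R) (x : 'rV[R]_k) (l : 'I_k) (C : R).

Lemma Rintegral01_cst (c : R) : \int[leb]_(s in `[0, 1]) c = c.
Proof.
rewrite Rintegral_cst//.
have := @lebesgue_measure_itv R `[0, 1].
by rewrite /= lte01 oppr0 adde0 => ->; rewrite mulr1.
Qed.

Lemma le_Rintegral01 (h : R -> R) K : continuous h -> (forall s, s \in `[0, 1] -> `|h s| <= K) ->
  `|\int[leb]_(s in `[0, 1]) h s| <= K.
Proof.
move=> ch hK; have ih := continuous_integrable_itv 0 1 ch.
have cK : continuous (fun _ : R => K) by move=> ?; exact: cvg_cst.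
rewrite (le_trans (le_normr_Rintegral _ ih))// -[leRHS]Rintegral01_cst.
apply: le_Rintegral => //.
- by apply: continuous_integrable_itv => s; apply: continuous_comp;
    [exact: ch|exact: norm_continuous].
- exact: continuous_integrable_itv.
Qed.

Section fixed_width.
Variable delta : R.
Hypothesis delta_gt0 : 0 < delta.

(** Parametrised over the unit interval, whose mass is [1], so that pointwise bounds pass to the
    average without a factor. *)
Definition coord_avg l g x : R :=
  \int[leb]_(s in `[0, 1]) g (x + (delta * s) *: delta_mx 0 l).

Lemma shift_lip l C g x s t : lip C g ->
  `|g (x + (delta * s) *: delta_mx 0 l) - g (x + (delta * t) *: delta_mx 0 l)|
    <= C * delta * `|s - t|.
Proof.
move=> lg; rewrite (le_trans (lg _ _))//.
rewrite opprD addrACA subrr add0r -scalerBl l1normZ l1norm_delta mulr1.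
by rewrite -mulrBr normrM gtr0_norm// mulrA.
Qed.

Lemma continuous_shift l C g x : lip C g ->
  continuous (fun s => g (x + (delta * s) *: delta_mx 0 l)).
Proof. by move=> lg; apply: lipschitz_continuous1 => s t; exact: shift_lip lg. Qed.

Lemma coord_avg_dist l C g x y K : lip C g ->
  (forall v, `|g (x + v) - g (y + v)| <= K) ->
  `|coord_avg l g x - coord_avg l g y| <= K.
Proof.
move=> lg h; have cx := continuous_shift (l := l) (x := x) lg; have cy := continuous_shift (l := l) (x := y) lg.
rewrite /coord_avg -RintegralB//; try exact: continuous_integrable_itv.
apply: le_Rintegral01 => //.
by move=> s; apply: cvgB; [exact: cx|exact: cy].
Qed.

Lemma coord_avg_lip l C g : lip C g -> lip C (coord_avg l g).
Proof.
move=> lg x y; apply: (coord_avg_dist l lg) => v.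
by rewrite (le_trans (lg _ _))// opprD addrACA subrr addr0.
Qed.

Lemma coord_avg_close l C g x : 0 <= C -> lip C g -> `|coord_avg l g x - g x| <= C * delta.
Proof.
move=> C0 lg; have cx := continuous_shift (l := l) (x := x) lg.
have cK : continuous (fun _ : R => g x) by move=> ?; exact: cvg_cst.
rewrite -{1}(Rintegral01_cst (g x)) /coord_avg -RintegralB//; try exact: continuous_integrable_itv.
apply: le_Rintegral01 => [s|s]; first by apply: cvgB; [exact: cx|exact: cK].
rewrite in_itv/= => /andP[s0 s1].
have := shift_lip l x s 0 lg; rewrite mulr0 scale0r addr0 subr0 => /le_trans.
by apply; rewrite ler_piMr ?mulr_ge0 ?(ltW delta_gt0)// ger0_norm.
Qed.

(** The remainder bound holds at every translate and is averaged: partial derivatives already gained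
    are kept, with the same constant. *)
Lemma coord_avg_has_partial j l C g G : lip C g -> lip C G ->
  has_partial j g G C -> has_partial j (coord_avg l g) (coord_avg l G) C.
Proof.
move=> lg lG h x t.
have cx := continuous_shift (l := l) (x := x) lg.
have cxt := continuous_shift (l := l) (x := (x + t *: delta_mx 0 j)) lg.
have cG := continuous_shift (l := l) (x := x) lG.
have ctG : continuous (fun s => t * G (x + (delta * s) *: delta_mx 0 l)).
  by move=> s; apply: cvgM; [exact: cvg_cst|exact: cG].
rewrite /coord_avg -RintegralB//; try exact: continuous_integrable_itv.
rewrite -RintegralZl//; last exact: continuous_integrable_itv.
have cB : continuous (fun s => g (x + t *: delta_mx 0 j + (delta * s) *: delta_mx 0 l) -
    g (x + (delta * s) *: delta_mx 0 l)).
  by move=> s; apply: cvgB; [exact: cxt|exact: cx].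
rewrite -RintegralB//; try exact: continuous_integrable_itv.
apply: le_Rintegral01 => [s|s _]; first by apply: cvgB; [exact: cB|exact: ctG].
by rewrite (addrAC x); exact: h.
Qed.

(** A moving average is the increment of a primitive, so its derivative is the difference quotient
    of [g] over the segment. That quotient is Lipschitz, at the price of [1 / delta]. *)
Lemma coord_avg_new_partial l C g : 0 <= C -> lip C g -> exists C' G,
  [/\ lip C' (coord_avg l g), lip C' G & has_partial l (coord_avg l g) G C'].
Proof.
move=> C0 lg.
pose G x := (g (x + delta *: delta_mx 0 l) - g x) / delta.
have lG : lip (2 * C / delta) G.
  move=> x y; rewrite /G -mulrBl normrM normfV (gtr0_norm delta_gt0).
  rewrite mulrAC ler_pM2r ?invr_gt0//.
  rewrite (_ : _ - _ = (g (x + delta *: delta_mx 0 l) - g (y + delta *: delta_mx 0 l))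
    - (g x - g y)); last by ring.
  rewrite (le_trans (ler_normB _ _))//.
  have := lg x y; have := lg (x + delta *: delta_mx 0 l) (y + delta *: delta_mx 0 l).
  rewrite opprD addrACA subrr addr0; lra.
exists (C + 2 * C / delta), G; split.
- by apply: lipW (coord_avg_lip l lg); rewrite lerDl divr_ge0 ?mulr_ge0// ltW.
- by apply: lipW lG; rewrite lerDr.
move=> x t.
pose eta s := g (x + (delta * s) *: delta_mx 0 l).
have ceta : continuous eta by exact: continuous_shift lg.
(* Moving [x] by [t] along the axis moves the parameter [s] by [tau]; [N] is large enough for
   [[0, 1]] and its translate by [tau]. The two endpoint remainders add up to
   [2 * C / delta * t ^+ 2]. *)
pose tau := t / delta.
pose N := `|tau| + 2.
have [F dF] := local_primitive N ceta.
have tN : - `|tau| <= tau <= `|tau| by rewrite -ler_norml.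
have inN s : s \in `[0, 1] -> s \in `]- N, N[.
  by rewrite !in_itv/= /N => /andP[s0 s1]; apply/andP; split; lra.
have inNt s : s \in `[0, 1] -> s + tau \in `]- N, N[.
  by rewrite !in_itv/= /N => /andP[s0 s1]; apply/andP; split; lra.
have e0 : coord_avg l g x = F 1 - F 0.
  exact: (@FTC2 _ eta F 0 1 ltr01 (fun s h => dF s (inN s h)) ceta).
have e1 : coord_avg l g (x + t *: delta_mx 0 l) = F (1 + tau) - F (0 + tau).
  have -> : coord_avg l g (x + t *: delta_mx 0 l) = \int[leb]_(s in `[0, 1]) eta (s + tau).
    apply: eq_Rintegral => s _; rewrite /eta -addrA -scalerDl /tau.
    by congr (g (_ + _ *: _)); field; rewrite gt_eqF.
  have dFt (s : R) : s \in `[0, 1] -> is_derive s (1 : R) (fun u => F (u + tau)) (eta (s + tau)).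
    move=> /inNt h; have d1 := dF _ h; have d2 := @is_derive_shift R s 1 tau.
    by have := @is_derive1_comp R F (shift tau) s _ _ d1 d2; rewrite mulr1.
  have ceta' : continuous (fun s => eta (s + tau)).
    move=> s; apply: continuous_comp; last exact: ceta.
    by apply: cvgD; [exact: cvg_id|exact: cvg_cst].
  exact: (@FTC2 _ _ (fun s => F (s + tau)) 0 1 ltr01 dFt ceta').
have leta s s' : `|eta s - eta s'| <= C * delta * `|s - s'| by exact: shift_lip lg.
have i0 : 0 \in `[0, 1 : R] by rewrite in_itv/= lexx ler01.
have i1 : 1 \in `[0, 1 : R] by rewrite in_itv/= lexx ler01.
have h0 := taylor_of_is_derive (inN _ i0) (inNt _ i0) dF leta.
have h1 := taylor_of_is_derive (inN _ i1) (inNt _ i1) dF leta.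
have tG : t * G x = tau * eta 1 - tau * eta 0.
  by rewrite /eta mulr1 mulr0 scale0r addr0 /G /tau; field; rewrite gt_eqF.
rewrite e0 e1 tG.
rewrite (_ : _ - _ = (F (1 + tau) - F 1 - tau * eta 1) -
  (F (0 + tau) - F 0 - tau * eta 0)); last by ring.
rewrite (le_trans (ler_normB _ _))// (le_trans (lerD h1 h0))//.
have -> : C * delta * tau ^+ 2 = C / delta * t ^+ 2.
  by rewrite /tau; field; rewrite gt_eqF.
have := mulr_ge0 C0 (sqr_ge0 t); lra.
Qed.

Definition coord_avgs (s : seq 'I_k) g := foldr coord_avg g s.

Lemma coord_avgs_lip s C g : lip C g -> lip C (coord_avgs s g).
Proof. by move=> lg; elim: s => //= l s; exact: coord_avg_lip. Qed.

(** [N] is arbitrary so that the modulus [L * euclidean_norm] is inherited exactly; [lip] supplies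
    the integrability. *)
Lemma coord_avgs_dist (N : 'rV[R]_k -> R) s C g : lip C g ->
  (forall x y, `|g x - g y| <= N (x - y)) ->
  forall x y, `|coord_avgs s g x - coord_avgs s g y| <= N (x - y).
Proof.
move=> lg gN; elim: s => //= l s ih x y.
apply: (coord_avg_dist l (coord_avgs_lip s lg)) => v.
by rewrite (le_trans (ih _ _))// opprD addrACA subrr addr0.
Qed.

Lemma coord_avgs_close s C g x : 0 <= C -> lip C g ->
  `|coord_avgs s g x - g x| <= C * delta * (size s)%:R.
Proof.
move=> C0 lg; elim: s => [|l s ih] /=; first by rewrite subrr normr0 mulr0.
rewrite -(subrK (coord_avgs s g x) (coord_avg _ _ _)) -addrA (le_trans (ler_normD _ _))//.
by rewrite -natr1 mulrDr mulr1 [leRHS]addrC lerD// coord_avg_close//; exact: coord_avgs_lip.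
Qed.

Lemma coord_avgs_has_partial j s C g G : lip C g -> lip C G ->
  has_partial j g G C -> has_partial j (coord_avgs s g) (coord_avgs s G) C.
Proof.
move=> lg lG h; elim: s => //= l s ih.
by apply: coord_avg_has_partial => //; exact: coord_avgs_lip.
Qed.

(** The average in direction [l] creates the partial derivative, and the averages applied after it
    preserve it. *)
Lemma coord_avgs_new_partial l s C g : l \in s -> 0 <= C -> lip C g ->
  exists C' G, [/\ lip C' (coord_avgs s g), lip C' G & has_partial l (coord_avgs s g) G C'].
Proof.
move=> + C0 lg; elim: s => //= a s ih; rewrite in_cons => /predU1P[->|/ih].
  by apply: coord_avg_new_partial C0 _; exact: coord_avgs_lip.
move=> [C' [G [h1 h2 h3]]]; exists C', (coord_avg a G); split.
- exact: coord_avg_lip.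
- exact: coord_avg_lip.
- exact: coord_avg_has_partial.
Qed.

(** One pass over all axes gains one order of differentiability in every direction. *)
Definition smoothing g := coord_avgs (enum 'I_k) g.

Lemma smooth1_smoothing C g : 0 <= C -> lip C g ->
  exists C' (G : 'I_k -> 'rV[R]_k -> R), C <= C' /\ smooth1 C' (smoothing g) G.
Proof.
move=> C0 lg.
have /choice[c hc] : forall l, exists cG : R * ('rV[R]_k -> R),
    [/\ lip cG.1 (smoothing g), lip cG.1 cG.2 & has_partial l (smoothing g) cG.2 cG.1].
  move=> l; have [|C' [G h]] := @coord_avgs_new_partial l (enum 'I_k) C g _ C0 lg.
    by rewrite mem_enum.
  by exists (C', G).
pose C' := C + \sum_l `|(c l).1|.
have cC l : (c l).1 <= C'.
  rewrite (le_trans (ler_norm _))// /C' (bigD1 l)//= addrCA lerDl.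
  by rewrite addr_ge0// sumr_ge0.
have CC' : C <= C' by rewrite lerDl sumr_ge0.
exists C', (fun l => (c l).2); split => //; split.
- exact: lipW CC' (coord_avgs_lip _ lg).
- by move=> l; have [_ h _] := hc l; exact: lipW (cC l) h.
- by move=> l; have [_ _ h] := hc l; exact: has_partialW (cC l) h.
Qed.

End fixed_width.

Lemma lip_euclidean L f : 0 <= L ->
  (forall x y, `|f x - f y| <= L * euclidean_norm (x - y)) -> lip L f.
Proof.
move=> L0 fL x y; rewrite (le_trans (fL x y))// ler_wpM2l//.
rewrite -[leRHS]ger0_norm ?l1norm_ge0// -sqrtr_sqr ler_sqrt ?sqr_ge0//.
rewrite expr2 {1}/l1norm mulr_suml; apply: ler_sum => i _.
by rewrite -real_normK ?num_real// expr2 ler_wpM2l// ler_l1norm.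
Qed.

Definition smooth2 C g (G : 'I_k -> 'rV[R]_k -> R)
    (H : 'I_k -> 'I_k -> 'rV[R]_k -> R) :=
  smooth1 C g G /\ forall l, smooth1 C (G l) (H l).

(** Two passes are made. The first gives partial derivatives [G1]; the second turns them into
    [smoothing delta (G1 l)], which are themselves smooth. *)
Lemma smooth_approximation L f e : 0 <= L -> 0 < e ->
  (forall x y, `|f x - f y| <= L * euclidean_norm (x - y)) ->
  exists C g (G : 'I_k -> 'rV[R]_k -> R) H, [/\ 0 <= C, forall x, `|g x - f x| <= e,
    forall x y, `|g x - g y| <= L * euclidean_norm (x - y) & smooth2 C g G H].
Proof.
move=> L0 e0 fL; have lf := lip_euclidean L0 fL.
(* Each pass moves the function by at most [L * delta * k]; the added [1] keeps the divisor
   positive. *)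
pose D := 2 * L * k%:R + 1.
have D0 : 0 < D by rewrite ltr_wpDl// !mulr_ge0.
pose delta := e / D; have d0 : 0 < delta by rewrite divr_gt0.
pose f1 := smoothing delta f.
have lf1 : lip L f1 by exact: coord_avgs_lip.
have f1L x y : `|f1 x - f1 y| <= L * euclidean_norm (x - y).
  exact: (coord_avgs_dist (N := fun z => L * euclidean_norm z) d0 (enum _) lf fL).
have [C1 [G1 [LC1 [s1 s2 s3]]]] := smooth1_smoothing d0 L0 lf.
have C10 : 0 <= C1 by exact: le_trans LC1.
have /choice[c hc] : forall l, exists cG : R * ('I_k -> 'rV[R]_k -> R),
    C1 <= cG.1 /\ smooth1 cG.1 (smoothing delta (G1 l)) cG.2.
  by move=> l; have [C' [G h]] := smooth1_smoothing d0 C10 (s2 l); exists (C', G).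
pose C := C1 + \sum_l `|(c l).1|.
have cC l : (c l).1 <= C.
  rewrite (le_trans (ler_norm _))// /C (bigD1 l)//= addrCA lerDl.
  by rewrite addr_ge0// sumr_ge0.
have C1C : C1 <= C by rewrite lerDl sumr_ge0.
exists C, (smoothing delta f1), (fun l => smoothing delta (G1 l)), (fun l => (c l).2).
split; first exact: le_trans C1C.
- move=> x; rewrite -(subrK (f1 x) (smoothing _ _ _)) -addrA.
  rewrite (le_trans (ler_normD _ _))//.
  have h1 : `|smoothing delta f1 x - f1 x| <= L * delta * (size (enum 'I_k))%:R.
    exact: coord_avgs_close.
  have h2 : `|f1 x - f x| <= L * delta * (size (enum 'I_k))%:R by exact: coord_avgs_close.
  rewrite (le_trans (lerD h1 h2))// size_enum_ord.
  have -> : L * delta * k%:R + L * delta * k%:R = e * ((2 * L * k%:R) / D).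
    by rewrite /delta; field; rewrite gt_eqF.
  by rewrite ler_piMr ?(ltW e0)// ler_pdivrMr// mul1r /D lerDl.
- exact: (coord_avgs_dist (N := fun z => L * euclidean_norm z) d0 (enum _) lf1 f1L).
- split; first split.
  + exact: lipW C1C (coord_avgs_lip _ _ s1).
  + by move=> l; exact: lipW C1C (coord_avgs_lip _ _ (s2 l)).
  + by move=> l; apply: has_partialW C1C _; exact: coord_avgs_has_partial.
  + move=> l; have [C1c [h1 h2 h3]] := hc l; split.
    * exact: lipW (cC l) h1.
    * by move=> m; exact: lipW (cC l) (h2 m).
    * by move=> m; exact: has_partialW (cC l) (h3 m).
Qed.

End coordinate_average.

(** * Haar measure and integration by parts on the orthogonal group *)

Section orthogonal_matrices.
Variables (R : realType) (n : nat).
Notation orth := (@orthogonal_group R n).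
Implicit Types (U V W B : 'M[R]_n) (i j : 'I_n).

Lemma orthogonal_mulTV V : orth V -> V^T *m V = 1%:M.
Proof. by move=> /= h; exact: mulmx1C. Qed.

Lemma orthogonal_tr V : orth V -> orth V^T.
Proof. by move=> /orthogonal_mulTV h; rewrite /orthogonal_group/= trmxK. Qed.

Lemma orthogonal_mul U V : orth U -> orth V -> orth (U *m V).
Proof.
rewrite /orthogonal_group/= => hU hV.
by rewrite trmx_mul mulmxA -(mulmxA U) hV mulmx1.
Qed.

Lemma orthogonal_entry V i j : orth V -> `|V i j| <= 1.
Proof.
move=> hV.
have : \sum_(l < n) V i l ^+ 2 = 1.
  have := congr1 (fun W : 'M[R]_n => W i i) hV; rewrite !mxE eqxx /= mulr1n => <-.
  by apply: eq_bigr => l _; rewrite mxE expr2.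
rewrite (bigD1 j)//= => h.
rewrite -(ler_pXn2r (n := 2)) ?nnegrE// expr1n real_normK ?num_real// -h.
by rewrite lerDl sumr_ge0// => l _; exact: sqr_ge0.
Qed.

Lemma orthogonal_trace B : exists K, forall V, orth V -> `|\tr (B *m V)| <= K.
Proof.
exists (\sum_i \sum_j `|B i j|) => V hV.
rewrite /mxtrace (le_trans (ler_norm_sum _ _ _))//; apply: ler_sum => i _.
rewrite mxE (le_trans (ler_norm_sum _ _ _))//; apply: ler_sum => j _.
by rewrite normrM ler_piMr// orthogonal_entry.
Qed.

Lemma measurable_entry i j : measurable_fun setT (fun V : borel_mx R n => V i j : R).
Proof.
move=> mT; apply: (measurability _ (RGenOpens.measurableE R)) => //.
move=> _ [_ [a [b ->] <-]]; rewrite setTI; apply: sub_sigma_algebra.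
have /continuousP := @coord_continuous R n n i j; apply.
exact: interval_open.
Qed.

Lemma open_mulmx U (A : set 'M[R]_n) : open A -> open [set V | A (U *m V)].
Proof.
rewrite !openE => oA V /= /oA /nbhs_ballP[e /= e0 eA].
(* [K] bounds every absolute row sum of [U], hence its norm with respect to the sup norm, and is
   positive. *)
pose K := 1 + \sum_i \sum_j `|U i j|.
have K0 : 0 < K by rewrite ltr_wpDr// sumr_ge0// => i _; rewrite sumr_ge0.
apply/nbhs_ballP; exists (e / K); first by rewrite /= divr_gt0.
move=> W [_ VW]; apply: eA; split => // i j; rewrite /ball/=.
rewrite !mxE -sumrB (le_lt_trans (ler_norm_sum _ _ _))//.
apply: (@le_lt_trans _ _ (\sum_l `|U i l| * (e / K))).
  apply: ler_sum => l _; rewrite -mulrBr normrM ler_wpM2l//.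
  exact/ltW/VW.
rewrite -mulr_suml mulrA ltr_pdivrMr// [ltRHS]mulrC ltr_pM2r//.
rewrite /K; apply: ltr_pwDl => //; rewrite [leRHS](bigD1 i)//= lerDl sumr_ge0// => l _.
by rewrite sumr_ge0.
Qed.

Lemma measurable_mulmx U :
  measurable_fun setT ((fun V => U *m V) : borel_mx R n -> borel_mx R n).
Proof.
apply: (@measurability _ _ _ (borel_mx R n) _ _ (@open 'M[R]_n)) => //.
move=> _ [A oA <-]; rewrite setTI; apply: sub_sigma_algebra.
exact: open_mulmx.
Qed.

Lemma measurable_trace B :
  measurable_fun setT (fun V : borel_mx R n => \tr (B *m V) : R).
Proof.
apply: measurable_sum => i; under eq_fun do rewrite mxE.
by apply: measurable_sum => j; apply: measurable_funM => //; exact: measurable_entry.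
Qed.

Lemma measurable_orthogonal : measurable (orth : set (borel_mx R n)).
Proof.
have -> : (orth : set (borel_mx R n)) = \bigcap_(ij in [set: 'I_n * 'I_n])
    ((fun V : borel_mx R n => \sum_l (V : 'M[R]_n) ij.1 l * (V : 'M[R]_n) ij.2 l)
     @^-1` [set (ij.1 == ij.2)%:R]).
  apply/seteqP; split=> V /= h.
    move=> [i j] _ /=; have := congr1 (fun W : 'M[R]_n => W i j) h.
    by rewrite !mxE => <-; apply: eq_bigr => l _; rewrite mxE.
  apply/matrixP => i j; rewrite !mxE -(h (i, j) I)/=.
  by apply: eq_bigr => l _; rewrite mxE.
apply: fin_bigcap_measurable => // -[i j] _ /=.
rewrite -[X in measurable X]setTI.
have mf : measurable_fun setT (fun V : borel_mx R n =>
    \sum_l (V : 'M[R]_n) i l * (V : 'M[R]_n) j l).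
  by apply: measurable_sum => l; apply: measurable_funM; exact: measurable_entry.
exact: mf.
Qed.

End orthogonal_matrices.

(** * Integration against Haar measure *)

Section haar_integrals.
Variables (R : realType) (n : nat).
Notation orth := (@orthogonal_group R n).
Variable mu : probability (borel_mx R n) R.
Hypothesis mu_haar : haar_orthogonal mu.
Let mO := @measurable_orthogonal R n.
Implicit Types (F : 'M[R]_n -> R) (U V B E : 'M[R]_n).

Definition bounded_orth F := exists K, forall V, orth V -> `|F V| <= K.

Lemma rintegrable_bounded F :
  measurable_fun setT (F : borel_mx R n -> R) -> bounded_orth F ->
  rintegrable mu orth (F : borel_mx R n -> R).
Proof.
move=> mF [K FK]; apply: (rintegrable_le mO (G := fun=> K)) => //.
- exact: measurable_funTS.
- exact: rintegrable_cst.
Qed.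

Lemma Rintegral_orth_cst (c : R) : \int[mu]_(V in orth) c = c.
Proof.
rewrite Rintegral_cst//; transitivity (c * fine (1 : \bar R)%E).
  by congr (_ * fine _); exact: mu_haar.1.
by rewrite mulr1.
Qed.

(** Left translation preserves the law, and it maps the group onto itself, so the domain of
    integration does not change. *)
Lemma haar_invariant U F : orth U ->
  measurable_fun setT (F : borel_mx R n -> R) -> bounded_orth F ->
  \int[mu]_(V in orth) F (U *m V) = \int[mu]_(V in orth) F V.
Proof.
move=> hU mF bF; have iF := rintegrable_bounded mF bF.
have mU := measurable_mulmx U.
have [|_] := @same_law_integral _ _ _ _ _ _ R mu mu idfun
  ((fun V => U *m V) : borel_mx R n -> borel_mx R n) (@measurable_id _ _ _) mU _ _ F mO mF iF.
  (* Invariance is given for images, whereas laws involve preimages: the preimage under [U] is the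
     image under its transpose. *)
  move=> A mA /=; rewrite preimage_id -(mu_haar.2 _ _ (orthogonal_tr hU) mA).
  congr (mu _); apply/seteqP; split=> V /=.
    move=> [W AW <-]; by rewrite mulmxA hU mul1mx.
  move=> AUV; exists (U *m V) => //.
  by rewrite mulmxA (orthogonal_mulTV hU) mul1mx.
move=> h; rewrite -[RHS]/(\int[mu]_(V in idfun @^-1` orth) F V) h.
congr (\int[mu]_(V in _) _); apply/seteqP; split=> V /=.
  exact: orthogonal_mul.
move=> h2; have := orthogonal_mul (orthogonal_tr hU) h2.
by rewrite mulmxA (orthogonal_mulTV hU) mul1mx.
Qed.

End haar_integrals.

(** * Plane rotations and their generators *)

Section rotations.
Variables (R : realType) (n : nat).
Notation orth := (@orthogonal_group R n).
Implicit Types (V B E : 'M[R]_n) (t : R).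

(** This is [1 - cos] of the angle with sine [t]. Parametrising by the sine turns Rodrigues' formula
    into an algebraic expression, with no matrix exponential. *)
Definition rotation_defect t : R := 1 - Num.sqrt (1 - t ^+ 2).

(* For [E = e_i e_j^T - e_j e_i^T] this is the rotation of angle [arcsin t] in
   the plane of [e_i] and [e_j]. *)
Definition rotation E t : 'M[R]_n :=
  1%:M + t *: E + rotation_defect t *: (E *m E).

Lemma rotation_defect_bound t : `|t| <= 1 -> 0 <= rotation_defect t <= t ^+ 2.
Proof.
move=> t1; have t2 : 0 <= 1 - t ^+ 2 <= 1.
  by rewrite subr_ge0 gerBl sqr_ge0 andbT -real_normK ?num_real// expr_le1.
set s := Num.sqrt (1 - t ^+ 2).
have s0 : 0 <= s by exact: sqrtr_ge0.
have s2 : s ^+ 2 = 1 - t ^+ 2 by rewrite sqr_sqrtr//; case/andP: t2.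
rewrite /rotation_defect -/s; apply/andP; split; nra.
Qed.

(** With [c] the defect, the cubic relation reduces the product with the transpose to the identity
    plus [(2 * c - t ^+ 2 - c ^+ 2) *: (E *m E)], and [c] is a root of that coefficient. *)
Lemma rotation_orthogonal E t : `|t| <= 1 -> E^T = - E -> E *m E *m E = - E ->
  orth (rotation E t).
Proof.
move=> t1 ET E3; rewrite /orthogonal_group /= /rotation.
set c := rotation_defect t.
have hc : 2 * c = t ^+ 2 + c ^+ 2.
  have t2 : 0 <= 1 - t ^+ 2.
    by rewrite subr_ge0 -real_normK ?num_real// expr_le1.
  have := sqr_sqrtr t2; rewrite /c /rotation_defect.
  set s := Num.sqrt _ => hs; have -> : t ^+ 2 = 1 - s ^+ 2 by rewrite hs; ring.
  by ring.
rewrite !linearD/= !linearZ/= trmx1 trmx_mul ET.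
rewrite !(mulmxDl, mulmxN, mulNmx, opprK) -!scalemxAl !mul1mx !mulmx1.
rewrite !mulmxA E3 !mulNmx.
apply/matrixP => i j; rewrite !mxE.
set x := \sum_(_ < _) _; set y := E i j; set z := (_ == _)%:R.
apply/eqP; rewrite -subr_eq0; apply/eqP.
transitivity (x * (2 * c - (t ^+ 2 + c ^+ 2))); first by ring.
by rewrite hc subrr mulr0.
Qed.

Definition skew (i j : 'I_n) : 'M[R]_n := delta_mx i j - delta_mx j i.

Lemma skew_tr i j : (skew i j)^T = - skew i j.
Proof. by rewrite /skew linearB/= !trmx_delta opprB. Qed.

(** The degenerate case [i = j], where the generator is zero, is kept so that sums can run over all
    ordered pairs. *)
Lemma skew_sqr i j : skew i j *m skew i j =
  (i == j)%:R *: (delta_mx i j *+ 2) - delta_mx i i - delta_mx j j.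
Proof.
rewrite /skew mulmxBl !mulmxBr !mul_delta_mx_cond !eqxx !mulr1n.
rewrite (eq_sym j i); case: eqVneq => [->|_] /=.
  by rewrite mulr1n scale1r !subrr mulr2n addrK subrr.
by rewrite scale0r !mulr0n !sub0r subr0 addrC.
Qed.

Lemma skew_cube i j : skew i j *m skew i j *m skew i j = - skew i j.
Proof.
rewrite skew_sqr; case: eqVneq => [->|ij].
  by rewrite /skew subrr mulmx0 oppr0.
rewrite /skew scale0r sub0r -opprD mulNmx mulmxDl !mulmxBr.
rewrite !mul_delta_mx_cond !eqxx (negbTE ij) eq_sym (negbTE ij).
by rewrite !mulr0n !mulr1n subr0 sub0r.
Qed.

(** The Casimir element, and the origin of [n - 1]: each index lies in [n - 1] planes, and each
    plane is counted twice. *)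
Lemma sum_skew_sqr : \sum_i \sum_j skew i j *m skew i j =
  - ((n%:R - 1) *+ 2)%:M.
Proof.
apply/matrixP => a b; rewrite summxE.
under eq_bigr do rewrite summxE.
under eq_bigr => i _ do under eq_bigr => j _ do rewrite skew_sqr !mxE.
under eq_bigr => i _ do rewrite sumrB sumrB.
rewrite !sumrB.
have e1 : \sum_i \sum_j ((i == j)%:R * ((a == i) && (b == j))%:R *+ 2) =
    (a == b)%:R *+ 2 :> R.
  rewrite (bigD1 a)//= [X in _ + X]big1 ?addr0; last first.
    move=> i ia; rewrite big1// => j _.
    by rewrite [a == i]eq_sym (negbTE ia) mulr0 mul0rn.
  rewrite (bigD1 b)//= [X in _ + X]big1 ?addr0; last first.
    by move=> j jb; rewrite [b == j]eq_sym (negbTE jb) andbF mulr0 mul0rn.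
  by rewrite !eqxx mulr1.
have e2 : \sum_(i < n) \sum_(j < n) ((a == i) && (b == i))%:R = (a == b)%:R * n%:R :> R.
  under eq_bigr do rewrite sumr_const card_ord -[_ *+ n]mulr_natr.
  rewrite -mulr_suml; congr (_ * _).
  rewrite (bigD1 a)//= [X in _ + X]big1 ?addr0 ?eqxx 1?eq_sym// => i ia.
  by rewrite [a == i]eq_sym (negbTE ia).
have e3 : \sum_(i < n) \sum_(j < n) ((a == j) && (b == j))%:R = (a == b)%:R * n%:R :> R.
  by rewrite exchange_big/= e2.
rewrite (_ : \sum_(i < n) _ = (a == b)%:R *+ 2); last first.
  by rewrite -e1; apply: eq_bigr => i _; apply: eq_bigr => j _; rewrite mulr2n -mulrDr.
rewrite e2 e3.
by rewrite !mxE; case: (a == b); rewrite ?mulr1n ?mulr0n/=; ring.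
Qed.

Lemma trace_mul_delta B i j : \tr (B *m delta_mx i j) = B j i.
Proof.
rewrite /mxtrace (bigD1 j)//= big1 ?addr0 => [|l lj].
  rewrite mxE (bigD1 i)//= big1 ?addr0 => [|m mi]; rewrite !mxE ?eqxx ?mulr1//.
  by rewrite (negbTE mi) mulr0.
by rewrite mxE big1// => m _; rewrite mxE (negbTE lj) andbF mulr0.
Qed.

Lemma trace_skew B i j : \tr (B *m skew i j) = B j i - B i j.
Proof. by rewrite /skew mulmxBr linearB/= !trace_mul_delta. Qed.

(** Pairing with all generators only sees antisymmetric parts. With [B = V *m A l] and
    [C = V *m A m], the first trace becomes [n] times a Kronecker delta and the second one becomes
    [trace2]. *)
Lemma sum_trace_skew B C : \sum_i \sum_j \tr (B *m skew i j) * \tr (C *m skew i j) =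
  (\tr (B *m C^T) - \tr (B *m C)) *+ 2.
Proof.
under eq_bigr => i _ do under eq_bigr => j _ do rewrite !trace_skew.
have tT : \tr (B *m C^T) = \sum_i \sum_j B i j * C i j.
  by apply: eq_bigr => i _; rewrite mxE; apply: eq_bigr => j _; rewrite mxE.
have t1 : \tr (B *m C) = \sum_i \sum_j B i j * C j i.
  by apply: eq_bigr => i _; rewrite mxE.
have tT' : \tr (B *m C^T) = \sum_i \sum_j B j i * C j i by rewrite tT exchange_big.
have t1' : \tr (B *m C) = \sum_i \sum_j B j i * C i j by rewrite t1 exchange_big.
rewrite mulr2n {1}tT' {1}t1' tT t1 -!sumrB -big_split/=; apply: eq_bigr => i _.
rewrite -!sumrB -big_split/=; apply: eq_bigr => j _; ring.
Qed.

End rotations.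

(** * First-order expansions along rotations and integration by parts on the group *)

Section haar_ibp.
Variables (R : realType) (n : nat).
Notation orth := (@orthogonal_group R n).
Variable mu : probability (borel_mx R n) R.
Hypothesis mu_haar : haar_orthogonal mu.
Let mO := @measurable_orthogonal R n.
Implicit Types (V B E : 'M[R]_n) (p q : R -> 'M[R]_n -> R).

(** A first-order expansion in [t], uniform over the group. The bounds on [p0] and [p1] are included
    so that the notion is closed under products. *)
Definition expands p (p0 p1 : 'M[R]_n -> R) := exists K, forall V, orth V ->
  [/\ `|p0 V| <= K, `|p1 V| <= K &
      forall t, `|t| <= 1 -> `|p t V - p0 V - t * p1 V| <= K * t ^+ 2].

Lemma expandsD p (p0 p1 : 'M[R]_n -> R) q (q0 q1 : 'M[R]_n -> R) : expands p p0 p1 -> expands q q0 q1 ->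
  expands (fun t V => p t V + q t V) (fun V => p0 V + q0 V) (fun V => p1 V + q1 V).
Proof.
move=> [K hK] [L hL]; exists (K + L) => V hV.
have [a0 a1 a2] := hK V hV; have [b0 b1 b2] := hL V hV; split.
- by rewrite (le_trans (ler_normD _ _))// lerD.
- by rewrite (le_trans (ler_normD _ _))// lerD.
move=> t t1.
rewrite (_ : _ - _ = (p t V - p0 V - t * p1 V) + (q t V - q0 V - t * q1 V)); last by ring.
by rewrite (le_trans (ler_normD _ _))// mulrDl lerD// ?a2 ?b2.
Qed.

(** The product rule leaves six error terms, each at most [K * L * t ^+ 2] because [|t| <= 1]; the
    factor [8] is slack. *)
Lemma expandsM p (p0 p1 : 'M[R]_n -> R) q (q0 q1 : 'M[R]_n -> R) : expands p p0 p1 -> expands q q0 q1 ->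
  expands (fun t V => p t V * q t V) (fun V => p0 V * q0 V)
    (fun V => p1 V * q0 V + p0 V * q1 V).
Proof.
move=> [K hK] [L hL]; exists (8 * (K * L)) => V hV.
have [a0 a1 a2] := hK V hV; have [b0 b1 b2] := hL V hV.
have K0 : 0 <= K by exact: le_trans a0.
have L0 : 0 <= L by exact: le_trans b0.
have KL : 0 <= K * L by rewrite mulr_ge0.
split.
- by rewrite normrM (@le_trans _ _ (K * L))//; [exact: ler_pM|lra].
- rewrite (le_trans (ler_normD _ _))// !normrM.
  rewrite (@le_trans _ _ (K * L + K * L))//; last by lra.
  by rewrite lerD// ler_pM.
move=> t t1; have {}a2 := a2 t t1; have {}b2 := b2 t t1.
set r := p t V - p0 V - t * p1 V in a2; set s := q t V - q0 V - t * q1 V in b2.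
have t2 : t ^+ 2 <= 1 by rewrite -real_normK ?num_real// expr_le1.
have t20 := sqr_ge0 t.
have s1 : `|s| <= L by rewrite (le_trans b2)// ler_piMr.
rewrite (_ : _ - _ = t ^+ 2 * (p1 V * q1 V) + r * q0 V + r * (t * q1 V) + r * s
  + p0 V * s + t * p1 V * s); last by rewrite /r /s; ring.
have h1 : `|t ^+ 2 * (p1 V * q1 V)| <= K * L * t ^+ 2.
  by rewrite normrM (ger0_norm t20) normrM mulrC ler_wpM2r// ler_pM.
have h2 : `|r * q0 V| <= K * L * t ^+ 2.
  by rewrite normrM mulrAC ler_pM.
have h3 : `|r * (t * q1 V)| <= K * L * t ^+ 2.
  rewrite normrM mulrAC ler_pM// normrM -[leRHS]mul1r ler_pM//.
have h4 : `|r * s| <= K * L * t ^+ 2 by rewrite normrM mulrAC ler_pM.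
have h5 : `|p0 V * s| <= K * L * t ^+ 2 by rewrite normrM -mulrA ler_pM.
have h6 : `|t * p1 V * s| <= K * L * t ^+ 2.
  by rewrite normrM -mulrA ler_pM// normrM -[leRHS]mul1r ler_pM.
have KLt : 0 <= K * L * t ^+ 2 by rewrite mulr_ge0.
move: h1 h2 h3 h4 h5 h6; rewrite !ler_norml.
move=> /andP[? ?] /andP[? ?] /andP[? ?] /andP[? ?] /andP[? ?] /andP[? ?].
by apply/andP; split; lra.
Qed.

Lemma expands_cst0 : expands (fun _ _ => 0) (fun=> 0) (fun=> 0).
Proof.
exists 0 => V _; split=> [||t _]; rewrite ?normr0//.
by rewrite mulr0 !subr0 normr0 mul0r.
Qed.

Lemma expands_sum (I : Type) (s : seq I) (p : I -> R -> 'M[R]_n -> R)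
    (p0 p1 : I -> 'M[R]_n -> R) : (forall i, expands (p i) (p0 i) (p1 i)) ->
  expands (fun t V => \sum_(i <- s) p i t V) (fun V => \sum_(i <- s) p0 i V)
    (fun V => \sum_(i <- s) p1 i V).
Proof.
move=> h; elim: s => [|i s ih].
  have [K hK] := expands_cst0; exists K => V /hK[a b c].
  by rewrite !big_nil; split => // t t1; rewrite big_nil; exact: c.
have [K hK] := expandsD (h i) ih; exists K => V /hK[a b c].
by rewrite !big_cons; split => // t t1; rewrite big_cons; exact: c.
Qed.

Lemma expands_bounded p (p0 p1 : 'M[R]_n -> R) : expands p p0 p1 ->
  bounded_orth p0 /\ bounded_orth p1.
Proof. by move=> [K hK]; split; exists K => V /hK[]. Qed.

(** By invariance the integral of [p t] does not depend on [t], so the integral [I] of [p1]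
    satisfies [|t * I| <= K * t ^+ 2]; dividing by a small [t] forces [I = 0]. *)
Lemma haar_derivative p (p0 p1 : 'M[R]_n -> R) E : E^T = - E -> E *m E *m E = - E ->
  expands p p0 p1 -> (forall t V, p t V = p0 (rotation E t *m V)) ->
  measurable_fun setT (p0 : borel_mx R n -> R) ->
  measurable_fun setT (p1 : borel_mx R n -> R) ->
  \int[mu]_(V in orth) p1 V = 0.
Proof.
move=> ET E3 hp pE m0 m1; have [b0 b1] := expands_bounded hp.
have [K hK] := hp.
have i0 := rintegrable_bounded mu m0 b0; have i1 := rintegrable_bounded mu m1 b1.
set I := \int[mu]_(V in orth) p1 V.
have It t : `|t| <= 1 -> `|t * I| <= K * t ^+ 2.
  move=> t1; have hR := rotation_orthogonal t1 ET E3.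
  have mR : measurable_fun setT ((fun V => p0 (rotation E t *m V)) : borel_mx R n -> R).
    exact: measurableT_comp m0 (measurable_mulmx _).
  have iR : rintegrable mu orth (fun V => p0 (rotation E t *m V)).
    apply: rintegrable_bounded => //.
    by have [L hL] := b0; exists L => V hV; apply: hL; exact: orthogonal_mul.
  have := Rintegral_first_order (t := t) mO i0 iR i1
    (rintegrable_cst mu mO (K * t ^+ 2)).
  rewrite (haar_invariant mu_haar hR m0 b0) subrr sub0r normrN.
  rewrite (Rintegral_orth_cst mu_haar); apply => V hV.
  by rewrite -pE; have [_ _] := hK V hV; apply.
apply/eqP; rewrite -normr_le0; apply/ler_addgt0Pr => e e0; rewrite add0r.
pose t := Num.min 1 (e / (`|K| + 1)).
have K1 : 0 < `|K| + 1 by rewrite ltr_wpDl.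
have t0 : 0 < t by rewrite lt_min ltr01 divr_gt0.
have t1 : `|t| <= 1 by rewrite gtr0_norm// ge_min lexx.
have te : (`|K| + 1) * t <= e by rewrite mulrC -ler_pdivlMr// ge_min lexx orbT.
have := It t t1; rewrite normrM (gtr0_norm t0) expr2 mulrCA ler_pM2l// => /le_trans.
apply; rewrite (le_trans _ te)// ler_wpM2r ?(ltW t0)//.
by rewrite (le_trans (ler_norm K))// lerDl.
Qed.

Lemma rotation_trace B E t V : \tr (B *m (rotation E t *m V)) =
  \tr (B *m V) + t * \tr (B *m (E *m V)) +
    rotation_defect t * \tr (B *m (E *m E *m V)).
Proof.
rewrite /rotation !mulmxDl mul1mx !mulmxDr !linearD/=.
by rewrite -!scalemxAl -!scalemxAr !linearZ.
Qed.

Lemma trace_bounded B E : exists K, forall V, orth V -> `|\tr (B *m (E *m V))| <= K.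
Proof.
have [K hK] := orthogonal_trace (B *m E); exists K => V /hK.
by rewrite mulmxA.
Qed.

(** The remainder is exactly [rotation_defect t] times a bounded trace, and the defect is at most
    [t ^+ 2]. *)
Lemma expands_trace B E :
  expands (fun t V => \tr (B *m (rotation E t *m V))) (fun V => \tr (B *m V))
    (fun V => \tr (B *m (E *m V))).
Proof.
have [K0 h0] := orthogonal_trace B; have [K1 h1] := trace_bounded B E.
have [K2 h2] := trace_bounded B (E *m E).
exists (`|K0| + `|K1| + `|K2|) => V hV; split.
- rewrite (le_trans (h0 V hV))// (le_trans (ler_norm K0))// -addrA lerDl.
  by rewrite addr_ge0.
- rewrite (le_trans (h1 V hV))// (le_trans (ler_norm K1))//.
  by rewrite (addrC `|K0|) -addrA lerDl addr_ge0.
move=> t t1; rewrite rotation_trace addrAC -(addrA (\tr _)) addrAC.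
rewrite [X in `|X|](_ : _ = rotation_defect t * \tr (B *m (E *m E *m V))); last by ring.
have /andP[c0 ct] := rotation_defect_bound t1.
rewrite normrM (ger0_norm c0) mulrC ler_pM//.
rewrite (le_trans (h2 V hV))// (le_trans (ler_norm K2))//.
by rewrite lerDr addr_ge0.
Qed.

Variables (k : nat) (A : 'I_k -> 'M[R]_n).

Definition trace_vector V : 'rV[R]_k := \row_i \tr (A i *m V).

Lemma measurable_trace_vector i :
  measurable_fun setT (fun V : borel_mx R n => trace_vector V 0 i : R).
Proof. by under eq_fun do rewrite mxE; exact: measurable_trace. Qed.

Lemma measurable_lip_trace C (g : 'rV[R]_k -> R) : lip C g ->
  measurable_fun setT ((fun V => g (trace_vector V)) : borel_mx R n -> R).
Proof.
move=> lg; apply: (@measurable_lip _ (borel_mx R n) R k C g trace_vector) => //.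
exact: measurable_trace_vector.
Qed.

Lemma trace_vector_bounded : exists K, forall V, orth V -> l1norm (trace_vector V) <= K.
Proof.
have /choice[c hc] := fun i => orthogonal_trace (A i).
exists (\sum_i c i) => V hV; apply: ler_sum => i _; rewrite mxE; exact: hc.
Qed.

Lemma lip_trace_bounded C (g : 'rV[R]_k -> R) : lip C g -> 0 <= C ->
  bounded_orth (fun V => g (trace_vector V)).
Proof.
move=> lg C0; have [K hK] := trace_vector_bounded.
exists (`|g 0| + C * K) => V /hK h.
by rewrite (le_trans (lip_growth _ lg))// lerD2l ler_wpM2l.
Qed.

(** The chain rule. The trace vector moves by [t *: y + c *: z] with [c <= t ^+ 2], so only [y]
    enters at first order, and the Taylor error is quadratic in [t]. *)
Lemma expands_smooth C g (G : 'I_k -> 'rV[R]_k -> R) E : 0 <= C -> smooth1 C g G ->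
  expands (fun t V => g (trace_vector (rotation E t *m V)))
    (fun V => g (trace_vector V))
    (fun V => \sum_m G m (trace_vector V) * \tr (A m *m (E *m V))).
Proof.
move=> C0 sg; have [lg lG dG] := sg.
have [K0 h0] := lip_trace_bounded lg C0.
have GC m x : `|G m x| <= C by exact: has_partial_bound lg (dG m).
have /choice[c1 hc1] := fun i => trace_bounded (A i) E.
have /choice[c2 hc2] := fun i => trace_bounded (A i) (E *m E).
pose S1 := \sum_i `|c1 i|; pose S2 := \sum_i `|c2 i|.
have S10 : 0 <= S1 by rewrite sumr_ge0.
have S20 : 0 <= S2 by rewrite sumr_ge0.
have q0 : 0 <= 2 * C * (S1 + S2) ^+ 2 by rewrite mulr_ge0 ?sqr_ge0// mulr_ge0.
exists (`|K0| + C * S1 + (2 * C * (S1 + S2) ^+ 2 + C * S2)) => V hV.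
have CS1 : 0 <= C * S1 by rewrite mulr_ge0.
have CS2 : 0 <= C * S2 by rewrite mulr_ge0.
have K00 := normr_ge0 K0.
pose y : 'rV[R]_k := \row_i \tr (A i *m (E *m V)).
pose z : 'rV[R]_k := \row_i \tr (A i *m (E *m E *m V)).
have yS : l1norm y <= S1.
  apply: ler_sum => i _; rewrite mxE; apply: le_trans (ler_norm _); exact: hc1.
have zS : l1norm z <= S2.
  apply: ler_sum => i _; rewrite mxE; apply: le_trans (ler_norm _); exact: hc2.
have sumE : \sum_m G m (trace_vector V) * \tr (A m *m (E *m V)) =
    \sum_m G m (trace_vector V) * y 0 m.
  by apply: eq_bigr => m _; rewrite mxE.
split.
- by have := h0 V hV; have := ler_norm K0; lra.
- rewrite sumE (@le_trans _ _ (C * S1))//; last by lra.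
  by rewrite (le_trans (ler_sum_l1norm _ (fun m => GC m _)))// ler_wpM2l.
move=> t t1; have /andP[c0 ct] := rotation_defect_bound t1.
set c := rotation_defect t in c0 ct.
have tv : trace_vector (rotation E t *m V) = trace_vector V + (t *: y + c *: z).
  by apply/rowP => i; rewrite !mxE rotation_trace addrA.
have := smooth1_taylor (trace_vector V) (t *: y + c *: z) sg.
rewrite tv sumE.
have -> : \sum_m G m (trace_vector V) * (t *: y + c *: z) 0 m =
    t * (\sum_m G m (trace_vector V) * y 0 m) + c * (\sum_m G m (trace_vector V) * z 0 m).
  rewrite !mulr_sumr -big_split/=; apply: eq_bigr => m _; rewrite !mxE; ring.
have hz : `|c * (\sum_m G m (trace_vector V) * z 0 m)| <= t ^+ 2 * (C * S2).
  rewrite normrM (ger0_norm c0) ler_pM//.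
  by rewrite (le_trans (ler_sum_l1norm _ (fun m => GC m _)))// ler_wpM2l.
have hl : l1norm (t *: y + c *: z) ^+ 2 <= (S1 + S2) ^+ 2 * t ^+ 2.
  rewrite -(real_normK (num_real t)) -exprMn.
  rewrite ler_pXn2r ?nnegrE ?l1norm_ge0 ?mulr_ge0 ?addr_ge0//.
  rewrite (le_trans (l1normD _ _))// !l1normZ (ger0_norm c0).
  have ctt : c <= `|t|.
    by rewrite (le_trans ct)// -real_normK ?num_real// expr2 ler_piMr.
  have ty : `|t| * l1norm y <= `|t| * S1 by rewrite ler_wpM2l.
  have cz : c * l1norm z <= `|t| * S2 by rewrite ler_pM// l1norm_ge0.
  lra.
have h2 : 2 * C * l1norm (t *: y + c *: z) ^+ 2 <= 2 * C * ((S1 + S2) ^+ 2 * t ^+ 2).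
  by rewrite ler_wpM2l// mulr_ge0.
have hK : 0 <= (`|K0| + C * S1) * t ^+ 2 by rewrite mulr_ge0 ?sqr_ge0// addr_ge0.
move: hz h2 hK; set Y := \sum_m _ * y 0 m; set Z := c * _; set L := l1norm _ ^+ 2.
set g1 := g _; set g2 := g _; set S := (S1 + S2) ^+ 2; set T := t ^+ 2.
rewrite !ler_norml => /andP[? ?] ? ? /andP[? ?].
by apply/andP; split; lra.
Qed.

Lemma bounded_orthM (F G : 'M[R]_n -> R) : bounded_orth F -> bounded_orth G ->
  bounded_orth (fun V => F V * G V).
Proof.
move=> [K hK] [L hL]; exists (K * L) => V hV.
by rewrite normrM ler_pM// ?hK ?hL.
Qed.

Lemma bounded_orthB (F G : 'M[R]_n -> R) : bounded_orth F -> bounded_orth G ->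
  bounded_orth (fun V => F V - G V).
Proof.
move=> [K hK] [L hL]; exists (K + L) => V hV.
by rewrite (le_trans (ler_normB _ _))// lerD ?hK ?hL.
Qed.

Lemma bounded_orth_cst (c : R) : bounded_orth (fun _ : 'M[R]_n => c).
Proof. by exists `|c|. Qed.

Lemma bounded_orth_sum (I : Type) (s : seq I) (F : I -> 'M[R]_n -> R) :
  (forall i, bounded_orth (F i)) -> bounded_orth (fun V => \sum_(i <- s) F i V).
Proof.
move=> h; elim: s => [|i s [K hK]]; first by exists 0 => V _; rewrite big_nil normr0.
have [L hL] := h i; exists (L + K) => V hV; rewrite big_cons.
by rewrite (le_trans (ler_normD _ _))// lerD ?hL ?hK.
Qed.

Lemma bounded_orth_trace B : bounded_orth (fun V => \tr (B *m V)).
Proof. exact: orthogonal_trace. Qed.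

Definition trace2 l m V : R := \tr (V *m A l *m (V *m A m)).

Lemma bounded_orth_trace2 l m : bounded_orth (trace2 l m).
Proof.
have e V : trace2 l m V = \sum_a \sum_b
    (\tr ((A l *m delta_mx b a) *m V) * \tr ((A m *m delta_mx a b) *m V)).
  rewrite /trace2 {1}/mxtrace; apply: eq_bigr => a _; rewrite mxE; apply: eq_bigr => b _.
  by rewrite ![\tr (_ *m V)]mxtrace_mulC !mulmxA !trace_mul_delta.
have -> : trace2 l m = (fun V => \sum_a \sum_b
    (\tr ((A l *m delta_mx b a) *m V) * \tr ((A m *m delta_mx a b) *m V))).
  by apply/funext => V.
apply: bounded_orth_sum => a; apply: bounded_orth_sum => b.
by apply: bounded_orthM; exact: bounded_orth_trace.
Qed.

Lemma measurable_trace2 l m :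
  measurable_fun setT (trace2 l m : borel_mx R n -> R).
Proof.
apply: measurable_sum => a; under eq_fun do rewrite mxE.
apply: measurable_sum => b; apply: measurable_funM.
  under eq_fun do rewrite mxE; apply: measurable_sum => c.
  by apply: measurable_funM => //; exact: measurable_entry.
under eq_fun do rewrite mxE; apply: measurable_sum => c.
by apply: measurable_funM => //; exact: measurable_entry.
Qed.

Hypothesis A_orthogonal : forall i j, \tr (A i *m (A j)^T) = n%:R * (i == j)%:R.

(* Sums the vanishing first-order terms over all the generators [skew i j]. *)
Lemma haar_ibp C (psi : 'I_k -> 'rV[R]_k -> R) (h : 'I_k -> 'I_k -> 'rV[R]_k -> R) :
  0 <= C -> (forall l, smooth1 C (psi l) (h l)) ->
  (n%:R - 1) * \int[mu]_(V in orth) (\sum_l trace_vector V 0 l * psi l (trace_vector V)) =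
  \int[mu]_(V in orth) (\sum_l \sum_m h l m (trace_vector V) *
     (n%:R * (l == m)%:R - trace2 l m V)).
Proof.
move=> C0 sm.
(* The function differentiated along a generator already contains that generator inside its trace.
   Its derivative therefore contains the square of the generator, and these squares sum to a
   multiple of the identity. *)
pose p1 i j V := \sum_l (\tr (A l *m skew R i j *m (skew R i j *m V)) * psi l (trace_vector V)
  + \tr (A l *m skew R i j *m V) *
    \sum_m h l m (trace_vector V) * \tr (A m *m (skew R i j *m V))).
have hp i j : expands
    (fun t V => \sum_l (\tr (A l *m skew R i j *m (rotation (skew R i j) t *m V)) *
       psi l (trace_vector (rotation (skew R i j) t *m V))))
    (fun V => \sum_l \tr (A l *m skew R i j *m V) * psi l (trace_vector V)) (p1 i j).
  apply: expands_sum => l; apply: expandsM; first exact: expands_trace.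
  exact: expands_smooth C0 (sm l).
have mpsi l : measurable_fun setT ((fun V => psi l (trace_vector V)) : borel_mx R n -> R).
  by have [lp _ _] := sm l; exact: measurable_lip_trace lp.
have mh l m : measurable_fun setT ((fun V => h l m (trace_vector V)) : borel_mx R n -> R).
  by have [_ lh _] := sm l; exact: measurable_lip_trace (lh m).
have bpsi l : bounded_orth (fun V => psi l (trace_vector V)).
  by have [lp _ _] := sm l; exact: lip_trace_bounded lp C0.
have bh l m : bounded_orth (fun V => h l m (trace_vector V)).
  by have [_ lh _] := sm l; exact: lip_trace_bounded (lh m) C0.
have mp1 i j : measurable_fun setT (p1 i j : borel_mx R n -> R).
  apply: measurable_sum => l; apply: measurable_funD.
    apply: measurable_funM => //; under eq_fun do rewrite mulmxA.
    exact: measurable_trace.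
  apply: measurable_funM; first exact: measurable_trace.
  apply: measurable_sum => m; apply: measurable_funM => //.
  by under eq_fun do rewrite mulmxA; exact: measurable_trace.
have ip1 i j : rintegrable mu orth (p1 i j).
  by apply: rintegrable_bounded => //; have [] := expands_bounded (hp i j).
have I0 i j : \int[mu]_(V in orth) p1 i j V = 0.
  apply: (haar_derivative (skew_tr R i j) (skew_cube R i j) (hp i j)) => //.
  apply: measurable_sum => l; apply: measurable_funM => //.
  exact: measurable_trace.
pose a V := \sum_l trace_vector V 0 l * psi l (trace_vector V).
pose b V := \sum_l \sum_m h l m (trace_vector V) * (n%:R * (l == m)%:R - trace2 l m V).
have ia : rintegrable mu orth a.
  apply: rintegrable_bounded.
    apply: measurable_sum => l; apply: measurable_funM => //.
    exact: measurable_trace_vector.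
  apply: bounded_orth_sum => l; apply: bounded_orthM => //.
  have [K hK] := bounded_orth_trace (A l).
  by exists K => V hV; rewrite mxE; exact: hK.
have ib : rintegrable mu orth b.
  apply: rintegrable_bounded.
    apply: measurable_sum => l; apply: measurable_sum => m; apply: measurable_funM => //.
    by apply: measurable_funB => //; exact: measurable_trace2.
  apply: bounded_orth_sum => l; apply: bounded_orth_sum => m; apply: bounded_orthM => //.
  apply: bounded_orthB; first exact: bounded_orth_cst.
  exact: bounded_orth_trace2.
have ptw V : orth V -> \sum_i \sum_j p1 i j V =
    - ((n%:R - 1) *+ 2) * a V + 2 * b V.
  move=> hV; rewrite /p1.
  under eq_bigr do rewrite exchange_big/=.
  rewrite exchange_big/= /a /b !mulr_sumr -big_split/=; apply: eq_bigr => l _.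
  under eq_bigr do rewrite big_split/=.
  rewrite big_split/=; congr (_ + _).
    under eq_bigr do rewrite -mulr_suml.
    rewrite -mulr_suml mulrA; congr (_ * _); rewrite mxE.
    transitivity (\tr (A l *m (\sum_i \sum_j skew R i j *m skew R i j) *m V)).
      rewrite mulmx_sumr mulmx_suml linear_sum; apply: eq_bigr => i _ /=.
      rewrite mulmx_sumr mulmx_suml linear_sum; apply: eq_bigr => j _ /=.
      by rewrite !mulmxA.
    by rewrite sum_skew_sqr -scaleN1r -scalemxAr mul_mx_scalar -!scalemxAl !linearZ/= mulN1r mulNr.
  under eq_bigr => i _ do under eq_bigr => j _ do rewrite mulr_sumr.
  under eq_bigr do rewrite exchange_big/=.
  rewrite exchange_big/= mulr_sumr; apply: eq_bigr => m _.
  transitivity (h l m (trace_vector V) * \sum_i \sum_j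
      \tr (V *m A l *m skew R i j) * \tr (V *m A m *m skew R i j)).
    rewrite mulr_sumr; apply: eq_bigr => i _; rewrite mulr_sumr; apply: eq_bigr => j _.
    rewrite mulrCA; congr (_ * (_ * _)); rewrite -?mulmxA [RHS]mxtrace_mulC ?mulmxA//.
  (* Cyclicity brings [V^T] next to [V], so the normalisation of the [A i] applies. *)
  have trA : \tr (V *m A l *m (V *m A m)^T) = n%:R * (l == m)%:R.
    rewrite trmx_mul mxtrace_mulC mulmxA -(mulmxA _ V^T V) (orthogonal_mulTV hV).
    by rewrite mulmx1 mxtrace_mulC A_orthogonal.
  rewrite sum_trace_skew trA /trace2; ring.
have : \int[mu]_(V in orth) (- ((n%:R - 1) *+ 2) * a V + 2 * b V) = 0.
  transitivity (\int[mu]_(V in orth) (\sum_i \sum_j p1 i j V)).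
    by apply: eq_Rintegral => V /set_mem hV; rewrite ptw.
  rewrite Rintegral_sum//; last by move=> i; exact: rintegrable_sum.
  by rewrite big1// => i _; rewrite Rintegral_sum// big1.
rewrite RintegralD//; [|exact: rintegrableZ|exact: rintegrableZ].
rewrite !RintegralZl// -/(a _) => e.
have : 2 * ((n%:R - 1) * \int[mu]_(V in orth) a V) = 2 * \int[mu]_(V in orth) b V.
  by move: e; set x := \int[mu]_(_ in _) _; set y := \int[mu]_(_ in _) _; lra.
by move/mulfI; apply.
Qed.

End haar_ibp.

(** * Fourth moments of Haar orthogonal matrices *)

Section delta_sums.
Variables (R : comRingType) (n : nat).

Lemma sum_delta (F : 'I_n -> R) i : \sum_j (i == j)%:R * F j = F i.
Proof.
rewrite (bigD1 i)//= eqxx mul1r big1 ?addr0// => j ji.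
by rewrite eq_sym (negbTE ji) mul0r.
Qed.

Variable F : 'I_n -> 'I_n -> 'I_n -> 'I_n -> R.

Lemma sum_delta12_34 : \sum_a \sum_b \sum_c \sum_d ((a == b)%:R * (c == d)%:R) * F a b c d =
  \sum_a \sum_c F a a c c.
Proof.
apply: eq_bigr => a _; rewrite -(sum_delta (fun b => \sum_c F a b c c)).
apply: eq_bigr => b _; rewrite mulr_sumr; apply: eq_bigr => c _.
rewrite -(sum_delta (fun d => F a b c d)) mulr_sumr; apply: eq_bigr => d _.
by rewrite mulrA.
Qed.

Lemma sum_delta13_24 : \sum_a \sum_b \sum_c \sum_d ((a == c)%:R * (b == d)%:R) * F a b c d =
  \sum_a \sum_b F a b a b.
Proof.
apply: eq_bigr => a _; apply: eq_bigr => b _.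
rewrite -(sum_delta (fun c => F a b c b)); apply: eq_bigr => c _.
rewrite -(sum_delta (fun d => F a b c d)) mulr_sumr; apply: eq_bigr => d _.
by rewrite mulrA.
Qed.

Lemma sum_delta14_23 : \sum_a \sum_b \sum_c \sum_d ((a == d)%:R * (b == c)%:R) * F a b c d =
  \sum_a \sum_b F a b b a.
Proof.
apply: eq_bigr => a _; apply: eq_bigr => b _.
rewrite -(sum_delta (fun c => F a b c a)); apply: eq_bigr => c _.
rewrite -(sum_delta (fun d => F a b c d)) mulr_sumr; apply: eq_bigr => d _.
by rewrite mulrCA mulrA.
Qed.

End delta_sums.

(** * The fourth moment tensor of the entries *)

Section moments.
Variables (R : realType) (n : nat).
Notation orth := (@orthogonal_group R n).
Variable mu : probability (borel_mx R n) R.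
Hypothesis mu_haar : haar_orthogonal mu.
Hypothesis n_gt1 : (2 <= n)%N.
Let mO := @measurable_orthogonal R n.
Implicit Types (V : 'M[R]_n).

Lemma bounded_orth_entry i j : bounded_orth (fun V => V i j).
Proof. by exists 1 => V; exact: orthogonal_entry. Qed.

Section fixed_columns.
Variables c1 c2 c3 c4 : 'I_n.

(** The columns are fixed parameters: left invariance acts on the row indices, and the columns enter
    later through their orthonormality. *)
Definition monom i1 i2 i3 i4 V : R := V i1 c1 * V i2 c2 * V i3 c3 * V i4 c4.

Definition moment i1 i2 i3 i4 : R := \int[mu]_(V in orth) monom i1 i2 i3 i4 V.

Lemma measurable_monom i1 i2 i3 i4 :
  measurable_fun setT (monom i1 i2 i3 i4 : borel_mx R n -> R).
Proof.
by apply: measurable_funM; [apply: measurable_funM; [apply: measurable_funM|]|];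
  exact: measurable_entry.
Qed.

Lemma bounded_monom i1 i2 i3 i4 : bounded_orth (monom i1 i2 i3 i4).
Proof.
by do !apply: bounded_orthM; exact: bounded_orth_entry.
Qed.

Lemma rintegrable_monom i1 i2 i3 i4 : rintegrable mu orth (monom i1 i2 i3 i4).
Proof.
by apply: rintegrable_bounded; [exact: measurable_monom|exact: bounded_monom].
Qed.

Definition flip_sign (i j : 'I_n) : R := if j == i then -1 else 1.

(** Invariance under a diagonal reflection. It kills every moment in which some row index occurs an
    odd number of times. *)
Lemma moment_flip i i1 i2 i3 i4 : moment i1 i2 i3 i4 =
  flip_sign i i1 * flip_sign i i2 * flip_sign i i3 * flip_sign i i4 * moment i1 i2 i3 i4.
Proof.
pose U : 'M[R]_n := diag_mx (\row_j flip_sign i j).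
have UV V r c : (U *m V) r c = flip_sign i r * V r c by rewrite mul_diag_mx !mxE.
have hU : orth U.
  rewrite /orthogonal_group/= tr_diag_mx mulmx_diag -(@diag_const_mx _ n 1); congr diag_mx.
  apply/rowP => j; rewrite !mxE /flip_sign; case: eqP => _; rewrite ?mulrNN ?mulr1//.
rewrite {1}/moment -(haar_invariant mu_haar hU (measurable_monom _ _ _ _) (bounded_monom _ _ _ _)).
rewrite /moment -RintegralZl//; last exact: rintegrable_monom.
by apply: eq_Rintegral => V _; rewrite /monom !UV; ring.
Qed.

Lemma moment_perm (s : {perm 'I_n}) i1 i2 i3 i4 :
  moment i1 i2 i3 i4 = moment (s i1) (s i2) (s i3) (s i4).
Proof.
pose U : 'M[R]_n := perm_mx s.
have UV V r c : (U *m V) r c = V (s r) c by rewrite /U -row_permE mxE.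
have hU : orth U.
  by rewrite /orthogonal_group/= tr_perm_mx -perm_mxM mulgV perm_mx1.
rewrite {1}/moment -(haar_invariant mu_haar hU (measurable_monom _ _ _ _) (bounded_monom _ _ _ _)).
by apply: eq_Rintegral => V _; rewrite /monom !UV.
Qed.

Lemma expands_entry (E : 'M[R]_n) i c :
  expands (fun t V => (rotation E t *m V) i c) (fun V => V i c) (fun V => (E *m V) i c).
Proof.
have [K hK] := expands_trace (delta_mx c i) E.
exists K => V /hK; rewrite -!(mxtrace_mulC _ (delta_mx c i)) !trace_mul_delta.
move=> [a b h]; split=> // t /h.
by rewrite -mxtrace_mulC trace_mul_delta.
Qed.

(* Sign flips and permutations only reduce the moments to four values; the
   missing relation is the infinitesimal rotation in the plane of [e_i] and
   [e_j]. *)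
Lemma moment_diag i j : i != j ->
  moment i i i i = moment i i j j + moment i j i j + moment j i i j.
Proof.
move=> ij; pose E := skew R i j.
have EV V r c : (E *m V) r c = (r == i)%:R * V j c - (r == j)%:R * V i c.
  rewrite /E /skew mulmxBl !mxE; congr (_ - _).
    rewrite (bigD1 j)//= big1 ?addr0 => [|l lj]; rewrite !mxE ?eqxx ?andbT//.
    by rewrite (negbTE lj) andbF mul0r.
  rewrite (bigD1 i)//= big1 ?addr0 => [|l li]; rewrite !mxE ?eqxx ?andbT//.
  by rewrite (negbTE li) andbF mul0r.
(* Rows [i, i, i, j] are the right choice: rotating one of the first three gives the three mixed
   pairings, and rotating the last gives minus the pure fourth moment. *)
have hp := expandsM (expandsM (expandsM (expands_entry E i c1) (expands_entry E i c2))
  (expands_entry E i c3)) (expands_entry E j c4).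
have := haar_derivative mu_haar (skew_tr R i j) (skew_cube R i j) hp
  (fun _ _ => erefl) (measurable_monom i i i j).
have -> : (fun V => (((E *m V) i c1 * V i c2 + V i c1 * (E *m V) i c2) * V i c3
    + V i c1 * V i c2 * (E *m V) i c3) * V j c4 + V i c1 * V i c2 * V i c3 * (E *m V) j c4) =
    (fun V => monom j i i j V + monom i j i j V + monom i i j j V - monom i i i i V).
  apply/funext => V; rewrite !EV !eqxx (negbTE ij) [j == i]eq_sym (negbTE ij) /monom ?mulr1n ?mulr0n; ring.
move=> h; have {h} : \int[mu]_(V in orth)
    (monom j i i j V + monom i j i j V + monom i i j j V - monom i i i i V) = 0.
  apply: h; apply: measurable_funB; last exact: measurable_monom.
  by apply: measurable_funD; [apply: measurable_funD|]; exact: measurable_monom.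
have i1 := rintegrable_monom j i i j; have i2 := rintegrable_monom i j i j.
have i3 := rintegrable_monom i i j j; have i4 := rintegrable_monom i i i i.
have i12 := rintegrableD mO i1 i2; have i123 := rintegrableD mO i12 i3.
rewrite RintegralB// RintegralD// RintegralD// -!/(moment _ _ _ _).
lra.
Qed.

Definition idx0 : 'I_n := Ordinal (ltnW n_gt1).
Definition idx1 : 'I_n := Ordinal n_gt1.

(** Double transitivity: [i] is swapped into place first, then the image of [j], which differs from
    [idx0]. *)
Lemma perm_idx i j : i != j -> exists s : {perm 'I_n}, s i = idx0 /\ s j = idx1.
Proof.
move=> ij; pose s1 := tperm i idx0; exists (s1 * tperm (s1 j) idx1)%g.
rewrite !permM /s1 tpermL; split; last by rewrite tpermL.
rewrite tpermD//.
by rewrite -{2}(tpermL i idx0) (inj_eq perm_inj) eq_sym.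
Qed.

Definition mom_x := moment idx0 idx0 idx1 idx1.
Definition mom_y := moment idx0 idx1 idx0 idx1.
Definition mom_z := moment idx0 idx1 idx1 idx0.

(** The moment tensor is isotropic. Sign flips leave only paired rows, permutations make each
    pairing pattern constant, and [moment_diag] makes the all-equal case the sum of the three
    values. *)
Lemma momentE i1 i2 i3 i4 : moment i1 i2 i3 i4 =
  (i1 == i2)%:R * (i3 == i4)%:R * mom_x + (i1 == i3)%:R * (i2 == i4)%:R * mom_y
  + (i1 == i4)%:R * (i2 == i3)%:R * mom_z.
Proof.
have X i j : i != j -> moment i i j j = mom_x.
  by move=> /perm_idx[s [si sj]]; rewrite (moment_perm s) si sj.
have Y i j : i != j -> moment i j i j = mom_y.
  by move=> /perm_idx[s [si sj]]; rewrite (moment_perm s) si sj.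
have Zz i j : i != j -> moment i j j i = mom_z.
  by move=> /perm_idx[s [si sj]]; rewrite (moment_perm s) si sj.
have Dg i : moment i i i i = mom_x + mom_y + mom_z.
  have [j ij] : exists j, i != j.
    by case: (eqVneq i idx0) => [->|h]; [exists idx1|exists idx0].
  by rewrite (moment_diag ij) X// Y// Zz// eq_sym.
have zero x : x = - x -> x = 0 :> R by lra.
have [<-|n12] := eqVneq i1 i2.
  have [<-|n34] := eqVneq i3 i4.
    have [<-|n13] := eqVneq i1 i3; first by rewrite Dg !mul1r.
    by rewrite X// !mul1r !mul0r !addr0.
  rewrite mulr0 mul0r add0r.
  have [e13|n13] := eqVneq i1 i3.
    rewrite -e13 in n34 *; rewrite (negbTE n34) mulr0 !mul0r addr0.
    apply: zero; rewrite {1}(moment_flip i4) /flip_sign eqxx (negbTE n34); ring.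
  rewrite mul0r mul0r mulr0 mul0r addr0.
  apply: zero; rewrite {1}(moment_flip i3) /flip_sign eqxx (negbTE n13).
  rewrite [i4 == i3]eq_sym (negbTE n34); ring.
rewrite !mul0r add0r.
have [<-|n13] := eqVneq i1 i3.
  rewrite [i2 == i1]eq_sym (negbTE n12) mulr0 mul0r addr0 mul1r.
  have [<-|n24] := eqVneq i2 i4; first by rewrite Y// mul1r.
  rewrite mul0r; apply: zero; rewrite {1}(moment_flip i2) /flip_sign eqxx (negbTE n12).
  rewrite [i4 == i2]eq_sym (negbTE n24); ring.
rewrite !mul0r add0r.
have [<-|n14] := eqVneq i1 i4.
  have [<-|n23] := eqVneq i2 i3; first by rewrite Zz// !mul1r.
  rewrite mulr0 mul0r; apply: zero.
  rewrite {1}(moment_flip i2) /flip_sign eqxx (negbTE n12).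
  rewrite [i3 == i2]eq_sym (negbTE n23); ring.
rewrite !mul0r; apply: zero; rewrite {1}(moment_flip i1) /flip_sign eqxx.
rewrite ![_ == i1]eq_sym (negbTE n12) (negbTE n13) (negbTE n14); ring.
Qed.

Lemma orth_col_dot V c c' : orth V -> \sum_i V i c * V i c' = (c == c')%:R.
Proof.
move=> hV; have := congr1 (fun W : 'M[R]_n => W c c') (orthogonal_mulTV hV).
by rewrite !mxE => <-; apply: eq_bigr => i _; rewrite mxE.
Qed.

Lemma sum_moment (g : 'I_n -> 'I_n -> 'M[R]_n -> R) (c : R) :
  (forall i j, rintegrable mu orth (g i j)) ->
  (forall V, orth V -> \sum_i \sum_j g i j V = c) ->
  \sum_i \sum_j \int[mu]_(V in orth) g i j V = c.
Proof.
move=> ig gc; rewrite -[RHS](Rintegral_orth_cst mu_haar).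
transitivity (\int[mu]_(V in orth) (\sum_i \sum_j g i j V)).
  rewrite Rintegral_sum//; last by move=> i; exact: rintegrable_sum.
  by apply: eq_bigr => i _; rewrite Rintegral_sum.
by apply: eq_Rintegral => V /set_mem hV; rewrite gc.
Qed.

Lemma sum_moment_cst (x y z : R) :
  \sum_(i < n) \sum_(j < n) (x + (i == j)%:R * y + (i == j)%:R * z) =
  n%:R ^+ 2 * x + n%:R * y + n%:R * z.
Proof.
under eq_bigr => i _ do rewrite !big_split/= (sum_delta (fun=> y)) (sum_delta (fun=> z)).
rewrite !big_split/= !sumr_const card_ord -!mulrnA -[x *+ _]mulr_natl -[y *+ _]mulr_natl.
by rewrite -[z *+ _]mulr_natl natrM expr2.
Qed.

(** Contracting the rows along each pairing turns the integrand into a product of two inner products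
    of columns, which is constant on the group. *)
Lemma moment_contract :
  [/\ n%:R ^+ 2 * mom_x + n%:R * mom_y + n%:R * mom_z = (c1 == c2)%:R * (c3 == c4)%:R,
      n%:R ^+ 2 * mom_y + n%:R * mom_x + n%:R * mom_z = (c1 == c3)%:R * (c2 == c4)%:R &
      n%:R ^+ 2 * mom_z + n%:R * mom_x + n%:R * mom_y = (c1 == c4)%:R * (c2 == c3)%:R].
Proof.
split; rewrite -sum_moment_cst.
- transitivity (\sum_i \sum_j moment i i j j).
    apply: eq_bigr => i _; apply: eq_bigr => j _.
    by rewrite momentE !eqxx ?mulr1n; case: (i == j); rewrite ?mulr1n ?mulr0n; ring.
  apply: (@sum_moment (fun i j => monom i i j j)) => [i j|V hV].
    exact: rintegrable_monom.
  rewrite -(orth_col_dot c1 c2 hV) -(orth_col_dot c3 c4 hV) big_distrlr/=.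
  by apply: eq_bigr => i _; apply: eq_bigr => j _; rewrite /monom; ring.
- transitivity (\sum_i \sum_j moment i j i j).
    apply: eq_bigr => i _; apply: eq_bigr => j _.
    by rewrite momentE !eqxx [j == i]eq_sym; case: (i == j); rewrite ?mulr1n ?mulr0n; ring.
  apply: (@sum_moment (fun i j => monom i j i j)) => [i j|V hV].
    exact: rintegrable_monom.
  rewrite -(orth_col_dot c1 c3 hV) -(orth_col_dot c2 c4 hV) big_distrlr/=.
  by apply: eq_bigr => i _; apply: eq_bigr => j _; rewrite /monom; ring.
- transitivity (\sum_i \sum_j moment i j j i).
    apply: eq_bigr => i _; apply: eq_bigr => j _.
    by rewrite momentE !eqxx [j == i]eq_sym; case: (i == j); rewrite ?mulr1n ?mulr0n; ring.
  apply: (@sum_moment (fun i j => monom i j j i)) => [i j|V hV].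
    exact: rintegrable_monom.
  rewrite -(orth_col_dot c1 c4 hV) -(orth_col_dot c2 c3 hV) big_distrlr/=.
  by apply: eq_bigr => i _; apply: eq_bigr => j _; rewrite /monom; ring.
Qed.

(** The common denominator of the Weingarten coefficients. The system of [moment_contract] has
    [n ^ 2] on the diagonal and [n] elsewhere; its inverse has [n + 1] on the diagonal and [-1]
    elsewhere, over this number. *)
Definition mom_den : R := n%:R * (n%:R - 1) * (n%:R + 2).

Lemma mom_solve :
  [/\ mom_x * mom_den = (n%:R + 1) * ((c1 == c2)%:R * (c3 == c4)%:R)
        - (c1 == c3)%:R * (c2 == c4)%:R - (c1 == c4)%:R * (c2 == c3)%:R,
      mom_y * mom_den = (n%:R + 1) * ((c1 == c3)%:R * (c2 == c4)%:R)
        - (c1 == c2)%:R * (c3 == c4)%:R - (c1 == c4)%:R * (c2 == c3)%:R &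
      mom_z * mom_den = (n%:R + 1) * ((c1 == c4)%:R * (c2 == c3)%:R)
        - (c1 == c2)%:R * (c3 == c4)%:R - (c1 == c3)%:R * (c2 == c4)%:R].
Proof.
by have [<- <- <-] := moment_contract; rewrite /mom_den; split; ring.
Qed.

(** The isotropic form extended by multilinearity: each pairing of rows becomes a product of two
    inner products of coefficient vectors. *)
Lemma moment_rows (v1 v2 v3 v4 : 'I_n -> R) :
  \int[mu]_(V in orth) ((\sum_i v1 i * V i c1) * (\sum_i v2 i * V i c2) *
    (\sum_i v3 i * V i c3) * (\sum_i v4 i * V i c4)) =
  mom_x * ((\sum_i v1 i * v2 i) * (\sum_i v3 i * v4 i)) +
  mom_y * ((\sum_i v1 i * v3 i) * (\sum_i v2 i * v4 i)) +
  mom_z * ((\sum_i v1 i * v4 i) * (\sum_i v2 i * v3 i)).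
Proof.
pose w a b c d := v1 a * v2 b * v3 c * v4 d.
have iw a b c d : rintegrable mu orth (fun V => w a b c d * monom a b c d V).
  by apply: rintegrableZ => //; exact: rintegrable_monom.
transitivity (\int[mu]_(V in orth)
    (\sum_a \sum_b \sum_c \sum_d w a b c d * monom a b c d V)).
  apply: eq_Rintegral => V _.
  rewrite -!mulrA mulr_suml; apply: eq_bigr => a _.
  rewrite mulr_suml mulr_sumr; apply: eq_bigr => b _.
  rewrite mulr_suml !mulr_sumr; apply: eq_bigr => c _.
  rewrite !mulr_sumr; apply: eq_bigr => d _.
  by rewrite /w /monom; ring.
rewrite Rintegral_sum//; last by move=> a; do 3 (apply: rintegrable_sum => // ?).
transitivity (\sum_a \sum_b \sum_c \sum_d w a b c d * moment a b c d).
  apply: eq_bigr => a _; rewrite Rintegral_sum//; last first.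
    by move=> b; do 2 (apply: rintegrable_sum => // ?).
  apply: eq_bigr => b _; rewrite Rintegral_sum//; last first.
    by move=> c; apply: rintegrable_sum.
  apply: eq_bigr => c _; rewrite Rintegral_sum//.
  apply: eq_bigr => d _; rewrite RintegralZl//; exact: rintegrable_monom.
transitivity (\sum_a \sum_b \sum_c \sum_d
    ((a == b)%:R * (c == d)%:R) * (mom_x * w a b c d) +
  \sum_a \sum_b \sum_c \sum_d ((a == c)%:R * (b == d)%:R) * (mom_y * w a b c d) +
  \sum_a \sum_b \sum_c \sum_d ((a == d)%:R * (b == c)%:R) * (mom_z * w a b c d)).
  do 4 (rewrite -!big_split/=; apply: eq_bigr => ? _).
  by rewrite momentE; ring.
rewrite sum_delta12_34 sum_delta13_24 sum_delta14_23 /w.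
congr (_ + _ + _).
- rewrite mulr_suml mulr_sumr; apply: eq_bigr => i _.
  by rewrite !mulr_sumr; apply: eq_bigr => j _; ring.
- rewrite mulr_suml mulr_sumr; apply: eq_bigr => i _.
  by rewrite !mulr_sumr; apply: eq_bigr => j _; ring.
- rewrite mulr_suml mulr_sumr; apply: eq_bigr => i _.
  by rewrite !mulr_sumr; apply: eq_bigr => j _; ring.
Qed.

End fixed_columns.
End moments.

(** * First and second moments of the trace of [V A V B] *)

Section trace_moments.
Variables (R : realType) (n : nat).
Notation orth := (@orthogonal_group R n).
Variable mu : probability (borel_mx R n) R.
Hypothesis mu_haar : haar_orthogonal mu.
Hypothesis n_gt1 : (2 <= n)%N.
Let mO := @measurable_orthogonal R n.
Implicit Types (V : 'M[R]_n).

(** Inserting the squared length of column [c], which is [1], reduces this to the fourth moments. *)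
Lemma second_moment i j c c' :
  n%:R * \int[mu]_(V in orth) (V i c * V j c') = (i == j)%:R * (c == c')%:R.
Proof.
have [e _ _] := moment_contract mu_haar n_gt1 c c' c c.
have -> : \int[mu]_(V in orth) (V i c * V j c') =
    \sum_l moment mu c c' c c i j l l.
  rewrite -Rintegral_sum//; last by move=> l; exact: rintegrable_monom.
  apply: eq_Rintegral => V /set_mem hV.
  transitivity (V i c * V j c' * (\sum_l V l c * V l c)).
    by rewrite (orth_col_dot c c hV) eqxx mulr1.
  by rewrite mulr_sumr; apply: eq_bigr => l _; rewrite /monom; ring.
under eq_bigr do rewrite (momentE mu_haar n_gt1) eqxx mulr1.
rewrite !big_split/= sumr_const card_ord -[_ *+ n]mulr_natl.
rewrite -!mulr_suml.
have -> : \sum_l (i == l)%:R * (j == l)%:R = (i == j)%:R :> R.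
  by rewrite (sum_delta (fun l => (j == l)%:R)) eq_sym.
rewrite eqxx mulr1 in e; rewrite -e; ring.
Qed.

Variables A B : 'M[R]_n.

Definition prod_trace V : R := \tr (V *m A *m (V *m B)).

(** Each factor is a linear form in a single column of [V], the shape required by [moment_rows]. *)
Lemma prod_traceE V : prod_trace V =
  \sum_b \sum_d (\sum_i B d i * V i b) * (\sum_i A b i * V i d).
Proof.
rewrite /prod_trace -mulmxA mxtrace_mulC !mulmxA -(mulmxA (A *m V)).
apply: eq_bigr => b _; rewrite mxE; apply: eq_bigr => d _.
by rewrite !mxE mulrC.
Qed.

(** The entries of [C *m D^T]. *)
Definition gram (C D : 'M[R]_n) i j : R := \sum_l C i l * D j l.

Lemma rows_bounded (C : 'M[R]_n) i j : bounded_orth (fun V => \sum_l C i l * V l j).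
Proof.
apply: bounded_orth_sum => l; apply: bounded_orthM; first exact: bounded_orth_cst.
exact: bounded_orth_entry.
Qed.

Lemma rows_measurable (C : 'M[R]_n) i j :
  measurable_fun setT ((fun V => \sum_l C i l * V l j) : borel_mx R n -> R).
Proof.
by apply: measurable_sum => l; apply: measurable_funM => //; exact: measurable_entry.
Qed.

Lemma prod_trace_mean :
  n%:R * \int[mu]_(V in orth) prod_trace V = \sum_i gram A B i i.
Proof.
have iVV i j c c' : rintegrable mu orth (fun V => V i c * V j c').
  apply: rintegrable_bounded.
    by apply: measurable_funM; exact: measurable_entry.
  by apply: bounded_orthM; exact: bounded_orth_entry.
have iw b d i j : rintegrable mu orth (fun V => B d i * A b j * (V i b * V j d)).
  exact: rintegrableZ.
transitivity (n%:R * \int[mu]_(V in orth)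
    (\sum_b \sum_d \sum_i \sum_j B d i * A b j * (V i b * V j d))).
  congr (_ * _); apply: eq_Rintegral => V _; rewrite prod_traceE.
  apply: eq_bigr => b _; apply: eq_bigr => d _; rewrite big_distrlr/=.
  by apply: eq_bigr => i _; apply: eq_bigr => j _; ring.
rewrite Rintegral_sum//; last by move=> a; do 3 (apply: rintegrable_sum => // ?).
transitivity (\sum_b \sum_d \sum_i \sum_j ((b == d)%:R * (i == j)%:R) * (B d i * A b j)).
  rewrite mulr_sumr; apply: eq_bigr => b _.
  rewrite Rintegral_sum//; last by move=> d; do 2 (apply: rintegrable_sum => // ?).
  rewrite mulr_sumr; apply: eq_bigr => d _.
  rewrite Rintegral_sum//; last by move=> i; apply: rintegrable_sum => // ?.
  rewrite mulr_sumr; apply: eq_bigr => i _.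
  rewrite Rintegral_sum// mulr_sumr; apply: eq_bigr => j _.
  rewrite RintegralZl//; last exact: iVV.
  by rewrite mulrCA second_moment; ring.
rewrite sum_delta12_34; apply: eq_bigr => i _; apply: eq_bigr => l _.
by rewrite mulrC.
Qed.

(** The three pairings of rows meet the three pairings of columns. The off-diagonal Weingarten
    coefficients are collected into the two subtracted sums, which the variance bound estimates from
    below. *)
Lemma prod_trace_sqr :
  mom_den R n * \int[mu]_(V in orth) prod_trace V ^+ 2 =
  (n%:R + 1) * (2 * (\sum_i gram A B i i) ^+ 2
     + (\sum_i gram A A i i) * (\sum_i gram B B i i))
  - (\sum_i \sum_j (gram A B i j + gram A B j i) ^+ 2)
  - 2 * \sum_i \sum_j gram A A i j * gram B B i j.
Proof.
pose G i j := gram B A i j.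
have GE i j : gram A B i j = G j i.
  by apply: eq_bigr => l _; rewrite mulrC.
pose g b d f h V := (\sum_i B d i * V i b) * (\sum_i A b i * V i d) *
    (\sum_i B h i * V i f) * (\sum_i A f i * V i h).
have ig b d f h : rintegrable mu orth (g b d f h).
  apply: rintegrable_bounded.
    by do 3 (apply: measurable_funM; last exact: rows_measurable); exact: rows_measurable.
  by do 3 (apply: bounded_orthM; last exact: rows_bounded); exact: rows_bounded.
(* [X], [Y], [Z] are the inner products of the rows of [B] and [A] for the pairings 12-34, 13-24 and
   14-23 of the four factors of [g]. *)
pose X b d f h : R := G d b * G h f.
pose Y b d f h : R := gram B B d h * gram A A b f.
pose Z b d f h : R := G d f * G h b.
transitivity (\sum_b \sum_d \sum_f \sum_h
   (((b == d)%:R * (f == h)%:R) * ((n%:R + 1) * X b d f h - Y b d f h - Z b d f h) +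
    ((b == f)%:R * (d == h)%:R) * ((n%:R + 1) * Y b d f h - X b d f h - Z b d f h) +
    ((b == h)%:R * (d == f)%:R) * ((n%:R + 1) * Z b d f h - X b d f h - Y b d f h))).
  transitivity (mom_den R n * \int[mu]_(V in orth) (\sum_b \sum_d \sum_f \sum_h g b d f h V)).
    congr (_ * _); apply: eq_Rintegral => V _; rewrite prod_traceE expr2.
    pose u b d := (\sum_i B d i * V i b) * (\sum_i A b i * V i d).
    rewrite -!/(u _ _) mulr_suml; apply: eq_bigr => b _.
    rewrite mulr_suml; apply: eq_bigr => d _; rewrite -/(u b d).
    rewrite mulr_sumr; apply: eq_bigr => f _; rewrite mulr_sumr.
    by apply: eq_bigr => h _; rewrite /g /u !mulrA.
  rewrite Rintegral_sum//; last by move=> a; do 3 (apply: rintegrable_sum => // ?).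
  rewrite mulr_sumr; apply: eq_bigr => b _.
  rewrite Rintegral_sum//; last by move=> d; do 2 (apply: rintegrable_sum => // ?).
  rewrite mulr_sumr; apply: eq_bigr => d _.
  rewrite Rintegral_sum//; last by move=> i; apply: rintegrable_sum => // ?.
  rewrite mulr_sumr; apply: eq_bigr => f _.
  rewrite Rintegral_sum// mulr_sumr; apply: eq_bigr => h _.
  rewrite (moment_rows mu_haar n_gt1).
  have [ex ey ez] := mom_solve mu_haar n_gt1 b d f h.
  rewrite -/(gram B A d b) -/(gram B A h f) -/(gram B B d h) -/(gram A A b f).
  rewrite -/(gram B A d f) -/(gram A B b h) GE -/(G d b) -/(G h f) -/(G d f).
  rewrite !mulrDr !mulrA ![mom_den R n * _]mulrC ex ey ez /X /Y /Z; ring.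
under eq_bigr => b _ do under eq_bigr => d _ do under eq_bigr => f _ do rewrite !big_split/=.
under eq_bigr => b _ do under eq_bigr => d _ do rewrite !big_split/=.
under eq_bigr => b _ do rewrite !big_split/=.
rewrite !big_split/= sum_delta12_34 sum_delta13_24 sum_delta14_23.
rewrite /X /Y /Z.
pose t := \sum_i G i i; pose a := \sum_i gram A A i i; pose b := \sum_i gram B B i i.
pose G2 := \sum_i \sum_j G i j ^+ 2; pose GG := \sum_i \sum_j G i j * G j i.
pose S := \sum_i \sum_j gram A A i j * gram B B i j.
have e1 : \sum_b0 \sum_f ((n%:R + 1) * (G b0 b0 * G f f) - gram B B b0 f * gram A A b0 f
    - G b0 f * G f b0) = (n%:R + 1) * t ^+ 2 - S - GG.
  under eq_bigr do rewrite !sumrB; rewrite !sumrB; congr (_ - _ - _).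
    by rewrite /t expr2 big_distrlr/= mulr_sumr; apply: eq_bigr => i _; rewrite mulr_sumr.
  by apply: eq_bigr => i _; apply: eq_bigr => j _; rewrite mulrC.
have e2 : \sum_b0 \sum_d ((n%:R + 1) * (gram B B d d * gram A A b0 b0) - G d b0 * G d b0
    - G d b0 * G d b0) = (n%:R + 1) * (a * b) - G2 - G2.
  under eq_bigr do rewrite !sumrB; rewrite !sumrB; congr (_ - _ - _).
  - rewrite /a /b big_distrlr/= mulr_sumr; apply: eq_bigr => i _; rewrite mulr_sumr.
    by apply: eq_bigr => j _; rewrite (mulrC (gram A A i i)).
  - by rewrite exchange_big.
  - by rewrite exchange_big.
have gS (C : 'M[R]_n) i j : gram C C i j = gram C C j i.
  by apply: eq_bigr => l _; rewrite mulrC.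
have e3 : \sum_b0 \sum_d ((n%:R + 1) * (G d d * G b0 b0) - G d b0 * G b0 d
    - gram B B d b0 * gram A A b0 d) = (n%:R + 1) * t ^+ 2 - GG - S.
  under eq_bigr do rewrite !sumrB; rewrite !sumrB; congr (_ - _ - _).
  - rewrite /t expr2 big_distrlr/= mulr_sumr; apply: eq_bigr => i _; rewrite mulr_sumr.
    by apply: eq_bigr => j _; rewrite (mulrC (G i i)).
  - by rewrite exchange_big.
  - by apply: eq_bigr => i _; apply: eq_bigr => j _; rewrite mulrC (gS B).
have e4 : \sum_i \sum_j (gram A B i j + gram A B j i) ^+ 2 = 2 * G2 + 2 * GG.
  transitivity (\sum_i \sum_j (G i j ^+ 2 + G j i ^+ 2 + 2 * (G i j * G j i))).
    by apply: eq_bigr => i _; apply: eq_bigr => j _; rewrite !GE; ring.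
  under eq_bigr do rewrite !big_split/= -mulr_sumr.
  rewrite !big_split/= -mulr_sumr -/GG -/G2.
  rewrite (_ : \sum_i \sum_j G j i ^+ 2 = G2); first by ring.
  by rewrite exchange_big.
have e5 : \sum_i gram A B i i = t by apply: eq_bigr => i _; rewrite GE.
rewrite e1 e2 e3 e4 e5 -/a -/b -/S; ring.
Qed.

End trace_moments.

(** * The mean square deviation of [trace2] from the Kronecker delta *)

Section trace2_variance.
Variables (R : realType) (n k : nat).
Notation orth := (@orthogonal_group R n).
Variable mu : probability (borel_mx R n) R.
Hypothesis mu_haar : haar_orthogonal mu.
Hypothesis n_gt1 : (2 <= n)%N.
Let mO := @measurable_orthogonal R n.
Variable A : 'I_k -> 'M[R]_n.
Hypothesis A_orthogonal : forall i j, \tr (A i *m (A j)^T) = n%:R * (i == j)%:R.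

Lemma sum_gram i j : \sum_l gram (A i) (A j) l l = n%:R * (i == j)%:R.
Proof.
rewrite -A_orthogonal; apply: eq_bigr => l _; rewrite mxE; apply: eq_bigr => m _.
by rewrite mxE.
Qed.

(** Only the diagonal is kept. Its entries sum to [n], and [x ^+ 2 >= 2 * x - 1] summed over [n]
    entries gives [2 * n - n]. *)
Lemma sum_gram_sqr_ge i : n%:R <= \sum_a \sum_b gram (A i) (A i) a b ^+ 2.
Proof.
apply: (@le_trans _ _ (\sum_a (gram (A i) (A i) a a *+ 2 - 1))).
  rewrite sumrB sumrMnl sum_gram eqxx mulr1 sumr_const card_ord.
  by rewrite mulr2n addrK.
apply: ler_sum => a _; rewrite (bigD1 a)//= ler_wpDr//.
  by rewrite sumr_ge0// => b _; exact: sqr_ge0.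
by have := sqr_ge0 (gram (A i) (A i) a a - 1); set x := gram _ _ _ _; nra.
Qed.

(** The sum is the squared Frobenius norm of [B^T *m C]. *)
Lemma sum_gram_prod_ge0 (B C : 'M[R]_n) :
  0 <= \sum_i \sum_j gram B B i j * gram C C i j.
Proof.
rewrite (_ : \sum_i _ = \sum_l \sum_m (\sum_i B i l * C i m) ^+ 2); last first.
  transitivity (\sum_i \sum_j \sum_l \sum_m (B i l * C i m) * (B j l * C j m)).
    apply: eq_bigr => i _; apply: eq_bigr => j _; rewrite /gram big_distrlr/=.
    by apply: eq_bigr => l _; apply: eq_bigr => m _; ring.
  under eq_bigr => i _ do rewrite exchange_big/=.
  rewrite exchange_big/=; apply: eq_bigr => l _.
  under eq_bigr => i _ do rewrite exchange_big/=.
  rewrite exchange_big/=; apply: eq_bigr => m _.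
  by rewrite expr2 big_distrlr.
by apply: sumr_ge0 => l _; apply: sumr_ge0 => m _; exact: sqr_ge0.
Qed.

Lemma rintegrable_trace2 l m : rintegrable mu orth (trace2 A l m).
Proof.
by apply: rintegrable_bounded; [exact: measurable_trace2|exact: bounded_orth_trace2].
Qed.

Lemma rintegrable_trace2_sqr l m : rintegrable mu orth (fun V => trace2 A l m V ^+ 2).
Proof.
apply: rintegrable_bounded.
  by apply: measurable_funX; exact: measurable_trace2.
by apply: bounded_orthM; exact: bounded_orth_trace2.
Qed.

Lemma trace2_variance l m :
  \int[mu]_(V in orth) ((l == m)%:R - trace2 A l m V) ^+ 2 <= 2.
Proof.
have n2 : 2 <= n%:R :> R by rewrite ler_nat.
have it := rintegrable_trace2 l m; have it2 := rintegrable_trace2_sqr l m.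
have := prod_trace_sqr mu_haar n_gt1 (A l) (A m).
have := prod_trace_mean mu_haar n_gt1 (A l) (A m).
rewrite /prod_trace -![\int[mu]_(V in orth) (_ ^+ 2)]/(\int[mu]_(V in orth) (trace2 A l m V ^+ 2)).
rewrite -[\int[mu]_(V in orth) \tr _]/(\int[mu]_(V in orth) trace2 A l m V).
rewrite !sum_gram !eqxx !mulr1 /mom_den.
have [<-|lm] := eqVneq l m.
  set I1 := \int[mu]_(_ in _) _; set I2 := \int[mu]_(_ in _) _ => e1 e2.
  have -> : \int[mu]_(V in orth) (1 - trace2 A l l V) ^+ 2 = 1 - 2 * I1 + I2.
    transitivity (\int[mu]_(V in orth) ((1 - 2 * trace2 A l l V) + trace2 A l l V ^+ 2)).
      by apply: eq_Rintegral => V _; ring.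
    have i1 := rintegrable_cst mu mO 1; have i2 := rintegrableZ mO 2 (rintegrable_trace2 l l).
    rewrite RintegralD//; [|exact: rintegrableB|exact: rintegrable_trace2_sqr].
    rewrite RintegralB// RintegralZl; [|exact: mO|exact: rintegrable_trace2].
    by congr (_ + _); congr (_ + _); exact: (Rintegral_orth_cst mu_haar).
  have n0 : n%:R != 0 :> R by rewrite gt_eqF// (lt_le_trans _ n2).
  have I11 : I1 = 1 by apply: (mulfI n0); rewrite e1.
  have gS i j : gram (A l) (A l) i j = gram (A l) (A l) j i.
    by apply: eq_bigr => a _; rewrite mulrC.
  have eS : \sum_i \sum_j (gram (A l) (A l) i j + gram (A l) (A l) j i) ^+ 2 =
      4 * \sum_i \sum_j gram (A l) (A l) i j ^+ 2.
    rewrite mulr_sumr; apply: eq_bigr => i _; rewrite mulr_sumr; apply: eq_bigr => j _.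
    by rewrite [gram _ _ j i]gS; ring.
  have eP : \sum_i \sum_j gram (A l) (A l) i j * gram (A l) (A l) i j =
      \sum_i \sum_j gram (A l) (A l) i j ^+ 2.
    by apply: eq_bigr => i _; apply: eq_bigr => j _; rewrite expr2.
  move: e2; rewrite eS eP; have := sum_gram_sqr_ge l.
  set S := \sum_i _; set N : R := n%:R in n2 * => hS e2.
  have D0 : 0 < N * (N - 1) * (N + 2) by rewrite !mulr_gt0//; lra.
  (* Here [mom_den] times the second moment is [3 * N ^ 2 * (N + 1) - 6 * S], and [S >= N] brings it
     down to exactly [3 * N * (N - 1) * (N + 2)]. With mean [1] the deviation is at most [3 - 1]. *)
  have : I2 <= 3.
    by rewrite -(ler_pM2l D0) e2 /= mulr1n mulr1; lra.
  by rewrite I11; lra.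
set I1 := \int[mu]_(_ in _) _; set I2 := \int[mu]_(_ in _) _ => _ e2.
have -> : \int[mu]_(V in orth) (0 - trace2 A l m V) ^+ 2 = I2.
  by apply: eq_Rintegral => V _; rewrite sub0r sqrrN.
move: e2; have := sum_gram_prod_ge0 (A l) (A m).
set S := \sum_i _; set S' := \sum_i _; set N : R := n%:R in n2 * => hS e2.
have hS' : 0 <= S' by apply: sumr_ge0 => i _; apply: sumr_ge0 => j _; exact: sqr_ge0.
have D0 : 0 < N * (N - 1) * (N + 2) by rewrite !mulr_gt0//; lra.
rewrite -(ler_pM2l D0) e2 /= mulr0n mulr0 expr0n/= mulr0 add0r.
(* The second moment is at most [N ^ 2 * (N + 1)] over the denominator. Twice the denominator
   exceeds this numerator by the displayed product plus [2 * N]. *)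
have : 0 <= N * (N - 2) * (N + 3) by rewrite !mulr_ge0//; lra.
by lra.
Qed.

End trace2_variance.

(** * Interpolation *)

Section gaussian_average.
Variables (R : realType) (k : nat).
Context d' (T' : measurableType d') (Q : probability T' R).
Variable Z : 'I_k -> {RV Q >-> R}.
Hypothesis Z_normal : forall i : 'I_k, standard_normal (Z i).
Hypothesis Z_indep : mutually_independent Z.
Implicit Types (x y : 'rV[R]_k) (F : 'rV[R]_k -> R).

Lemma rintegrable_lip_shift C F y s : lip C F ->
  rintegrable Q setT (fun w => F (y + s *: rvec Z w)).
Proof.
move=> lF.
apply: (rintegrable_quadratic Z_normal (c := `|F y| + `|C| * `|s|)).
  apply: (measurable_lip (Y := fun w => y + s *: rvec Z w) lF) => i.
  under eq_fun do rewrite !mxE.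
  by apply: measurable_funD => //; apply: measurable_funM => //; exact: measurable_funP.
move=> w; have := lF (y + s *: rvec Z w) y.
rewrite addrAC subrr add0r l1normZ => h.
have := ler_normD (F (y + s *: rvec Z w) - F y) (F y); rewrite subrK => h2.
set N := l1norm _ in h *; have N0 : 0 <= N by exact: l1norm_ge0.
have h3 : C * (`|s| * N) <= `|C| * `|s| * N.
  by rewrite mulrA ler_wpM2r// ler_wpM2r// ler_norm.
have h4 : `|C| * `|s| * N <= `|C| * `|s| * (1 + N ^+ 2).
  by rewrite ler_wpM2l ?mulr_ge0//; have := sqr_ge0 (N - 1); nra.
have h5 : `|F y| <= `|F y| * (1 + N ^+ 2).
  by rewrite ler_peMr// lerDl sqr_ge0.
by rewrite mulrDl; lra.
Qed.

Lemma Rintegral_prob_cst (c : R) : \int[Q]_w c = c.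
Proof.
rewrite Rintegral_cst//; transitivity (c * fine (1 : \bar R)%E).
  by congr (_ * fine _); exact: probability_setT.
by rewrite mulr1.
Qed.

(** Mehler's formula for the Ornstein-Uhlenbeck semigroup when [c] and [s] are a cosine and a
    sine. *)
Definition gavg c s F x : R := \int[Q]_w F (c *: x + s *: rvec Z w).

Lemma gavg_dist C F c s x y K : lip C F ->
  (forall v, `|F (c *: x + v) - F (c *: y + v)| <= K) ->
  `|gavg c s F x - gavg c s F y| <= K.
Proof.
move=> lF h; have ix := rintegrable_lip_shift (c *: x) s lF.
have iy := rintegrable_lip_shift (c *: y) s lF.
have i0 := rintegrable_cst Q measurableT 0.
have iK := rintegrable_cst Q measurableT K.
(* The first-order estimate is reused with zero step and zero derivative. *)
have h0 w : [set: T'] w -> `|F (c *: x + s *: rvec Z w) - F (c *: y + s *: rvec Z w)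
    - 0 * 0| <= K by rewrite mul0r subr0.
have := Rintegral_first_order measurableT iy ix i0 iK h0.
by rewrite mul0r subr0 Rintegral_prob_cst.
Qed.

Lemma gavg_lip C F c s : 0 <= C -> `|c| <= 1 -> lip C F -> lip C (gavg c s F).
Proof.
move=> C0 c1 lF x y; apply: (gavg_dist _ lF) => v.
rewrite (le_trans (lF _ _))// opprD addrACA subrr addr0 -scalerBr l1normZ.
by rewrite ler_wpM2l// ler_piMl// l1norm_ge0.
Qed.

Lemma gavg_has_partial l C F F' c s : 0 <= C -> `|c| <= 1 -> lip C F -> lip C F' ->
  has_partial l F F' C -> has_partial l (gavg c s F) (fun x => c * gavg c s F' x) C.
Proof.
move=> C0 c1 lF lF' h x t.
have ix := rintegrable_lip_shift (c *: x) s lF.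
have ixt := rintegrable_lip_shift (c *: (x + t *: delta_mx 0 l)) s lF.
have iF' := rintegrable_lip_shift (c *: x) s lF'.
have iK := rintegrable_cst Q measurableT (C * t ^+ 2).
have := Rintegral_first_order (t := t * c) measurableT ix ixt iF' iK.
rewrite Rintegral_prob_cst -mulrA; apply => w _.
have := h (c *: x + s *: rvec Z w) (c * t).
rewrite scalerDr scalerA (addrAC (c *: x)) [t * c]mulrC => /le_trans; apply.
rewrite ler_wpM2l// exprMn ler_piMl ?sqr_ge0//.
by rewrite -real_normK ?num_real// expr_le1.
Qed.

Lemma gavg_smooth1 C F (F' : 'I_k -> 'rV[R]_k -> R) c s : 0 <= C -> `|c| <= 1 ->
  smooth1 C F F' -> smooth1 C (gavg c s F) (fun m x => c * gavg c s (F' m) x).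
Proof.
move=> C0 c1 [lF lF' dF]; split; first exact: gavg_lip.
  move=> m x y; rewrite -mulrBr normrM.
  rewrite (le_trans _ (gavg_lip s C0 c1 (lF' m) x y))// ler_piMl//.
by move=> m; exact: gavg_has_partial.
Qed.

Lemma smooth1_scale C F (F' : 'I_k -> 'rV[R]_k -> R) y s : 0 <= C -> `|s| <= 1 ->
  smooth1 C F F' ->
  smooth1 C (fun z => F (y + s *: z)) (fun m z => s * F' m (y + s *: z)).
Proof.
move=> C0 s1 [lF lF' dF].
have sc (G : 'rV[R]_k -> R) : lip C G -> lip C (fun z => G (y + s *: z)).
  move=> lG a b; rewrite (le_trans (lG _ _))// opprD addrACA subrr add0r.
  by rewrite -scalerBr l1normZ ler_wpM2l// ler_piMl// l1norm_ge0.
split; first exact: sc.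
  move=> m a b; rewrite -mulrBr normrM.
  rewrite (le_trans _ (sc _ (lF' m) a b))// ler_piMl//.
move=> m x t; have := dF m (y + s *: x) (s * t).
rewrite scalerDr scalerA addrA [t * (s * _)]mulrCA mulrA => /le_trans; apply.
rewrite ler_wpM2l// exprMn ler_piMl ?sqr_ge0//.
by rewrite -real_normK ?num_real// expr_le1.
Qed.

(** Used in both directions: to remove [Z] from the speed of the path, and in [hessian_pairing] to
    trade the Hessian for the gradient. *)
Lemma gavg_ibp C F (F' : 'I_k -> 'rV[R]_k -> R) c s x m : 0 <= C -> `|s| <= 1 ->
  smooth1 C F F' ->
  \int[Q]_w (Z m w * F (c *: x + s *: rvec Z w)) = s * gavg c s (F' m) x.
Proof.
move=> C0 s1 sF; have [lF lF' dF] := smooth1_scale (c *: x) C0 s1 sF.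
have := gaussian_ibp Z_normal Z_indep lF (lF' m)
  (fun z => has_partial_bound z lF (dF m)) (dF m).
move=> ->; rewrite RintegralZl//.
by have [_ lF0 _] := sF; exact: rintegrable_lip_shift (lF0 m).
Qed.

Lemma lip_coord i : lip 1 (fun x => x 0 i).
Proof.
by move=> x y; rewrite mul1r -[_ - _](_ : (x - y) 0 i = _) ?ler_l1norm// !mxE.
Qed.

(** Gaussian integration by parts applied to a coordinate function. *)
Lemma gaussian_covariance i j : \int[Q]_w (Z i w * Z j w) = (i == j)%:R.
Proof.
have l0 : lip 1 (fun _ : 'rV[R]_k => (i == j)%:R : R).
  by move=> x y; rewrite subrr normr0 mul1r l1norm_ge0.
have := gaussian_ibp Z_normal Z_indep (l := i) (lip_coord j) l0.
rewrite Rintegral_prob_cst => <-.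
- by apply: eq_Rintegral => w _; rewrite mxE.
- by move=> _; case: (i == j); rewrite ?normr1 ?normr0.
- move=> x t; rewrite !mxE eqxx/= [j == i]eq_sym.
  by rewrite (_ : _ - _ = 0) ?normr0 ?mul1r ?sqr_ge0//; ring.
Qed.

Lemma rintegrable_ZZ i j : rintegrable Q setT (fun w => Z i w * Z j w).
Proof.
apply: (rintegrable_quadratic Z_normal (c := 1)).
  by apply: measurable_funM => //; exact: measurable_funP.
move=> w; have := ler_l1norm (rvec Z w) i; have := ler_l1norm (rvec Z w) j.
rewrite !mxE normrM mul1r; set N := l1norm _ => h1 h2.
by rewrite (@le_trans _ _ (N * N))// ?ler_pM// -expr2 lerDr.
Qed.

Lemma gaussian_quadratic (D : 'I_k -> 'I_k -> R) :
  rintegrable Q setT (fun w => \sum_l (\sum_m D l m * Z m w) ^+ 2) /\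
  \int[Q]_w (\sum_l (\sum_m D l m * Z m w) ^+ 2) = \sum_l \sum_m D l m ^+ 2.
Proof.
have e w : \sum_l (\sum_m D l m * Z m w) ^+ 2 =
    \sum_l \sum_m \sum_p D l m * D l p * (Z m w * Z p w).
  apply: eq_bigr => l _; rewrite expr2 big_distrlr/=.
  by apply: eq_bigr => m _; apply: eq_bigr => p _; ring.
have iw l m p : rintegrable Q setT (fun w => D l m * D l p * (Z m w * Z p w)).
  by apply: rintegrableZ => //; exact: rintegrable_ZZ.
split.
  under eq_fun do rewrite e.
  by do 3 (apply: rintegrable_sum => // ?).
under eq_Rintegral do rewrite e.
rewrite Rintegral_sum//; last by move=> l; do 2 (apply: rintegrable_sum => // ?).
apply: eq_bigr => l _.
rewrite Rintegral_sum//; last by move=> m; apply: rintegrable_sum => // ?.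
apply: eq_bigr => m _; rewrite Rintegral_sum//.
rewrite -[RHS](sum_delta (fun p => D l m * D l p)).
apply: eq_bigr => p _; rewrite RintegralZl//; last exact: rintegrable_ZZ.
by rewrite gaussian_covariance mulrC.
Qed.

(** The sum is a directional derivative, hence a limit of difference quotients along [v]. Here the
    Euclidean constant [L] replaces the coarse constant [C]. *)
Lemma smooth1_euclidean L C F (F' : 'I_k -> 'rV[R]_k -> R) x
    (v : 'rV[R]_k) : smooth1 C F F' ->
  (forall x y, `|F x - F y| <= L * euclidean_norm (x - y)) ->
  `|\sum_l F' l x * v 0 l| <= L * euclidean_norm v.
Proof.
move=> sF FL; set S := \sum_l _.
have enZ t : 0 < t -> euclidean_norm (t *: v) = t * euclidean_norm v.
  move=> t0; rewrite /euclidean_norm -[t in RHS](@ger0_norm _ t) ?(ltW t0)//.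
  rewrite -sqrtr_sqr -sqrtrM ?sqr_ge0// mulr_sumr; congr Num.sqrt.
  by apply: eq_bigr => i _; rewrite mxE exprMn.
apply/ler_addgt0Pr => e e0.
pose K := `|2 * C * l1norm v ^+ 2| + 1.
have K0 : 0 < K by rewrite ltr_wpDl.
pose t := e / K; have t0 : 0 < t by rewrite divr_gt0.
have h := smooth1_taylor x (t *: v) sF.
have h2 := FL (x + t *: v) x; rewrite addrAC subrr add0r enZ// in h2.
have eS : \sum_l F' l x * (t *: v) 0 l = t * S.
  by rewrite mulr_sumr; apply: eq_bigr => l _; rewrite mxE mulrCA.
rewrite eS l1normZ exprMn (gtr0_norm t0) in h.
have : `|t * S| <= t * (L * euclidean_norm v + e).
  have -> : t * S = (F (x + t *: v) - F x) - (F (x + t *: v) - F x - t * S) by ring.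
  rewrite (le_trans (ler_normB _ _))// mulrDr lerD//; first by rewrite mulrCA.
  rewrite (le_trans h)// mulrCA expr2 -mulrA ler_pM2l//.
  have -> : e = t * K by rewrite /t divfK// gt_eqF.
  by rewrite ler_pM2l// (le_trans (ler_norm _))// lerDl.
by rewrite normrM (gtr0_norm t0) ler_pM2l.
Qed.

End gaussian_average.

(** * Expansion along the path [cos t x + sin t z] *)

Section trigonometric_path.
Variable R : realType.
Implicit Types t u : R.

Lemma sin_lipschitz t u : `|sin t - sin u| <= 1 * `|t - u|.
Proof.
have inT (y : R) : y \in `]-oo, +oo[ by rewrite in_itv.
have [c [_ _ ->]] := mvt_diff (inT u) (inT t) (fun y _ => is_derive_sin y).
by rewrite normrM ler_wpM2r// ler_norml cos_geN1 cos_le1.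
Qed.

Lemma cos_lipschitz t u : `|cos t - cos u| <= 1 * `|t - u|.
Proof.
have inT (y : R) : y \in `]-oo, +oo[ by rewrite in_itv.
have [c [_ _ ->]] := mvt_diff (inT u) (inT t) (fun y _ => is_derive_cos y).
by rewrite normrM ler_wpM2r// normrN ler_norml sin_geN1 sin_le1.
Qed.

Lemma cos_taylor t u : `|cos (t + u) - cos t - u * - sin t| <= u ^+ 2.
Proof.
have inT (y : R) : y \in `]-oo, +oo[ by rewrite in_itv.
rewrite -[leRHS]mul1r.
apply: (taylor_of_is_derive (inT t) (inT _) (fun y _ => is_derive_cos y)) => x y.
by rewrite -opprD normrN; exact: sin_lipschitz.
Qed.

Lemma sin_taylor t u : `|sin (t + u) - sin t - u * cos t| <= u ^+ 2.
Proof.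
have inT (y : R) : y \in `]-oo, +oo[ by rewrite in_itv.
rewrite -[leRHS]mul1r.
apply: (taylor_of_is_derive (inT t) (inT _) (fun y _ => is_derive_sin y)) => x y.
exact: cos_lipschitz.
Qed.

(** The displacement is [u] times the velocity plus [r], of size [u ^+ 2 * S]. The [3] is [2] from
    [smooth1_taylor] plus [1] from the gradient against [r], after [S <= 1 + S ^+ 2]. *)
Lemma path_taylor k C (g : 'rV[R]_k -> R) G (x z : 'rV[R]_k) t u : 0 <= C ->
  smooth1 C g G ->
  `|g (cos (t + u) *: x + sin (t + u) *: z) - g (cos t *: x + sin t *: z) -
    u * \sum_l G l (cos t *: x + sin t *: z) * (- sin t * x 0 l + cos t * z 0 l)|
  <= 3 * C * (1 + (l1norm x + l1norm z) ^+ 2) * u ^+ 2.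
Proof.
move=> C0 sg; have [lg lG dG] := sg.
set Y := cos t *: x + sin t *: z; set S := l1norm x + l1norm z.
have S0 : 0 <= S by rewrite addr_ge0 ?l1norm_ge0.
pose a := cos (t + u) - cos t; pose b := sin (t + u) - sin t.
pose h : 'rV[R]_k := a *: x + b *: z.
pose r : 'rV[R]_k := (a - u * - sin t) *: x + (b - u * cos t) *: z.
have au : `|a| <= `|u| by have := cos_lipschitz (t + u) t; rewrite mul1r addrAC subrr add0r.
have bu : `|b| <= `|u| by have := sin_lipschitz (t + u) t; rewrite mul1r addrAC subrr add0r.
have -> : cos (t + u) *: x + sin (t + u) *: z = Y + h.
  by apply/rowP => i; rewrite !mxE /a /b; ring.
have hS : l1norm h <= `|u| * S.
  rewrite (le_trans (l1normD _ _))// !l1normZ mulrDr lerD// ler_wpM2r// l1norm_ge0//.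
have rS : l1norm r <= u ^+ 2 * S.
  rewrite (le_trans (l1normD _ _))// !l1normZ mulrDr.
  by rewrite lerD// ler_wpM2r ?l1norm_ge0//; [exact: cos_taylor|exact: sin_taylor].
have h1 := smooth1_taylor Y h sg.
have h2 : `|\sum_l G l Y * r 0 l| <= C * l1norm r.
  by apply: ler_sum_l1norm => l; exact: has_partial_bound lg (dG l).
have e : \sum_l G l Y * h 0 l = u * (\sum_l G l Y * (- sin t * x 0 l + cos t * z 0 l)) +
    \sum_l G l Y * r 0 l.
  rewrite mulr_sumr -big_split/=; apply: eq_bigr => l _; rewrite !mxE; ring.
have h3 : 2 * C * l1norm h ^+ 2 <= 2 * C * (u ^+ 2 * S ^+ 2).
  rewrite ler_wpM2l ?mulr_ge0//.
  rewrite -(real_normK (num_real u)) -exprMn ler_pXn2r ?nnegrE ?l1norm_ge0//.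
  by rewrite mulr_ge0.
have h4 : C * l1norm r <= C * (u ^+ 2 * S) by rewrite ler_wpM2l.
have h5 : C * u ^+ 2 * S <= C * u ^+ 2 * (1 + S ^+ 2).
  rewrite ler_wpM2l //.
    by rewrite mulr_ge0// sqr_ge0.
  by have := sqr_ge0 (S - 1); have := sqr_ge0 S; nra.
have h6 : 0 <= C * u ^+ 2 by rewrite mulr_ge0 ?sqr_ge0.
have h7 : 0 <= C * u ^+ 2 * S ^+ 2 by rewrite mulr_ge0 ?sqr_ge0.
rewrite e in h1; move: h1 h2.
set A1 := u * _; set B1 := \sum_l G l Y * r 0 l; set g1 := g _; set g0 := g _.
rewrite !ler_norml => /andP[? ?] /andP[? ?].
by apply/andP; split; lra.
Qed.

End trigonometric_path.

(** * The interpolation for smooth test functions *)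

Section interpolation.
Variables (R : realType) (n k : nat).
Notation orth := (@orthogonal_group R n).
Variable mu : probability (borel_mx R n) R.
Hypothesis mu_haar : haar_orthogonal mu.
Hypothesis n_gt1 : (2 <= n)%N.
Let mO := @measurable_orthogonal R n.
Variable A : 'I_k -> 'M[R]_n.
Hypothesis A_orthogonal : forall i j, \tr (A i *m (A j)^T) = n%:R * (i == j)%:R.
Context d' (T' : measurableType d') (Q : probability T' R).
Variable Z : 'I_k -> {RV Q >-> R}.
Hypothesis Z_normal : forall i : 'I_k, standard_normal (Z i).
Hypothesis Z_indep : mutually_independent Z.
Variables (L C : R) (g : 'rV[R]_k -> R) (G : 'I_k -> 'rV[R]_k -> R)
  (H : 'I_k -> 'I_k -> 'rV[R]_k -> R).
Hypotheses (L_ge0 : 0 <= L) (C_ge0 : 0 <= C).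
Hypothesis g_lip : forall x y, `|g x - g y| <= L * euclidean_norm (x - y).
Hypothesis g_smooth : smooth2 C g G H.
Notation X := (trace_vector A).
Notation avg t F := (gavg Z (cos t) (sin t) F).
Implicit Types (x : 'rV[R]_k) (t u : R).

Definition interpolant t : R := \int[mu]_(V in orth) avg t g (X V).

Let cos1 t : `|cos t| <= 1. Proof. by rewrite ler_norml cos_geN1 cos_le1. Qed.
Let sin1 t : `|sin t| <= 1. Proof. by rewrite ler_norml sin_geN1 sin_le1. Qed.
Let lip_g : lip C g. Proof. by have [[]] := g_smooth. Qed.
Let lip_G l : lip C (G l). Proof. by have [[]] := g_smooth. Qed.
Let lip_H l m : lip C (H l m). Proof. by have [_ /(_ l)[]] := g_smooth. Qed.

Definition path_speed t x w : R :=
  \sum_l G l (cos t *: x + sin t *: rvec Z w) * (- sin t * x 0 l + cos t * rvec Z w 0 l).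

(* The Gaussian mean of [path_speed], after integration by parts in [Z]. *)
Definition mean_speed t x : R :=
  - sin t * (\sum_l x 0 l * avg t (G l) x) + cos t * sin t * \sum_l avg t (H l l) x.

Lemma rintegrable_ZG t x m l :
  rintegrable Q setT (fun w => Z m w * G l (cos t *: x + sin t *: rvec Z w)).
Proof.
have [lF _ _] := smooth1_scale (cos t *: x) C_ge0 (sin1 t) (g_smooth.2 l).
set F := fun z => _ in lF.
apply: (rintegrable_quadratic Z_normal (c := `|F 0| + 2 * C)).
  apply: measurable_funM; first exact: measurable_funP.
  apply: (measurable_lip (Y := rvec Z) lF) => i.
  exact: measurable_rvec.
move=> w; have h1 := ler_l1norm (rvec Z w) m; have h2 := lip_growth (rvec Z w) lF.
rewrite mxE in h1; rewrite normrM -/(F (rvec Z w)).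
move: h1 h2; set y := l1norm _; set a := `|F 0|; set b := `|F _|; set r := `|Z m w|.
move=> ry ba.
have y0 : 0 <= y by exact: l1norm_ge0.
have a0 : 0 <= a by exact: normr_ge0.
have h : r * b <= y * (a + C * y) by rewrite ler_pM ?normr_ge0.
have h2 : a * y <= a * (1 + y ^+ 2).
  by rewrite ler_wpM2l//; have := sqr_ge0 (y - 1); nra.
have h3 : C * y ^+ 2 <= C * (1 + y ^+ 2) by rewrite ler_wpM2l// lerDr.
have h4 : 0 <= C * (1 + y ^+ 2) by rewrite mulr_ge0// addr_ge0 ?sqr_ge0.
lra.
Qed.

Lemma mean_speedE t x : rintegrable Q setT (path_speed t x) /\
  \int[Q]_w path_speed t x w = mean_speed t x.
Proof.
have iG l := rintegrable_lip_shift Z_normal (cos t *: x) (sin t) (@lip_G l).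
have iZG l := rintegrable_ZG t x l l.
pose p1 l w := - sin t * x 0 l * G l (cos t *: x + sin t *: rvec Z w).
pose p2 l w := cos t * (Z l w * G l (cos t *: x + sin t *: rvec Z w)).
have i1 l : rintegrable Q setT (p1 l) by exact: rintegrableZ.
have i2 l : rintegrable Q setT (p2 l) by exact: rintegrableZ.
have i12 l : rintegrable Q setT (fun w => p1 l w + p2 l w) by exact: rintegrableD.
have e : path_speed t x = (fun w => \sum_l (p1 l w + p2 l w)).
  apply/funext => w; apply: eq_bigr => l _.
  by rewrite [rvec Z w 0 l]mxE /p1 /p2; ring.
split; first by rewrite e; exact: rintegrable_sum.
under eq_Rintegral do rewrite e.
rewrite Rintegral_sum// /mean_speed !mulr_sumr -big_split/=; apply: eq_bigr => l _.
rewrite RintegralD; [|exact: measurableT|exact: i1|exact: i2].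
rewrite RintegralZl; [|exact: measurableT|exact: iG].
rewrite RintegralZl; [|exact: measurableT|exact: iZG].
congr (_ + _); first by rewrite -mulrA.
by rewrite (gavg_ibp Z_normal Z_indep (cos t) x l C_ge0 (sin1 t) (g_smooth.2 l)) mulrA.
Qed.

(** The pathwise remainder is quadratic in the Gaussian vector and so has finite mean. Uniformity in
    [x] over a ball allows integration over the group, where the trace vector is bounded. *)
Lemma gavg_path B : exists K, forall x, l1norm x <= B -> forall t u,
  `|avg (t + u) g x - avg t g x - u * mean_speed t x| <= K * u ^+ 2.
Proof.
pose Kw w := 3 * C * (1 + (B + l1norm (rvec Z w)) ^+ 2).
have iK : rintegrable Q setT Kw.
  apply: (rintegrable_quadratic Z_normal (c := 3 * C * (1 + 2 * B ^+ 2 + 2))).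
    have mN : measurable_fun setT (fun w => l1norm (rvec Z w)).
      apply: measurable_sum => i; apply: measurableT_comp => //.
      exact: measurable_rvec.
    by apply: measurable_funM => //; apply: measurable_funD => //;
      apply: measurable_funX; apply: measurable_funD.
  move=> w; rewrite /Kw ger0_norm; last first.
    by rewrite mulr_ge0 ?addr_ge0 ?sqr_ge0// mulr_ge0.
  rewrite -[leRHS]mulrA ler_wpM2l ?mulr_ge0//; set N := l1norm _.
  have := sqr_ge0 (B - N); have := mulr_ge0 (sqr_ge0 B) (sqr_ge0 N).
  have := sqr_ge0 B; have := sqr_ge0 N; nra.
exists (\int[Q]_w Kw w) => x xB t u.
have i0 := rintegrable_lip_shift Z_normal (cos t *: x) (sin t) lip_g.
have i1 := rintegrable_lip_shift Z_normal (cos (t + u) *: x) (sin (t + u)) lip_g.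
have [iD <-] := mean_speedE t x.
have iKu : rintegrable Q setT (fun w => u ^+ 2 * Kw w) by exact: rintegrableZ.
rewrite [leRHS]mulrC -[leRHS]RintegralZl; [|exact: measurableT|exact: iK].
apply: (Rintegral_first_order (t := u) measurableT i0 i1 iD iKu) => w _.
rewrite (le_trans (path_taylor x (rvec Z w) t u C_ge0 g_smooth.1))// mulrC.
rewrite ler_wpM2l ?sqr_ge0// /Kw ler_wpM2l ?mulr_ge0// lerD2l.
rewrite ler_pXn2r ?nnegrE ?addr_ge0 ?l1norm_ge0 ?lerD2r//.
by rewrite (le_trans (l1norm_ge0 x)).
Qed.

Lemma bounded_orth_coord l : bounded_orth (fun V => X V 0 l).
Proof.
have [K hK] := bounded_orth_trace (A l).
by exists K => V hV; rewrite mxE; exact: hK.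
Qed.

Let lip_avg t F : lip C F -> lip C (avg t F).
Proof. exact: gavg_lip. Qed.

Let int_XG t l : rintegrable mu orth (fun V => X V 0 l * avg t (G l) (X V)).
Proof.
apply: rintegrable_bounded.
  apply: measurable_funM; first exact: measurable_trace_vector.
  exact: measurable_lip_trace (lip_avg t (@lip_G l)).
apply: bounded_orthM; first exact: bounded_orth_coord.
exact: lip_trace_bounded (lip_avg t (@lip_G l)) C_ge0.
Qed.

Let int_H t l m : rintegrable mu orth (fun V => avg t (H l m) (X V)).
Proof.
apply: rintegrable_bounded.
  exact: measurable_lip_trace (lip_avg t (@lip_H l m)).
exact: lip_trace_bounded (lip_avg t (@lip_H l m)) C_ge0.
Qed.

Let int_HD t l m :
  rintegrable mu orth (fun V => avg t (H l m) (X V) * ((l == m)%:R - trace2 A l m V)).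
Proof.
apply: rintegrable_bounded.
  apply: measurable_funM; first exact: measurable_lip_trace (lip_avg t (@lip_H l m)).
  by apply: measurable_funB => //; exact: measurable_trace2.
apply: bounded_orthM; first exact: lip_trace_bounded (lip_avg t (@lip_H l m)) C_ge0.
apply: bounded_orthB; first exact: bounded_orth_cst.
exact: bounded_orth_trace2.
Qed.

Definition interpolant_speed t : R := \int[mu]_(V in orth) mean_speed t (X V).

Let int_speed1 t : rintegrable mu orth
  (fun V => - sin t * (\sum_l X V 0 l * avg t (G l) (X V))).
Proof. by apply: rintegrableZ => //; apply: rintegrable_sum => //. Qed.

Let int_speed2 t : rintegrable mu orth
  (fun V => cos t * sin t * \sum_l avg t (H l l) (X V)).
Proof. by apply: rintegrableZ => //; apply: rintegrable_sum => //. Qed.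

Lemma is_derive_interpolant t : is_derive t (1 : R) interpolant (interpolant_speed t).
Proof.
have [B hB] := trace_vector_bounded A.
have [K hK] := gavg_path B.
apply: (is_derive_of_taylor (C := K)) => u _.
have ig s : rintegrable mu orth (fun V => avg s g (X V)).
  apply: rintegrable_bounded.
    exact: measurable_lip_trace (lip_avg s lip_g).
  exact: lip_trace_bounded (lip_avg s lip_g) C_ge0.
have iS : rintegrable mu orth (fun V => mean_speed t (X V)) by exact: rintegrableD.
rewrite -[leRHS](Rintegral_orth_cst mu_haar).
apply: (Rintegral_first_order (t := u) mO (ig _) (ig _) iS (rintegrable_cst mu mO _)).
by move=> V hV; apply: hK; exact: hB.
Qed.

(** Splitting [n * delta - trace2] as [(delta - trace2) + (n - 1) * delta], the last part cancels
    the Laplacian term coming from the Gaussian side, so that only the deviation remains. *)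
Lemma interpolant_speedE t : (n%:R - 1) * interpolant_speed t =
  - cos t * (sin t * \int[mu]_(V in orth)
     (\sum_l \sum_m avg t (H l m) (X V) * ((l == m)%:R - trace2 A l m V))).
Proof.
have := haar_ibp mu_haar A_orthogonal C_ge0
  (fun l => gavg_smooth1 Z_normal (sin t) C_ge0 (cos1 t) (g_smooth.2 l)).
set I1 := \int[mu]_(_ in _) _ => hI1.
have iS1 : rintegrable mu orth (fun V => \sum_l X V 0 l * avg t (G l) (X V)).
  exact: rintegrable_sum.
have iS2 : rintegrable mu orth (fun V => \sum_l avg t (H l l) (X V)).
  exact: rintegrable_sum.
have iS3 : rintegrable mu orth (fun V => \sum_l \sum_m
    avg t (H l m) (X V) * ((l == m)%:R - trace2 A l m V)).
  by do 2 (apply: rintegrable_sum => // ?).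
have -> : interpolant_speed t = - sin t * I1 +
    cos t * sin t * \int[mu]_(V in orth) \sum_l avg t (H l l) (X V).
  rewrite /interpolant_speed /mean_speed RintegralD//; [|exact: int_speed1|exact: int_speed2].
  by rewrite !RintegralZl.
rewrite mulrDr mulrCA hI1.
set J := \int[mu]_(_ in _) _; set I2 := \int[mu]_(_ in _) _; set I3 := \int[mu]_(_ in _) _.
have -> : J = cos t * (I3 + (n%:R - 1) * I2).
  rewrite /I3 /I2 -RintegralZl// -RintegralD//; last exact: rintegrableZ.
  rewrite -RintegralZl//; last by apply: rintegrableD => //; exact: rintegrableZ.
  apply: eq_Rintegral => V _; rewrite mulrDr mulrA !mulr_sumr -big_split/=.
  apply: eq_bigr => l _.
  rewrite -[avg t (H l l) (X V)](sum_delta (fun m => avg t (H l m) (X V))).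
  rewrite !mulr_sumr -big_split/=; apply: eq_bigr => m _; ring.
ring.
Qed.

(* A second Gaussian integration by parts turns [H] into [G], which pairs with a
   vector at the cost of [L] only; [kappa] is an AM-GM parameter replacing the
   square root of Cauchy-Schwarz. *)
Lemma hessian_pairing (D : 'I_k -> 'I_k -> R) t x kappa : 0 < kappa ->
  `|sin t * \sum_l \sum_m avg t (H l m) x * D l m| <=
  L * ((\sum_l \sum_m D l m ^+ 2 + kappa ^+ 2) / (2 * kappa)).
Proof.
move=> kappa0.
pose Y w : 'rV[R]_k := cos t *: x + sin t *: rvec Z w.
(* The matrix [D] applied to the Gaussian vector; its mean squared length is the squared Frobenius
   norm of [D]. *)
pose v w : 'rV[R]_k := \row_l \sum_m D l m * Z m w.
have iZG l m : rintegrable Q setT (fun w => D l m * (Z m w * G l (Y w))).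
  by apply: rintegrableZ => //; exact: rintegrable_ZG.
have -> : sin t * \sum_l \sum_m avg t (H l m) x * D l m =
    \int[Q]_w (\sum_l \sum_m D l m * (Z m w * G l (Y w))).
  rewrite Rintegral_sum//; last by move=> l; apply: rintegrable_sum => // ?.
  rewrite mulr_sumr; apply: eq_bigr => l _.
  rewrite Rintegral_sum// mulr_sumr; apply: eq_bigr => m _.
  rewrite RintegralZl; [|exact: measurableT|exact: rintegrable_ZG].
  rewrite (gavg_ibp Z_normal Z_indep (cos t) x m C_ge0 (sin1 t) (g_smooth.2 l)).
  by rewrite [RHS]mulrC mulrA.
have [iq eq] := gaussian_quadratic Z_normal Z_indep D.
have icst := rintegrable_cst Q measurableT (kappa ^+ 2).
have iqc : rintegrable Q setT (fun w => \sum_l (\sum_m D l m * Z m w) ^+ 2 + kappa ^+ 2).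
  exact: rintegrableD.
have -> : L * ((\sum_l \sum_m D l m ^+ 2 + kappa ^+ 2) / (2 * kappa)) =
    \int[Q]_w (L / (2 * kappa) * (\sum_l (\sum_m D l m * Z m w) ^+ 2 + kappa ^+ 2)).
  rewrite RintegralZl// RintegralD// eq Rintegral_prob_cst.
  by rewrite -mulrA; congr (_ * _); rewrite mulrC.
apply: le_norm_Rintegral => //.
- by do 2 (apply: rintegrable_sum => // ?).
- exact: rintegrableZ.
move=> w _.
have -> : \sum_l \sum_m D l m * (Z m w * G l (Y w)) = \sum_l G l (Y w) * v w 0 l.
  apply: eq_bigr => l _; rewrite mxE mulr_sumr; apply: eq_bigr => m _; ring.
apply: le_trans (smooth1_euclidean (Y w) (v w) g_smooth.1 g_lip) _.
rewrite -mulrA ler_wpM2l//.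
have -> : \sum_l (\sum_m D l m * Z m w) ^+ 2 = euclidean_norm (v w) ^+ 2.
  rewrite /euclidean_norm sqr_sqrtr; last by apply: sumr_ge0 => l _; exact: sqr_ge0.
  by apply: eq_bigr => l _; rewrite mxE.
rewrite mulrC ler_pdivlMr ?mulr_gt0//.
by have := sqr_ge0 (euclidean_norm (v w) - kappa); lra.
Qed.

Lemma interpolant_speed_bound t :
  `|interpolant_speed t| <= Num.sqrt 2 * L * k%:R / (n%:R - 1) * `|cos t|.
Proof.
have n10 : 0 < n%:R - 1 :> R by rewrite subr_gt0 ltr1n.
rewrite -(ler_pM2l n10) -{1}(gtr0_norm n10) -normrM interpolant_speedE.
rewrite normrM normrN mulrA [(_ - 1) * _]mulrC divfK ?gt_eqF// [leRHS]mulrC.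
rewrite ler_wpM2l//.
set S := fun V : 'M[R]_n => \sum_l \sum_m
  avg t (H l m) (X V) * ((l == m)%:R - trace2 A l m V).
(* With [k = 0] all sums are empty; this case is separate because [kappa] has to be positive. *)
have [k0|k0] := posnP k.
  have S0 V : S V = 0.
    by rewrite /S big1// => l _; have := ltn_ord l; rewrite {2}k0.
  under eq_Rintegral do rewrite -/(S _) S0.
  by rewrite (Rintegral_orth_cst mu_haar) mulr0 normr0 !mulr_ge0// sqrtr_ge0.
(* [kappa ^+ 2] is the bound [2 * k ^ 2] on the mean of the sum of squared deviations, and thus the
   optimal parameter in the AM-GM step. *)
pose kappa : R := Num.sqrt 2 * k%:R.
have kappa0 : 0 < kappa by rewrite mulr_gt0 ?sqrtr_gt0 ?ltr0n.
have iS : rintegrable mu orth S by do 2 (apply: rintegrable_sum => // ?).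
have iD2 l m : rintegrable mu orth (fun V => ((l == m)%:R - trace2 A l m V) ^+ 2).
  have mD : measurable_fun setT ((fun V => (l == m)%:R - trace2 A l m V) : borel_mx R n -> R).
    by apply: measurable_funB => //; exact: measurable_trace2.
  have bD : bounded_orth (fun V => (l == m)%:R - trace2 A l m V).
    by apply: bounded_orthB; [exact: bounded_orth_cst|exact: bounded_orth_trace2].
  by apply: rintegrable_bounded; [exact: measurable_funX|exact: bounded_orthM].
have iD : rintegrable mu orth (fun V => \sum_l \sum_m ((l == m)%:R - trace2 A l m V) ^+ 2).
  by do 2 (apply: rintegrable_sum => // ?).
have iDk : rintegrable mu orth (fun V =>
    \sum_l \sum_m ((l == m)%:R - trace2 A l m V) ^+ 2 + kappa ^+ 2).
  by apply: rintegrableD => //; exact: rintegrable_cst.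
rewrite -RintegralZl//.
apply: (@le_trans _ _ (\int[mu]_(V in orth) (L / (2 * kappa) *
    (\sum_l \sum_m ((l == m)%:R - trace2 A l m V) ^+ 2 + kappa ^+ 2)))).
  apply: le_norm_Rintegral => //; [exact: rintegrableZ|exact: rintegrableZ|].
  move=> V _; rewrite (le_trans (hessian_pairing (fun l m => _) t (X V) kappa0))//.
  by rewrite -mulrA ler_wpM2l// mulrC.
rewrite RintegralZl// RintegralD//; last exact: rintegrable_cst.
rewrite (Rintegral_orth_cst mu_haar).
have hD : \int[mu]_(V in orth) (\sum_l \sum_m ((l == m)%:R - trace2 A l m V) ^+ 2) <=
    kappa ^+ 2.
  rewrite Rintegral_sum//; last by move=> l; apply: rintegrable_sum => // ?.
  have -> : kappa ^+ 2 = \sum_(l < k) \sum_(m < k) 2.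
    rewrite !sumr_const card_ord -[_ *+ k *+ k]mulr_natr -[_ *+ k]mulr_natr.
    by rewrite /kappa exprMn sqr_sqrtr// expr2 mulrA.
  apply: ler_sum => l _; rewrite Rintegral_sum//; apply: ler_sum => m _.
  exact: trace2_variance.
apply: (@le_trans _ _ (L / (2 * kappa) * (kappa ^+ 2 + kappa ^+ 2))).
  by rewrite ler_wpM2l ?lerD2r// divr_ge0// mulr_ge0// ltW.
rewrite (_ : L / (2 * kappa) * _ = L * kappa); last by field; rewrite gt_eqF.
by rewrite /kappa mulrA (mulrC L).
Qed.

(** The speed bound is integrated by monotonicity: for [a] equal to [1] or [-1], the function
    [a * interpolant - K * sin] has nonpositive derivative on [[0, pi / 2]], and the sine rises from
    [0] to [1] there. *)
Lemma normal_approximation_smooth :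
  `|\int[mu]_(V in orth) g (X V) - \int[Q]_w g (rvec Z w)| <=
  Num.sqrt 2 * L * k%:R / (n%:R - 1).
Proof.
have growth (p q K' : R) : p - K' * 1 - (q - K' * 0) <= 0 -> p - q <= K' by lra.
have arith (p q K' : R) : 1 * (p - q) <= K' -> -1 * (p - q) <= K' -> `|q - p| <= K'.
  by move=> h1 h2; rewrite ler_norml; apply/andP; split; lra.
set K := Num.sqrt 2 * L * k%:R / (n%:R - 1).
have e0 : interpolant 0 = \int[mu]_(V in orth) g (X V).
  apply: eq_Rintegral => V _; rewrite /gavg cos0 sin0.
  transitivity (\int[Q]_w g (X V)); last exact: Rintegral_prob_cst.
  by apply: eq_Rintegral => w _; rewrite scale1r scale0r addr0.
have e1 : interpolant (pi / 2) = \int[Q]_w g (rvec Z w).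
  rewrite -[RHS](Rintegral_orth_cst mu_haar); apply: eq_Rintegral => V _.
  rewrite /gavg cos_pihalf sin_pihalf; apply: eq_Rintegral => w _.
  by rewrite scale0r scale1r add0r.
have i0 : (0 : R) \in `[0, pi / 2] by rewrite in_itv/= lexx divr_ge0// pi_ge0.
have i1 : (pi / 2 : R) \in `[0, pi / 2] by rewrite in_itv/= lexx divr_ge0// pi_ge0.
have ds a (t : R) : is_derive t (1 : R) (fun u => a * interpolant u - K * sin u)
    (a * interpolant_speed t - K * cos t).
  have di := is_derive_interpolant t; apply: is_derive_eq.
  by rewrite /GRing.scale/= ?mulr0 ?addr0 ?add0r.
have key a : `|a| = 1 -> a * (interpolant (pi / 2) - interpolant 0) <= K.
  move=> a1; have [c [cI _ e]] := mvt_diff i0 i1 (fun t _ => ds a t).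
  have c0 : 0 <= cos c.
    move: cI; rewrite in_itv/= => /andP[c0 c1]; apply: cos_ge0_pihalf.
    by rewrite c1 andbT (le_trans _ c0)// oppr_le0 divr_ge0// pi_ge0.
  have h := interpolant_speed_bound c; rewrite -/K (ger0_norm c0) in h.
  have h2 : a * interpolant_speed c <= K * cos c.
    by rewrite (le_trans (ler_norm _))// normrM a1 mul1r.
  have h3 : (a * interpolant_speed c - K * cos c) * (pi / 2 - 0) <= 0.
    by rewrite mulr_le0_ge0 ?subr_le0// subr0 divr_ge0// pi_ge0.
  have {}e : a * interpolant (pi / 2) - K * sin (pi / 2) -
      (a * interpolant 0 - K * sin 0) =
      (a * interpolant_speed c - K * cos c) * (pi / 2 - 0) by exact: e.
  rewrite sin0 sin_pihalf in e.
  by rewrite mulrBr; apply: growth; rewrite e.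
rewrite -e0 -e1; apply: arith; apply: key; first exact: normr1.
by rewrite normrN normr1.
Qed.

End interpolation.

(** * The supremum of ratios is a valid Lipschitz constant *)

Section lipschitz_constant_facts.
Variables (R : realType) (k : nat) (f : 'rV[R]_k -> R).
Hypothesis hf : euclidean_lipschitz f.

Lemma euclidean_norm_gt0 (x : 'rV[R]_k) : x != 0 -> 0 < euclidean_norm x.
Proof.
move=> x0; rewrite sqrtr_gt0 lt_neqAle sumr_ge0 ?andbT => [|i _]; last exact: sqr_ge0.
apply: contraNneq x0 => /esym/eqP; rewrite psumr_eq0 => [/allP h|i _]; last exact: sqr_ge0.
apply/eqP/rowP => i; rewrite mxE; apply/eqP.
by rewrite -sqrf_eq0; apply: h; rewrite mem_index_enum.
Qed.

Let ratios : set R := [set r : R | exists x y : 'rV[R]_k,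
  x != y /\ r = `|f x - f y| / euclidean_norm (x - y)].

Let ratios_ub : has_ubound ratios.
Proof.
have [L hL] := hf; exists L => _ [x [y [xy ->]]].
by rewrite ler_pdivrMr// euclidean_norm_gt0// subr_eq0.
Qed.

Lemma lipschitz_constant_ge0 : 0 <= lipschitz_constant f.
Proof.
rewrite /lipschitz_constant -/ratios.
(* There are no ratios when no two points are distinct, as for [k = 0]; the supremum is then [0] by
   convention. *)
have [->|/set0P[r hr]] := eqVneq ratios set0; first by rewrite sup0.
apply: (@le_trans _ _ r); last exact: (ub_le_sup ratios_ub).
by have [x [y [_ ->]]] := hr; rewrite divr_ge0// sqrtr_ge0.
Qed.

Lemma lipschitz_constantP x y :
  `|f x - f y| <= lipschitz_constant f * euclidean_norm (x - y).
Proof.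
have [->|xy] := eqVneq x y.
  by rewrite !subrr normr0 mulr_ge0 ?lipschitz_constant_ge0 ?sqrtr_ge0.
rewrite -ler_pdivrMr ?euclidean_norm_gt0 ?subr_eq0//.
by apply: (ub_le_sup ratios_ub); exists x, y.
Qed.

End lipschitz_constant_facts.

(** * From smooth to Lipschitz test functions, and from the matrix law to the random matrix *)

Section normal_approximation.
Variables (R : realType) (n k : nat).
Notation orth := (@orthogonal_group R n).
Variable mu : probability (borel_mx R n) R.
Hypothesis mu_haar : haar_orthogonal mu.
Hypothesis n_gt1 : (2 <= n)%N.
Let mO := @measurable_orthogonal R n.
Variable A : 'I_k -> 'M[R]_n.
Hypothesis A_orthogonal : forall i j, \tr (A i *m (A j)^T) = n%:R * (i == j)%:R.
Context d' (T' : measurableType d') (Q : probability T' R).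
Variable Z : 'I_k -> {RV Q >-> R}.
Hypothesis Z_normal : forall i : 'I_k, standard_normal (Z i).
Hypothesis Z_indep : mutually_independent Z.

Lemma rintegrable_lip_trace C f : 0 <= C -> lip C f ->
  rintegrable mu orth (fun V => f (trace_vector A V)).
Proof.
move=> C0 lf; apply: rintegrable_bounded.
  exact: measurable_lip_trace lf.
exact: lip_trace_bounded lf C0.
Qed.

Lemma rintegrable_lip_gauss C f : lip C f -> rintegrable Q setT (fun w => f (rvec Z w)).
Proof.
move=> lf; have := rintegrable_lip_shift Z_normal 0 1 lf.
by under eq_fun do rewrite add0r scale1r.
Qed.

(** A uniform approximation within [e / 2] changes each expectation by at most [e / 2]. The smooth
    bound involves [L] only, so the constants that blow up with [e] do no harm. *)
Lemma normal_approximation L f : 0 <= L ->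
  (forall x y, `|f x - f y| <= L * euclidean_norm (x - y)) ->
  `|\int[mu]_(V in orth) f (trace_vector A V) - \int[Q]_w f (rvec Z w)| <=
  Num.sqrt 2 * L * k%:R / (n%:R - 1).
Proof.
have arith (a b c d e K : R) : `|a - c| <= e / 2 -> `|b - d| <= e / 2 ->
    `|a - b| <= K -> `|c - d| <= K + e.
  rewrite !ler_norml => /andP[? ?] /andP[? ?] /andP[? ?].
  by apply/andP; split; lra.
move=> L0 fL; apply/ler_addgt0Pr => e e0.
have e20 : 0 < e / 2 by rewrite divr_gt0.
have [C [g [G [H [C0 gf gL gS]]]]] := smooth_approximation L0 e20 fL.
have lf := lip_euclidean L0 fL; have [[lg _ _] _] := gS.
have close1 : `|\int[mu]_(V in orth) g (trace_vector A V) -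
    \int[mu]_(V in orth) f (trace_vector A V)| <= e / 2.
  have i1 := rintegrable_lip_trace C0 lg; have i2 := rintegrable_lip_trace L0 lf.
  rewrite -RintegralB// -[leRHS](Rintegral_orth_cst mu_haar).
  apply: le_norm_Rintegral => //; [exact: rintegrableB|exact: rintegrable_cst].
have close2 : `|\int[Q]_w g (rvec Z w) - \int[Q]_w f (rvec Z w)| <= e / 2.
  have i1 := rintegrable_lip_gauss lg; have i2 := rintegrable_lip_gauss lf.
  rewrite -RintegralB// -[leRHS](Rintegral_prob_cst Q).
  by apply: le_norm_Rintegral => //; [exact: rintegrableB|exact: rintegrable_cst].
apply: arith close1 close2 _.
exact: (normal_approximation_smooth mu_haar n_gt1 A_orthogonal Z_normal Z_indep L0 C0 gL gS).
Qed.

End normal_approximation.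

Theorem theorem12 (R : realType) (n k : nat) (hn : (2 <= n)%N)
    (A : 'I_k -> 'M[R]_n)
    (hA : forall i j : 'I_k, \tr (A i *m (A j)^T) = n%:R * (i == j)%:R)
    (d : measure_display) (T : measurableType d) (P : probability T R)
    (M : {RV P >-> borel_mx R n})
    (hM : haar_orthogonal (distribution P M))
    (d' : measure_display) (T' : measurableType d') (Q : probability T' R)
    (Z : 'I_k -> {RV Q >-> R})
    (hZ_normal : forall i : 'I_k, standard_normal (Z i))
    (hZ_indep : mutually_independent Z)
    (f : 'rV[R]_k -> R) (hf : euclidean_lipschitz f) :
  (`| 'E_P[fun w => f (\row_(i < k) \tr (A i *m (M w : 'M[R]_n)))]
      - 'E_Q[fun w => f (\row_(i < k) Z i w)] |
   <= (Num.sqrt 2 * lipschitz_constant f * k%:R / (n%:R - 1))%:E)%E.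
Proof.
set L := lipschitz_constant f.
have L0 : 0 <= L := lipschitz_constant_ge0 hf.
have fL := lipschitz_constantP hf.
have lf := lip_euclidean L0 fL.
pose mu : probability (borel_mx R n) R := distribution P M.
have mO := @measurable_orthogonal R n.
have iO := rintegrable_lip_trace mu A L0 lf.
have mf := measurable_lip_trace A lf.
have mOC : measurable (~` (@orthogonal_group R n) : set (borel_mx R n)).
  exact: measurableC.
(* [M] is orthogonal only almost surely: the complement is null, so expectations over the whole
   space reduce to integrals over the group. *)
have muOC : mu (~` (@orthogonal_group R n)) = 0%E.
  have h := probability_setC mu mO.
  by rewrite h (_ : mu _ = 1%E) ?subee//; exact: hM.1.
have mEf : measurable_fun setT (EFin \o (fun V : borel_mx R n => f (trace_vector A V))).
  exact/measurable_EFinP.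
have OCC : setT `\` ~` (@orthogonal_group R n) = @orthogonal_group R n.
  by rewrite setTD setCK.
have iT : rintegrable mu setT (fun V : borel_mx R n => f (trace_vector A V)).
  apply: (negligible_integrable mOC measurableT mEf muOC).2.
  by rewrite OCC.
have eT : \int[mu]_V f (trace_vector A V) =
    \int[mu]_(V in @orthogonal_group R n) f (trace_vector A V).
  congr fine; rewrite (negligible_integral mOC measurableT iT muOC).
  by rewrite OCC.
(* The identity under the distribution of [M] and [M] itself under [P] have the same law by
   definition. *)
have [iP eP] := same_law_integral (m1 := mu) (m2 := P) (Y1 := fun V : borel_mx R n => V)
  (Y2 := M) (@measurable_id _ _ setT) (measurable_funPT M) (fun B mB => erefl) measurableT mf iT.
have EP : ('E_P[fun w => f (trace_vector A (M w))])%E =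
    (\int[mu]_V f (trace_vector A V))%:E.
  rewrite eP unlock fineK //. exact: (integrable_fin_num measurableT iP).
have iQ := rintegrable_lip_gauss hZ_normal lf.
have EQ : ('E_Q[fun w => f (rvec Z w)])%E = (\int[Q]_w f (rvec Z w))%:E.
  rewrite unlock fineK //; exact: (integrable_fin_num measurableT iQ).
have := normal_approximation hM hn hA hZ_normal hZ_indep L0 fL.
by rewrite -eT -lee_fin -abse_EFin EFinB -EP -EQ.
Qed.
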